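(* Let $1<p<\infty$, $-\frac np<r<0$, $r+\varrho=-n$ and let $w\in A_p$. Then the dual space of $\overset{\circ}{L}{}^r_p(w,\mathbb{R}^n)$ is $H^{\varrho}L_{p'}(w,\mathbb{R}^n)$. More precisely, $g\in\big(\overset{\circ}{L}{}^r_p(w,\mathbb{R}^n)\big)'$ if, and only if, $g$ can be uniquely represented as $$g(f)=\int_{\mathbb{R}^n}\widetilde g(x)f(x)\,dx\qquad\text{for all } f\in L_{-\frac nr,w}(\mathbb{R}^n)$$ where $\widetilde g\in H^{\varrho}L_{p'}(w,\mathbb{R}^n)$ (that is: every bounded linear functional $g$ has such a representation with a unique $\widetilde g$, and every $\widetilde g\in H^{\varrho}L_{p'}(w,\mathbb{R}^n)$ induces a bounded linear functional in this way), and $$\Big\|g\,\Big|\big(\overset{\circ}{L}{}^r_p(w,\mathbb{R}^n)\big)'\Big\|\cong\|\widetilde g|H^{\varrho}L_{p'}(w,\mathbb{R}^n)\|$$ with equivalence constants independent of $g$.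
   Context: All functions are complex-valued; $p'=p/(p-1)$; $w(M)=\int_M w(x)\,dx$. $D(\mathbb{R}^n)$ denotes the compactly supported infinitely differentiable functions. $A_p$ ($1<p<\infty$): $w\in L_1^{\mathrm{loc}}(\mathbb{R}^n)$ with $w>0$ a.e. belongs to $A_p$ if $[w]_{A_p}=\sup_Q \frac{w(Q)}{|Q|}\big(\frac{w^{1-p'}(Q)}{|Q|}\big)^{p-1}<\infty$, the supremum over all cubes with sides parallel to the axes. $\|f|L_{p,w}(M)\|=(\int_M|f(x)|^pw(x)\,dx)^{1/p}$; $Q_{J,M}=2^{-J}(M+[-1,1]^n)$ for $J\in\mathbb{Z}$, $M\in\mathbb{Z}^n$. Weighted Morrey space: $L^r_p(w,\mathbb{R}^n)$ consists of all $f\in L_1^{\mathrm{loc}}(\mathbb{R}^n)$ with $\|f|L^r_p(w,\mathbb{R}^n)\|=\sup_{J\in\mathbb{Z},M\in\mathbb{Z}^n}w(Q_{J,M})^{-(\frac1p+\frac rn)}\|f|L_{p,w}(Q_{J,M})\|<\infty$. $\overset{\circ}{L}{}^r_p(w,\mathbb{R}^n)$ is the completion (closure) of $D(\mathbb{R}^n)$ in $L^r_p(w,\mathbb{R}^n)$; it contains $L_{-n/r,w}(\mathbb{R}^n)$. Space $H^{\varrho}L_q(w,\mathbb{R}^n)$ ($1<q<\infty$, $-n<\varrho<-n/q$, $w\in A_{q'}$): all $h\in S'(\mathbb{R}^n)$ representable as $h=\sum_{J\in\mathbb{Z},M\in\mathbb{Z}^n}h_{J,M}$ in $S'(\mathbb{R}^n)$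 with $\operatorname{supp}h_{J,M}\subset Q_{J,M}$ and $\sum_{J,M}w(Q_{J,M})^{-(\frac1q+\frac\varrho n)}\|h_{J,M}w^{-1/q'}|L_q(\mathbb{R}^n)\|<\infty$; the norm is the infimum of these sums over all such representations. Here $q=p'$, $q'=p$. Elements of $H^{\varrho}L_q(w,\mathbb{R}^n)$ are regular distributions (they lie in $L_{u,w^{1-u}}(\mathbb{R}^n)$ with $u=-n/\varrho$) and are identified with functions. $(X)'$ is the space of bounded linear functionals on $X$ with the usual dual norm. $A\cong B$ means $cA\le B\le CA$ for constants $c,C>0$. *)

(* Defs.v *)
From HB Require Import structures.
From mathcomp Require Import all_boot all_order all_algebra.
From mathcomp Require Import complex.
From mathcomp Require Import all_classical all_reals all_analysis.
From mathcomp Require summability.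

Set Implicit Arguments.
Unset Strict Implicit.
Unset Printing Implicit Defensive.

Import Order.TTheory GRing.Theory Num.Theory.
Import numFieldNormedType.Exports.
Import Normc.

Local Open Scope classical_set_scope.
Local Open Scope ring_scope.

(* The sigma-algebra of 'rV[R]_n is the product one, i.e. the Borel sets.  This
   loses nothing against Lebesgue measurability: all function spaces below are
   insensitive to null sets, and every Lebesgue measurable function has a Borel
   representative. *)
Section measurable_rV.
Context {R : realType}.

Definition rV_display : measure_display.
Proof. exact: default_measure_display. Qed.

Definition rV_coord n (i : 'I_n) (x : 'rV[R]_n) : measurableTypeR R := x 0 i.

Let rV_set0 n : g_sigma_preimage (@rV_coord n) set0.
Proof. exact: sigma_algebra0. Qed.

Let rV_setC n A :
  g_sigma_preimage (@rV_coord n) A -> g_sigma_preimage (@rV_coord n) (~` A).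
Proof. exact: sigma_algebraC. Qed.

Let rV_bigcup n (F : (set 'rV[R]_n)^nat) :
  (forall i, g_sigma_preimage (@rV_coord n) (F i)) ->
  g_sigma_preimage (@rV_coord n) (\bigcup_i (F i)).
Proof. exact: sigma_algebra_bigcup. Qed.

HB.instance Definition _ n := @isMeasurable.Build rV_display 'rV[R]_n
  (g_sigma_preimage (@rV_coord n)) (@rV_set0 n) (@rV_setC n) (@rV_bigcup n).

Lemma measurable_rV_coord n (i : 'I_n) :
  measurable_fun [set: 'rV[R]_n] (rV_coord i).
Proof.
move=> _ Y mY; rewrite setTI; apply: sub_sigma_algebra => /=.
rewrite -bigcup_seq/=; exists i => /=; first by rewrite mem_index_enum.
by exists Y => //; rewrite setTI.
Qed.

Lemma measurable_fun_rVP d (T : measurableType d) n (f : T -> 'rV[R]_n) :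
  (forall i, measurable_fun [set: T] (rV_coord i \o f)) ->
  measurable_fun [set: T] f.
Proof.
move=> mf.
have prefS : g_sigma_preimage (fun i => rV_coord i \o f) `<=` measurable.
  apply: smallest_sub; first exact: sigma_algebra_measurable.
  case: n => [|n] in f mf *; first by rewrite big_ord0.
  rewrite -bigcup_mkord_ord; apply: bigcup_sub => i Ii.
  by move=> A [B mB <-]; exact: mf.
move: prefS; rewrite g_sigma_preimage_comp => prefS _ A mA.
by apply: prefS; exists A.
Qed.

Definition rV_cons n (x : measurableTypeR R * 'rV[R]_n) : 'rV[R]_n.+1 :=
  row_mx (const_mx x.1 : 'rV_1) x.2.

Definition rV_uncons n (x : 'rV[R]_n.+1) : measurableTypeR R * 'rV[R]_n :=
  (x 0 0, \row_i x 0 (lift ord0 i)).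

Lemma rV_cons0 n a (y : 'rV[R]_n) : rV_cons (a, y) 0 ord0 = a.
Proof.
have := row_mxEl (const_mx a : 'rV_1) y 0 0; rewrite [RHS]mxE; apply: etrans.
by congr (fun_of_matrix _ _ _); exact: val_inj.
Qed.

Lemma rV_consS n a (y : 'rV[R]_n) i : rV_cons (a, y) 0 (lift ord0 i) = y 0 i.
Proof.
apply: etrans (row_mxEr (const_mx a : 'rV_1) y 0 i).
by congr (fun_of_matrix _ _ _); exact: val_inj.
Qed.

Lemma rV_unconsK n : cancel (@rV_cons n) (@rV_uncons n).
Proof.
move=> [a y]; rewrite /rV_uncons rV_cons0; congr pair.
by apply/rowP => i; rewrite mxE rV_consS.
Qed.

Lemma measurable_rV_cons n : measurable_fun setT (@rV_cons n).
Proof.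
apply: measurable_fun_rVP => i; have [j ->|->] := unliftP ord0 i.
  rewrite (_ : _ \o _ = rV_coord j \o snd).
    by apply: measurableT_comp; [exact: measurable_rV_coord|exact: measurable_snd].
  by apply/funext => -[a y]; exact: rV_consS.
rewrite (_ : _ \o _ = fst); first exact: measurable_fst.
by apply/funext => -[a y]; exact: rV_cons0.
Qed.

Lemma measurable_rV_uncons n : measurable_fun setT (@rV_uncons n).
Proof.
apply: measurable_fun_pair; first exact: measurable_rV_coord.
apply: measurable_fun_rVP => i.
rewrite (_ : _ \o _ = rV_coord (lift ord0 i)); first exact: measurable_rV_coord.
by apply/funext => x; rewrite /rV_coord /= mxE.
Qed.

End measurable_rV.

Section lebesgue_rV.
Context {R : realType}.

Section step.
Variables (n : nat) (m : {sigma_finite_measure set 'rV[R]_n -> \bar R}).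

Definition rV_measureS : set 'rV[R]_n.+1 -> \bar R :=
  pushforward (@lebesgue_measure R \x m)%E (@rV_cons R n).

Let mcons := @measurable_rV_cons R n.

Let rV_measureS0 : rV_measureS set0 = 0%E.
Proof. exact: measure0. Qed.

Let rV_measureS_ge0 A : (0 <= rV_measureS A)%E.
Proof. exact: measure_ge0. Qed.

Let rV_measureS_sigma_additive : semi_sigma_additive rV_measureS.
Proof. exact: measure_semi_sigma_additive. Qed.

HB.instance Definition _ := isMeasure.Build _ _ _ rV_measureS
  rV_measureS0 rV_measureS_ge0 rV_measureS_sigma_additive.

Let rV_measureS_sigma_finite : sigma_finite setT rV_measureS.
Proof.
have /sigma_finiteP[F [FT ndF Ffin]] := sigma_finiteT (@lebesgue_measure R).
have /sigma_finiteP[G [GT ndG Gfin]] := sigma_finiteT m.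
exists (fun k => @rV_uncons R n @^-1` (F k `*` G k)).
  rewrite -preimage_bigcup (_ : \bigcup_k (F k `*` G k) = setT) ?preimage_setT//.
  rewrite -setXTT FT GT predeqE => -[x y]; split.
    by move=> [k _ []/= ? ?]; split; exists k.
  move=> [/= [k _ Fkx] [l _ Gly]]; exists (maxn k l) => //; split.
  - by move: x Fkx; exact/subsetPset/ndF/leq_maxl.
  - by move: y Gly; exact/subsetPset/ndG/leq_maxr.
move=> k; have [mF Fk] := Ffin k; have [mG Gk] := Gfin k; split.
  rewrite -[X in measurable X]setTI; apply: measurable_rV_uncons => //.
  exact: measurableX.
rewrite /rV_measureS /pushforward -comp_preimage (_ : _ \o _ = id); last first.
  by apply/funext => x /=; rewrite rV_unconsK.
by rewrite preimage_id product_measure1E// lte_mul_pinfty// ge0_fin_numE.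
Qed.

HB.instance Definition _ := Measure_isSigmaFinite.Build _ _ _ rV_measureS
  rV_measureS_sigma_finite.

End step.

Fixpoint lebesgue_rV n : {sigma_finite_measure set 'rV[R]_n -> \bar R} :=
  if n is n'.+1 then rV_measureS (lebesgue_rV n')
  else dirac (0 : 'rV[R]_0).

End lebesgue_rV.

Lemma lebesgue_rV_box {R : realType} n (A : 'I_n -> set (measurableTypeR R)) :
  (forall i, measurable (A i)) ->
  lebesgue_rV n [set x | forall i, A i (x 0 i)] =
  (\prod_(i < n) lebesgue_measure (A i))%E.
Proof.
elim: n A => [|n IHn] A mA; first by rewrite big_ord0 /= diracE mem_set//= => -[].
have mB : measurable [set x : 'rV[R]_n | forall i, A (lift ord0 i) (x 0 i)].
  rewrite (_ : mkset _ = \bigcap_(i in [set: 'I_n])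
      (rV_coord i @^-1` (A (lift ord0 i)))).
    apply: fin_bigcap_measurable; first exact: finite_finset.
    by move=> i _; rewrite -[X in measurable X]setTI; exact: measurable_rV_coord.
  by apply/seteqP; split=> [x /= Ax i _|x /= Ax i]; [exact: Ax|exact: (Ax i)].
rewrite big_ord_recl -IHn//.
apply: etrans (product_measure1E lebesgue_measure (lebesgue_rV n) (mA ord0) mB).
congr (product_measure1 _ _ _); apply/seteqP; split=> -[a y] /=.
- move=> Aay; split=> [|i]; first by have := Aay ord0; rewrite rV_cons0.
  by have := Aay (lift ord0 i); rewrite rV_consS.
- move=> [Aa Ay] i; have [j ->|->] := unliftP ord0 i; last by rewrite rV_cons0.
  by rewrite rV_consS; exact: Ay.
Qed.

Section complex_functions.
Context {R : realType} {n : nat}.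
Notation V := 'rV[R]_n.
Notation mu := (lebesgue_rV n : {measure set V -> \bar R}).
Implicit Types (D : set V) (f g h phi : V -> R[i]) (w : V -> R).

Definition re f : V -> R := fun x => complex.Re (f x).
Definition im f : V -> R := fun x => complex.Im (f x).

Definition cmeasurable f :=
  measurable_fun setT (re f) /\ measurable_fun setT (im f).

Definition cintegrable D f :=
  mu.-integrable D (EFin \o re f) /\ mu.-integrable D (EFin \o im f).

Definition cintegral D f : R[i] :=
  (\int[mu]_(x in D) re f x +i* \int[mu]_(x in D) im f x)%C.

Definition locally_integrable_rV (u : V -> R) :=
  measurable_fun setT u /\
  forall K : set V, compact K -> mu.-integrable K (EFin \o u).

Definition clocally_integrable f :=
  locally_integrable_rV (re f) /\ locally_integrable_rV (im f).

Definition ae_equal f g := {ae mu, forall x, f x = g x}.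

End complex_functions.

Section weights.
Context {R : realType} {n : nat}.
Notation V := 'rV[R]_n.
Notation mu := (lebesgue_rV n : {measure set V -> \bar R}).
Implicit Types (w : V -> R) (p q r : R) (f : V -> R[i]).

Definition conj_exp p : R := p / (p - 1).

(* The closed cube with centre c and half side length l. *)
Definition cube (c : V) (l : R) : set V :=
  [set x | forall i, `|x 0 i - c 0 i| <= l].

Definition weight_measure w (M : set V) : R := \int[mu]_(x in M) w x.

Definition Ap_product p w (Q : set V) : \bar R :=
  let avg (u : V -> R) : \bar R :=
    ((fine (mu Q))^-1%:E * \int[mu]_(x in Q) (u x)%:E)%E in
  (avg w * (avg (fun x => w x `^ (1 - conj_exp p))%R) `^ (p - 1))%E.

Definition Ap p w :=
  [/\ locally_integrable_rV w, {ae mu, forall x, 0 < w x} &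
      (ereal_sup [set Ap_product p w (cube c l) |
                   c in [set: V] & l in [set l : R | (0 < l)%R]] < +oo)%E].

Definition Lpw_norm p w (M : set V) f : \bar R :=
  ((\int[mu]_(x in M) (normc (f x) `^ p * w x)%:E) `^ p^-1)%E.

Definition Lpw p w f := cmeasurable f /\ (Lpw_norm p w setT f < +oo)%E.

(* 2 ^ (-J) (M + [-1, 1]^n) *)
Definition dyadic_cube (JM : int * 'rV[int]_n) : set V :=
  cube ((2 : R) ^ (- JM.1) *: map_mx intr JM.2) ((2 : R) ^ (- JM.1)).

Definition cube_factor p r w (JM : int * 'rV[int]_n) : R :=
  weight_measure w (dyadic_cube JM) `^ (- (p^-1 + r / n%:R)).

Definition morrey_norm r p w f : \bar R :=
  ereal_sup (range (fun JM : int * 'rV[int]_n =>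
    ((cube_factor p r w JM)%:E * Lpw_norm p w (dyadic_cube JM) f)%E)).

Definition morrey r p w f :=
  clocally_integrable f /\ (morrey_norm r p w f < +oo)%E.

End weights.

Section distributions.
Context {R : realType} {n : nat}.
Notation V := 'rV[R]_n.
Notation mu := (lebesgue_rV n : {measure set V -> \bar R}).
Implicit Types (u : V -> R) (phi g : V -> R[i]) (T : (V -> R[i]) -> R[i]).

Definition partial (i : 'I_n) u : V -> R := fun x => 'D_(delta_mx 0 i) u x.

Definition partials (s : seq 'I_n) u : V -> R := foldr partial u s.

Definition smooth u := forall s,
  continuous (partials s u) /\
  forall i x, derivable (partials s u) x (delta_mx 0 i : V).

Definition csmooth phi := smooth (re phi) /\ smooth (im phi).

Definition cpartials (s : seq 'I_n) phi : V -> R[i] :=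
  fun x => (partials s (re phi) x +i* partials s (im phi) x)%C.

Definition test_function phi :=
  csmooth phi /\
  exists K : set V, compact K /\ forall x, ~ K x -> phi x = 0.

Definition schwartz_norm (N : nat) phi : \bar R :=
  ereal_sup [set ((1 + `|x|) ^+ N * normc (cpartials s phi x))%:E |
              s in [set s : seq 'I_n | (size s <= N)%N] & x in [set: V]].

Definition schwartz phi :=
  csmooth phi /\ forall N, (schwartz_norm N phi < +oo)%E.

Definition linear_on (X : set (V -> R[i])) T := forall a f1 f2,
  X f1 -> X f2 -> T (fun x => a * f1 x + f2 x) = a * T f1 + T f2.

Definition bounded_on (X : set (V -> R[i])) (N : (V -> R[i]) -> \bar R) T :=
  exists C : R, forall f, X f -> ((normc (T f))%:E <= C%:E * N f)%E.

(* The norm `|x| of 'rV[R]_n is the maximum norm, which generates the same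
   topology of S as the Euclidean one.  The schwartz_norm N increase with N and
   generate this topology, so a linear form on S is continuous iff it is bounded
   by one of them.  Only the values of T on S are meaningful. *)
Definition tempered T :=
  linear_on schwartz T /\ exists N, bounded_on schwartz (schwartz_norm N) T.

Definition function_distr g : (V -> R[i]) -> R[i] :=
  fun phi => cintegral setT (fun x => g x * phi x).

Definition regular_on_schwartz g :=
  clocally_integrable g /\
  forall phi, schwartz phi -> cintegrable setT (fun x => g x * phi x).

End distributions.

Section predual_space.
Context {R : realType} {n : nat}.
Notation V := 'rV[R]_n.
Notation mu := (lebesgue_rV n : {measure set V -> \bar R}).
Implicit Types (w : V -> R) (q rho : R) (T : (V -> R[i]) -> R[i]).
Implicit Types (g : V -> R[i]) (h : int * 'rV[int]_n -> V -> R[i]).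

Definition sum_in_S' T h := forall phi : V -> R[i], schwartz phi ->
  summability.partial_sum (fun JM => function_distr (h JM) phi)
    @ summability.totally --> (T phi : R[i]^o).

(* As dyadic_cube JM is closed, supp (h JM) is contained in it iff h JM vanishes
   almost everywhere outside it. *)
Definition H_representation T h :=
  [/\ forall JM, cmeasurable (h JM),
      forall JM, {ae mu, forall x, ~ dyadic_cube JM x -> h JM x = 0} &
      sum_in_S' T h].

Definition H_sum rho q w h : \bar R :=
  \esum_(JM in [set: int * 'rV[int]_n])
    ((cube_factor q rho w JM)%:E *
     'N[mu]_q%:E[EFin \o (fun x : V =>
        normc (h JM x * (w x `^ (- (conj_exp q)^-1))%:C%C))%R])%E.

Definition H_space rho q w T :=
  tempered T /\ exists h, H_representation T h /\ (H_sum rho q w h < +oo)%E.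

Definition H_norm rho q w T : \bar R :=
  ereal_inf [set H_sum rho q w h | h in H_representation T].

(* The elements of H_space are regular distributions; H_fun and H_fun_norm
   transport the space and its norm to the functions defining them. *)
Definition H_fun rho q w g :=
  regular_on_schwartz g /\ H_space rho q w (function_distr g).

Definition H_fun_norm rho q w g : \bar R := H_norm rho q w (function_distr g).

End predual_space.

Section dual_space.
Context {R : realType} {n : nat}.
Notation V := 'rV[R]_n.
Implicit Types (w : V -> R) (r p : R) (f : V -> R[i]).

Definition morrey_closure r p w f :=
  morrey r p w f /\
  forall e : R, 0 < e -> exists phi, test_function phi /\
    (morrey_norm r p w (fun x => f x - phi x)%R < e%:E)%E.

(* Functions are not identified modulo null sets; since morrey_norm vanishes
   on the functions that are null almost everywhere, bounded functionals are
   automatically well defined on the classes. *)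
Definition dual (X : set (V -> R[i])) (N : (V -> R[i]) -> \bar R)
    (g : (V -> R[i]) -> R[i]) :=
  linear_on X g /\ bounded_on X N g.

Definition dual_norm (X : set (V -> R[i])) (N : (V -> R[i]) -> \bar R)
    (g : (V -> R[i]) -> R[i]) : \bar R :=
  ereal_sup [set (normc (g f))%:E | f in [set f | X f /\ (N f <= 1)%E]].

Definition represents u w (g : (V -> R[i]) -> R[i]) (gt : V -> R[i]) :=
  forall f, Lpw u w f ->
    cintegrable setT (fun x => gt x * f x) /\
    g f = cintegral setT (fun x => gt x * f x).

End dual_space.

(* Main.v *)
(** Write a_JM and b_JM for the factors of the cube Q_JM in the norms of H^rho L_p'
    and of the Morrey space.  Since r + rho = -n, a_JM = 1 / b_JM, so Hoelder's
    inequality on the cubes makes every representation g = sum h_JM converge almost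
    everywhere and integrate against Morrey functions, with a bound by the sum of
    the norms of the h_JM.

    Conversely, embed L_u,w diagonally (u = -n/r) into the families (f_JM) with
    sup b_JM ||f_JM||_{p,w,Q_JM} finite and extend a functional by Hahn-Banach.
    Restricted to families concentrated on one index, the extension is given by a
    function h_JM on Q_JM, and testing on finite families bounds the sum of the
    a_JM ||h_JM w^(-1/p)||_p' by the norm.  For f in L_u,w the family
    b_JM ||f||_{p,w,Q_JM} tends to zero, because A_p weights are doubling and
    reverse doubling; hence the h_JM represent the functional on L_u,w.

    Uniqueness is the lemma of du Bois-Reymond.  The weight is first replaced by an
    everywhere positive representative of its class. *)

Require Import Defs.
From HB Require Import structures.
From mathcomp Require Import all_boot all_order all_algebra.
From mathcomp Require Import complex.
From mathcomp Require Import all_classical all_reals all_analysis.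
From mathcomp Require Import measurable_realfun.
From mathcomp Require Import ring lra zify.
From mathcomp Require finmap summability.

Set Implicit Arguments.
Unset Strict Implicit.
Unset Printing Implicit Defensive.

Import Order.TTheory GRing.Theory Num.Theory.
Import numFieldNormedType.Exports.
Import Normc.

Local Open Scope classical_set_scope.
Local Open Scope ring_scope.

(** * Cubes and Lebesgue measure *)

(** Extending a functional to all bounded families may create a part that lives at infinity and that
    finite families cannot see, as in the dual of l_infinity. The decay of [b_JM ||f||_{p,w,Q_JM}]
    removes it. The extension starts from L_u,w, where this decay is accessible by truncation, and
    the weight has to be controlled quantitatively at very small and at very large scales. Nothing
    is lost by working there: test functions lie in L_u,w, so a bounded functional on the Morrey
    closure is determined by its values on L_u,w.

    A representation in S' says nothing about pointwise values. The pointwise sum of the h_JM is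
    therefore constructed on its own and only afterwards identified with the given function, by
    testing both.

    Hahn-Banach and the representation on a single cube are carried out over the reals. Complex
    objects are split into real and imaginary parts, which costs a factor 2 in one norm inequality
    (two real functionals) and a factor 4 in the other (four real products). The A_p constant enters
    neither. *)

Section rV_sets.
Context {R : realType} {n : nat}.
Notation V := 'rV[R]_n.
Notation mu := (lebesgue_rV n : {measure set V -> \bar R}).

Lemma measurable_box (A : 'I_n -> set (measurableTypeR R)) :
  (forall i, measurable (A i)) ->
  measurable [set x : V | forall i, A i (x 0 i)].
Proof.
move=> mA; rewrite (_ : mkset _ =
    \bigcap_(i in [set: 'I_n]) (rV_coord i @^-1` A i)).
  apply: fin_bigcap_measurable; first exact: finite_finset.
  by move=> i _; rewrite -[X in measurable X]setTI; exact: measurable_rV_coord.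
by apply/seteqP; split=> [x /= Ax i _|x /= Ax i]; [exact: Ax|exact: (Ax i)].
Qed.

Lemma cubeE (c : V) l :
  cube c l = [set x | forall i, `[c 0 i - l, c 0 i + l]%classic (x 0 i)].
Proof.
by apply/seteqP; split=> x /= cx i; have := cx i; rewrite in_itv/= ler_distl.
Qed.

Lemma measurable_cube (c : V) l : measurable (cube c l).
Proof.
by rewrite cubeE; apply: (measurable_box (A := fun i => _)) => i;
  exact: measurable_itv.
Qed.

Lemma cube_compact (c : V) l : compact (cube c l).
Proof.
by rewrite cubeE; apply: (rV_compact (A := fun i => _)) => i; exact: segment_compact.
Qed.

Lemma lebesgue_cube (c : V) l : 0 <= l ->
  mu (cube c l) = ((2 * l) ^+ n)%:E.
Proof.
move=> l0; rewrite cubeE.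
apply: (etrans (lebesgue_rV_box (A := fun i => `[c 0 i - l, c 0 i + l]%classic) _)).
  by move=> i; exact: measurable_itv.
under eq_bigr => i _.
  rewrite lebesgue_measure_itv/= lte_fin.
  over.
transitivity (\prod_(i < n) ((2 * l)%:E : \bar R))%E.
  apply: eq_bigr => i _.
  have -> : 2 * l = c 0 i + l - (c 0 i - l) by ring.
  by case: ltP => // ?; congr EFin; lra.
by rewrite prodEFin prodr_const card_ord.
Qed.

Lemma rV_norm_le (x : V) (l : R) : 0 <= l ->
  (`|x| <= l) = `[< forall i, `|x 0 i| <= l >].
Proof.
move=> l0; apply/idP/asboolP => [xl i|xl].
  apply: le_trans xl.
  by rewrite [leRHS]/Num.norm/= mx_normrE; apply: (@le_bigmax _ _ _ 0 (fun ij => `|x ij.1 ij.2|) (0, i)).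
rewrite /Num.norm/= mx_normrE; apply/bigmax_leP; split => //= -[i j] _ /=.
by rewrite ord1.
Qed.

(** The norm of ['rV[R]_n] is the maximum norm, so closed balls about the origin are cubes. *)
Lemma cube0E (l : R) : 0 <= l -> cube 0 l = [set x : V | `|x| <= l].
Proof.
move=> l0; apply/seteqP; split => x /=.
  by move=> xl; rewrite rV_norm_le//; apply/asboolP => i; have := xl i; rewrite mxE subr0.
by rewrite rV_norm_le// => /asboolP xl i; have := xl i; rewrite mxE subr0.
Qed.

Lemma sub_cube (c c' : V) (l l' : R) :
  (forall i, `|c 0 i - c' 0 i| <= l' - l) -> cube c l `<=` cube c' l'.
Proof.
move=> cc x xc i; have := xc i; have := cc i => h1 h2.
rewrite -[x 0 i](subrK (c 0 i)) -addrA (le_trans (ler_normD _ _))//; lra.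
Qed.

Lemma compact_sub_cube (K : set V) : compact K -> exists l : R, 0 < l /\ K `<=` cube 0 l.
Proof.
move=> /compact_bounded[M [_ KM]]; exists (`|M| + 1); split.
  by rewrite ltr_wpDl.
rewrite cube0E; last by rewrite addr_ge0.
by move=> x Kx/=; apply: KM => //; rewrite (le_lt_trans (ler_norm _))// ltrDl.
Qed.

Lemma measurable_dyadic_cube JM : measurable (@dyadic_cube R n JM).
Proof. exact: measurable_cube. Qed.

(** An open set is the union of the dyadic cubes that it contains, and these are countably many.
    This links the product sigma-algebra with the topology. *)
Lemma open_measurable_rV (U : set V) : open U -> measurable U.
Proof.
move=> oU.
rewrite (_ : U = \bigcup_(JM : int * 'rV[int]_n)
   (if `[< dyadic_cube JM `<=` U >] then @dyadic_cube R n JM else set0)).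
  apply: countable_bigcupT_measurable => // JM.
  by case: ifP => // _; exact: measurable_dyadic_cube.
apply/seteqP; split => [x Ux|x [JM _]]; last first.
  by case: ifPn => // /asboolP; exact.
have /nbhs_ballP[e /= e0 eU] : nbhs x U by apply: open_nbhs_nbhs; split.
(* Cubes of level [k] have side [2 / 2 ^+ k < e], and rounding [2 ^+ k * x] down coordinatewise
   gives the index of one that contains [x]. *)
pose k := (Num.truncn (2 / e)).+1.
have k2 : 2 / e < 2 ^+ k.
  rewrite (lt_trans (truncnS_gt _))// -natrX ltr_nat.
  exact: ltn_expl.
pose J : int := k; pose M : 'rV[int]_n := \row_i Num.floor (2 ^+ k * x 0 i).
have t0 : 0 < 2 ^+ k :> R by rewrite exprn_gt0.
have JE : (2 : R) ^ (- J) = (2 ^+ k)^-1 by rewrite -exprnN.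
have dM i : `|(2 ^+ k)^-1 * (M 0 i)%:~R - x 0 i| <= (2 ^+ k)^-1.
  rewrite mxE; set a := x 0 i; set t := 2 ^+ k in t0 *.
  have /andP[h1 h2] := floor_itv (t * a).
  rewrite -[a in _ - a](mulKf (lt0r_neq0 t0)) -mulrBr normrM gtr0_norm ?invr_gt0//.
  rewrite -[leRHS]mulr1 ler_wpM2l ?invr_ge0 ?(ltW t0)// ler_distl.
  move: h2; rewrite intrD => h2.
  by apply/andP; split; lra.
exists (J, M) => //; case: ifPn => [_ i|/asboolP].
  by rewrite !mxE JE/= -/(M 0 i) distrC; have := dM i; rewrite mxE.
move=> h; exfalso; apply: h => y /= yQ; apply: eU; split => // i j; rewrite ord1.
rewrite /ball/=.
have := yQ j; rewrite !mxE JE => h1; have := dM j; rewrite mxE => h2.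
have h3 : 2 / 2 ^+ k < e by rewrite ltr_pdivrMr// mulrC -ltr_pdivrMr.
rewrite -(subrK ((2 ^+ k)^-1 * (Num.floor (2 ^+ k * x 0 j))%:~R) (x 0 j)) -addrA.
rewrite (le_lt_trans (ler_normD _ _))//; rewrite distrC in h1; rewrite distrC in h2; lra.
Qed.

Lemma continuous_measurable_rV (f : V -> R) :
  continuous f -> measurable_fun [set: V] f.
Proof.
move=> cf; apply: (measurability (@RGenOpens.G R)); first exact: RGenOpens.measurableE.
move=> _ [_ [a [b ->]] <-]; rewrite setTI; apply: open_measurable_rV.
by apply: open_comp => // x _; exact: cf.
Qed.

Lemma compact_measurable_rV (K : set V) : compact K -> measurable K.
Proof.
move=> cK; rewrite -(setCK K); apply: measurableC; apply: open_measurable_rV.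
by apply: closed_openC; apply: compact_closed => //; exact: norm_hausdorff.
Qed.

Definition open_box (a b : 'I_n -> R) : set V :=
  [set x | forall i, a i < x 0 i < b i].

Lemma measurable_open_box a b : measurable (open_box a b).
Proof.
rewrite (_ : open_box a b = [set x | forall i, `]a i, b i[%classic (x 0 i)]).
  by apply: (measurable_box (A := fun i => _)) => i; exact: measurable_itv.
by apply/seteqP; split => x /= xab i; have := xab i; rewrite in_itv.
Qed.

(** The pi-system for the Dynkin argument in the density proof. Sides may be empty intervals, which
    makes the system stable under intersection. *)
Definition open_boxes : set (set V) := [set A | exists a b, A = open_box a b].

Lemma open_boxes_setI : setI_closed open_boxes.
Proof.
move=> _ _ [a [b ->]] [a' [b' ->]].
exists (fun i => Num.max (a i) (a' i)), (fun i => Num.min (b i) (b' i)).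
apply/seteqP; split => x /=.
  by move=> [xab xab'] i; have /andP[? ?] := xab i; have /andP[? ?] := xab' i;
    rewrite gt_max lt_min; apply/andP; split; apply/andP.
by move=> h; split => i; have := h i; rewrite gt_max lt_min =>
  /andP[/andP[? ?] /andP[? ?]]; apply/andP.
Qed.

Lemma measurable_open_boxesE : @measurable _ V = <<s open_boxes >>.
Proof.
apply/seteqP; split; last first.
  apply: smallest_sub; first exact: sigma_algebra_measurable.
  by move=> _ [a [b ->]]; exact: measurable_open_box.
apply: smallest_sub; first exact: smallest_sigma_algebra.
suff coord i : preimage_set_system setT (@rV_coord R n i) measurable `<=` <<s open_boxes >>.
  by rewrite -bigcup_seq; apply: bigcup_sub => i _; exact: coord.
have mi : measurable_fun (setT : set (g_sigma_algebraType open_boxes)) (@rV_coord R n i).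
  apply: (measurability (@RGenOpens.G R)); first exact: RGenOpens.measurableE.
  move=> _ [_ [a [b ->]] <-]; rewrite setTI.
  (* A strip in direction [i] is exhausted by boxes whose other sides are the intervals from [-k] to
     [k]. *)
  rewrite (_ : _ @^-1` _ = \bigcup_k open_box
      (fun j => if j == i then a else - k%:R) (fun j => if j == i then b else k%:R)).
    by apply: bigcupT_measurable => k; apply: sub_sigma_algebra; do 2 eexists.
  apply/seteqP; split => [x/=|x [k _ /(_ i)]]; last by rewrite eqxx/= in_itv.
  rewrite in_itv/= => xab.
  exists (Num.truncn `|x|).+1 => // j; case: eqP => [->//|_].
  rewrite -ltr_norml (le_lt_trans _ (truncnS_gt _))//.
  by have := lexx `|x|; rewrite rV_norm_le// => /asboolP/(_ j).
by move=> _ [B mB <-]; exact: mi.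
Qed.

End rV_sets.

(** * Muckenhoupt weights *)

Lemma Lnorm_EFinE d (T : measurableType d) (R : realType)
    (m : {measure set T -> \bar R}) (f : T -> R) (p : R) :
  ('N[m]_p%:E[EFin \o f] = (\int[m]_x (`|f x| `^ p)%:E) `^ p^-1)%E.
Proof. by rewrite Lnorm.unlock. Qed.

Lemma integral_Lnorm_indic d (T : measurableType d) (R : realType)
    (m : {measure set T -> \bar R}) (D : set T) (f : T -> R) (p : R) :
  p != 0 ->
  (\int[m]_(x in D) (`|f x| `^ p)%:E =
   \int[m]_x (`|f x * \1_D x| `^ p)%:E)%E.
Proof.
move=> p0; rewrite integral_mkcond; apply: eq_integral => x _.
rewrite patchE indicE; case: ifPn => _; first by rewrite mulr1.
by rewrite mulr0 normr0 powR0.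
Qed.

Lemma EFin_mul_indic (R : realType) T (A : set T) (f : T -> R) :
  (fun x => (f x * \1_A x)%:E) = (EFin \o f) \_ A.
Proof.
apply/funext => x; rewrite patchE indicE; case: ifPn => _; first by rewrite mulr1.
by rewrite mulr0.
Qed.

Lemma hoelder_setI d (T : measurableType d) (R : realType)
    (m : {measure set T -> \bar R}) (D : set T) (f g : T -> R) (p q : R) :
  measurable D -> measurable_fun setT f -> measurable_fun setT g ->
  0 < p -> 0 < q -> p^-1 + q^-1 = 1 ->
  (\int[m]_(x in D) `|f x * g x|%:E <=
   (\int[m]_(x in D) (`|f x| `^ p)%:E) `^ p^-1 *
   (\int[m]_(x in D) (`|g x| `^ q)%:E) `^ q^-1)%E.
Proof.
move=> mD mf mg p0 q0 pq.
pose f' := (fun x => f x * \1_D x); pose g' := (fun x => g x * \1_D x).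
have mf' : measurable_fun setT f' by apply: measurable_funM.
have mg' : measurable_fun setT g' by apply: measurable_funM.
rewrite (integral_Lnorm_indic _ _ _ (lt0r_neq0 p0)).
rewrite (integral_Lnorm_indic _ _ _ (lt0r_neq0 q0)).
rewrite -(Lnorm_EFinE _ f') -(Lnorm_EFinE _ g').
apply: le_trans (hoelder m mf' mg' p0 q0 pq).
rewrite Lnorm1 integral_mkcond le_eqVlt; apply/orP; left; apply/eqP.
apply: eq_integral => x _.
rewrite patchE /= /f' /g' indicE; case: ifPn => _; first by rewrite !mulr1.
by rewrite !mulr0 normr0.
Qed.

Section weight.
Context {R : realType} {n : nat}.
Notation V := 'rV[R]_n.
Notation mu := (lebesgue_rV n : {measure set V -> \bar R}).
Variables (w : V -> R) (p : R).
Hypothesis n0 : (0 < n)%N.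
Hypothesis p1 : 1 < p.
Hypothesis w0 : forall x, 0 < w x.
Hypothesis Apw : Ap p w.

Local Notation wm := (weight_measure w).

Lemma measurable_weight : measurable_fun setT w.
Proof. by case: Apw => -[]. Qed.

Lemma weight_integrable_cube c l : mu.-integrable (cube c l) (EFin \o w).
Proof. by case: Apw => -[_ + _ _]; apply; exact: cube_compact. Qed.

Lemma weight_integrable A c l : measurable A -> A `<=` cube c l ->
  mu.-integrable A (EFin \o w).
Proof.
by move=> mA Ac; apply: integrableS (weight_integrable_cube c l) => //;
  exact: measurable_cube.
Qed.

Lemma weight_measureE A c l : measurable A -> A `<=` cube c l ->
  (wm A)%:E = (\int[mu]_(x in A) (w x)%:E)%E.
Proof.
move=> mA Ac; rewrite /weight_measure /Rintegral fineK//.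
exact: integrable_fin_num (weight_integrable mA Ac).
Qed.

Lemma weight_measure_ge0 A : 0 <= wm A.
Proof. by apply: Rintegral_ge0 => x _; exact: ltW. Qed.

Lemma weight_measure_le A B c l : measurable A -> measurable B ->
  A `<=` B -> B `<=` cube c l -> wm A <= wm B.
Proof.
move=> mA mB AB Bc; rewrite -lee_fin (weight_measureE mB Bc).
rewrite (weight_measureE mA (subset_trans AB Bc)).
apply: ge0_subset_integral => //.
  by apply/measurable_EFinP/measurable_funTS; exact: measurable_weight.
by move=> x _; rewrite lee_fin ltW.
Qed.

Lemma lebesgue_cube_gt0 (c : V) l : 0 < l -> (0 < mu (cube c l))%E.
Proof. by move=> l0; rewrite lebesgue_cube ?ltW// lte_fin exprn_gt0// mulr_gt0. Qed.

Lemma weight_cube_gt0 c l : 0 < l -> 0 < wm (cube c l).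
Proof.
move=> l0; rewrite lt_neqAle weight_measure_ge0 andbT; apply/eqP => W0.
have mQ := measurable_cube c l.
have mw : measurable_fun (cube c l) (EFin \o w).
  by apply/measurable_EFinP/measurable_funTS; exact: measurable_weight.
have : (\int[mu]_(x in cube c l) `|(EFin \o w) x| = 0)%E.
  rewrite -[RHS]/(0%R%:E) W0 (weight_measureE mQ (@subset_refl _ _)).
  by apply: eq_integral => x _ /=; rewrite gtr0_norm.
move/(ae_eq_integral_abs _ mQ mw) => w0ae.
have /negligibleP : mu.-negligible (cube c l).
  case: w0ae => N [mN N0 sN]; exists N; split => // x Qx; apply: sN => /=.
  by move=> /(_ Qx)[] wx0; have := w0 x; rewrite wx0 ltxx.
by move=> /(_ mQ) Q0; have := lebesgue_cube_gt0 c l0; rewrite Q0 ltxx.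
Qed.

Local Notation sigma := (fun x => w x `^ (1 - conj_exp p)).

Lemma measurable_dual_weight : measurable_fun setT sigma.
Proof. exact: measurableT_comp (measurable_powR _) measurable_weight. Qed.

(** The A_p condition with the averages cleared of their volumes: [w] contributes one factor of the
    volume and [sigma] contributes [p - 1] of them, hence the power [p] on the right. *)
Lemma Ap_bound : exists A : R, 0 < A /\ forall c l, 0 < l ->
  mu.-integrable (cube c l) (EFin \o sigma) /\
  wm (cube c l) * (\int[mu]_(x in cube c l) sigma x) `^ (p - 1) <=
    A * ((2 * l) ^+ n) `^ p.
Proof.
case: Apw => _ _; set s := ereal_sup _ => soo.
(* The maximum with 1 makes the constant positive. *)
pose A := Num.max (fine s) 1.
have A0 : 0 < A by rewrite lt_max ltr01 orbT.
exists A; split => // c l l0.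
have mQ := measurable_cube c l.
set v := (2 * l) ^+ n.
have v0 : 0 < v by rewrite exprn_gt0// mulr_gt0.
have ApA : (Ap_product p w (cube c l) <= A%:E)%E.
  have /(@le_trans _ _ _) : (Ap_product p w (cube c l) <= s)%E.
    by apply: ereal_sup_ubound; exists c => //; exists l.
  apply; move: soo; rewrite /A; case: (s) => [r _|//|_]; last exact: leNye.
  by rewrite lee_fin le_max lexx.
have {}ApA : ((v^-1%:E * \int[mu]_(x in cube c l) (w x)%:E) *
    (v^-1%:E * \int[mu]_(x in cube c l) (sigma x)%:E) `^ (p - 1) <= A%:E)%E.
  by have := ApA; rewrite /Ap_product lebesgue_cube; [exact|exact: ltW].
move: ApA; rewrite -(weight_measureE mQ (@subset_refl _ _)).
have W0 := weight_cube_gt0 c l0.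
set W := wm _ in W0 *.
have T0 : (0 <= \int[mu]_(x in cube c l) (sigma x)%:E)%E.
  by apply: integral_ge0 => x _; rewrite lee_fin powR_ge0.
have msig : measurable_fun (cube c l) (EFin \o sigma).
  by apply/measurable_EFinP/measurable_funTS; exact: measurable_dual_weight.
(* An infinite integral of [sigma] would make the whole product infinite, because [W] is positive.
   So the bound itself yields integrability. *)
have [Too|] := eqVneq (\int[mu]_(x in cube c l) (sigma x)%:E)%E +oo%E.
  rewrite Too gt0_muley ?lte_fin ?invr_gt0// poweRyr; last by rewrite gt_eqF// subr_gt0.
  by rewrite gt0_muley// -?EFinM ?lte_fin ?mulr_gt0 ?invr_gt0// leye_eq.
rewrite -ltey => Toy.
have isig : mu.-integrable (cube c l) (EFin \o sigma).
  apply/integrableP; split => //; apply: le_lt_trans Toy.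
  rewrite le_eqVlt; apply/orP; left; apply/eqP.
  by apply: eq_integral => x _ /=; rewrite ger0_norm ?powR_ge0.
move=> h; split => //; move: h.
have <- : (\int[mu]_(x in cube c l) sigma x)%:E =
    (\int[mu]_(x in cube c l) (sigma x)%:E)%E.
  by rewrite /Rintegral fineK// ge0_fin_numE.
set T := \int[mu]_(x in cube c l) sigma x.
have TT0 : 0 <= T by apply: Rintegral_ge0 => x _; exact: powR_ge0.
rewrite -!EFinM lee_fin.
rewrite powRM ?invr_ge0 ?(ltW v0)//.
have -> : v `^ p = v * v `^ (p - 1) by rewrite mulr_powRB1 ?(ltW v0)// (lt_trans ltr01).
have vp0 : 0 < v `^ (p - 1) by rewrite powR_gt0.
rewrite -powR_inv1 ?(ltW v0)// powRAC [X in X * T `^ _]powR_inv1 ?(ltW vp0)//.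
rewrite powR_inv1 ?(ltW v0)//.
rewrite (_ : v^-1 * W * ((v `^ (p - 1))^-1 * T `^ (p - 1)) =
  (W * T `^ (p - 1)) / (v * v `^ (p - 1))); last by field; rewrite !lt0r_neq0.
by rewrite ler_pdivrMr// mulr_gt0.
Qed.

(** Write Q for the large and Q' for the small cube. Hoelder's inequality for [1 = w^(1/p) w^(-1/p)]
    on Q' gives [|Q'|^p <= w(Q') sigma(Q')^(p-1) <= w(Q') sigma(Q)^(p-1)]. Multiplying by [w(Q)]
    brings in the A_p bound on Q. *)
Lemma doubling_ratio : exists A : R, 0 < A /\ forall c l c' l', 0 < l -> 0 < l' ->
  cube c' l' `<=` cube c l ->
  wm (cube c l) * ((2 * l') ^+ n) `^ p <=
    A * ((2 * l) ^+ n) `^ p * wm (cube c' l').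
Proof.
have [A [A0 hA]] := Ap_bound; exists A; split => // c l c' l' l0 l'0 Q'Q.
have [isig hQ] := hA c l l0.
have mQ' := measurable_cube c' l'; have mQ := measurable_cube c l.
have pgt0 : 0 < p by rewrite (lt_trans ltr01).
have p10 : 0 < p - 1 by rewrite subr_gt0.
pose q := conj_exp p.
have q0 : 0 < q by rewrite divr_gt0.
have pq : p^-1 + q^-1 = 1 by rewrite /q /conj_exp; field; rewrite !lt0r_neq0.
have qp : q^-1 * p = p - 1 by rewrite /q /conj_exp; field; rewrite !lt0r_neq0.
have pq1 : - p^-1 * q = 1 - conj_exp p.
  by rewrite /q /conj_exp; field; rewrite !lt0r_neq0.
clearbody q.
have mwp a : measurable_fun setT (fun x => w x `^ a).
  exact: measurableT_comp (measurable_powR _) measurable_weight.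
have := @hoelder_setI _ _ _ mu _ _ _ p q mQ' (mwp p^-1) (mwp (- p^-1)) pgt0 q0 pq.
have -> : (\int[mu]_(x in cube c' l') `|w x `^ p^-1 * w x `^ (- p^-1)|%:E =
   ((2 * l') ^+ n)%:E)%E.
  rewrite -(lebesgue_cube c' (ltW l'0)) -(mul1e (mu _)) -integral_cst//.
  apply: eq_integral => x _.
  by rewrite -powRD ?subrr ?powRr0 ?normr1//; apply/implyP => _; exact: lt0r_neq0.
have -> : (\int[mu]_(x in cube c' l') (`|w x `^ p^-1| `^ p)%:E =
   (wm (cube c' l'))%:E)%E.
  rewrite (weight_measureE mQ' (@subset_refl _ _)); apply: eq_integral => x _.
  by rewrite ger0_norm ?powR_ge0// -(powRrM (w x)) (mulVf (lt0r_neq0 pgt0)) powRr1// ltW.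
have isig' : mu.-integrable (cube c' l') (EFin \o sigma).
  exact: integrableS isig.
have -> : (\int[mu]_(x in cube c' l') (`|w x `^ (- p^-1)| `^ q)%:E =
   (\int[mu]_(x in cube c' l') sigma x)%:E)%E.
  rewrite /Rintegral fineK; last exact: integrable_fin_num.
  apply: eq_integral => x _.
  by rewrite ger0_norm ?powR_ge0// -powRrM pq1.
have TT : \int[mu]_(x in cube c' l') sigma x <= \int[mu]_(x in cube c l) sigma x.
  rewrite -lee_fin /Rintegral !fineK; [|exact: integrable_fin_num..].
  apply: ge0_subset_integral => //; first exact: measurable_int isig.
  by move=> x _; rewrite lee_fin powR_ge0.
set T' := \int[mu]_(x in cube c' l') sigma x in TT *.
set T := \int[mu]_(x in cube c l) sigma x in TT hQ *.
have T'0 : 0 <= T' by apply: Rintegral_ge0 => x _; exact: powR_ge0.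
set W := wm (cube c l) in hQ *; set W' := wm (cube c' l').
have W'0 : 0 <= W' by exact: weight_measure_ge0.
have W0 : 0 <= W by exact: weight_measure_ge0.
clearbody T T' W W'; rewrite !poweR_EFin -EFinM lee_fin => h.
have vp : ((2 * l') ^+ n) `^ p <= W' * T `^ (p - 1).
  apply: (@le_trans _ _ ((W' `^ p^-1 * T' `^ q^-1) `^ p)).
    rewrite ge0_ler_powR ?nnegrE ?(ltW pgt0)//.
      by rewrite exprn_ge0// mulr_ge0// ltW.
    by rewrite mulr_ge0 ?powR_ge0.
  rewrite powRM ?powR_ge0// -(powRrM W') -(powRrM T') qp (mulVf (lt0r_neq0 pgt0)) powRr1//.
  by rewrite ler_wpM2l// ge0_ler_powR ?nnegrE ?(ltW p10)// (le_trans T'0).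
apply: (le_trans (ler_wpM2l W0 vp)).
by rewrite mulrCA [leRHS]mulrC; rewrite ler_wpM2l.
Qed.

Lemma quad_doubling : exists eta : R, 0 < eta /\ forall c c' l, 0 < l ->
  cube c' l `<=` cube c (4 * l) ->
  eta * wm (cube c (4 * l)) <= wm (cube c' l).
Proof.
have [A [A0 hA]] := doubling_ratio.
have k0 : 0 < (4 ^+ n : R) `^ p by rewrite powR_gt0// exprn_gt0.
exists (A * (4 ^+ n) `^ p)^-1; split; first by rewrite invr_gt0 mulr_gt0.
move=> c c' l l0 Q'Q; rewrite ler_pdivrMl ?mulr_gt0//.
have l40 : 0 < 4 * l by rewrite mulr_gt0.
have := hA _ _ _ _ l40 l0 Q'Q.
have v0 : 0 < (2 * l) ^+ n by rewrite exprn_gt0// mulr_gt0.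
rewrite (_ : 2 * (4 * l) = 4 * (2 * l)); last by ring.
rewrite [(4 * _) ^+ n]exprMn powRM ?exprn_ge0// ?mulr_ge0 ?(ltW l0)//.
by rewrite mulrA [A * _ * _ * _]mulrAC ler_pM2r// powR_gt0.
Qed.

(** Besides [cube c l], the cube of radius [4 * l] contains a disjoint translate of it, which
    carries at least the share [eta] of the weight by doubling. At most the share [1 - eta] remains
    for [cube c l], and this is iterated [k] times. *)
Lemma reverse_doubling : exists eta : R, [/\ 0 < eta, eta < 1,
  forall c c' l, 0 < l -> cube c' l `<=` cube c (4 * l) ->
    eta * wm (cube c (4 * l)) <= wm (cube c' l) &
  forall c l k, 0 < l ->
    wm (cube c l) <= (1 - eta) ^+ k * wm (cube c (4 ^+ k * l))].
Proof.
have [eta [eta0 etaP]] := quad_doubling.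
have step c l : 0 < l -> wm (cube c l) <= (1 - eta) * wm (cube c (4 * l)).
  move=> l0; pose i0 := Ordinal n0.
  (* Centres at distance [3 * l] leave a gap between the two closed cubes, and [3 * l + l = 4 * l]
     keeps the second one inside. *)
  pose c' : V := c + \row_i (if i == i0 then 3 * l else 0).
  have cc' : cube c' l `<=` cube c (4 * l).
    apply: sub_cube => i; rewrite !mxE addrAC subrr add0r.
    by case: eqP => _; rewrite ?normr0 ?ger0_norm; lra.
  have cc : cube c l `<=` cube c (4 * l).
    by apply: sub_cube => i; rewrite subrr normr0; lra.
  have cc0 : cube c l `&` cube c' l = set0.
    rewrite -subset0 => x [] /(_ i0) /[swap] /(_ i0); rewrite !mxE eqxx.
    by rewrite !ler_distl => /andP[? ?] /andP[? ?]; lra.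
  have mc := measurable_cube c l; have mc' := measurable_cube c' l.
  have : wm (cube c l) + wm (cube c' l) <= wm (cube c (4 * l)).
    rewrite -lee_fin EFinD (weight_measureE mc (@subset_refl _ _)).
    rewrite (weight_measureE mc' (@subset_refl _ _)).
    rewrite -ge0_integral_setU//; last 3 first.
    - by apply/measurable_EFinP/measurable_funTS; exact: measurable_weight.
    - by move=> x _; rewrite lee_fin ltW.
    - exact/disj_set2P.
    rewrite -(@weight_measureE _ c (4 * l)) ?lee_fin; last 2 first.
    - exact: measurableU.
    - by rewrite subUset.
    apply: (@weight_measure_le _ _ c (4 * l)) => //; [exact: measurableU|exact: measurable_cube|].
    by rewrite subUset.
  by have := etaP c c' l l0 cc'; lra.
(* Forced by [step], since both weights in it are positive. *)
have eta1 : eta < 1.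
  have := step 0 1 ltr01; have := weight_cube_gt0 0 (@ltr01 R).
  have h4 : 0 < 4 * 1 :> R by lra.
  have := weight_cube_gt0 0 h4.
  set a := wm (cube 0 (4 * 1)); set b := wm _ => a0 b0 h.
  have : 0 < (1 - eta) * a by exact: lt_le_trans h.
  by rewrite pmulr_lgt0// subr_gt0.
exists eta; split => // c l k l0; elim: k => [|k IH]; first by rewrite !expr0 !mul1r.
apply: (le_trans IH); rewrite exprSr -mulrA.
rewrite ler_wpM2l ?exprn_ge0 ?subr_ge0 ?(ltW eta1)//.
by rewrite exprS -mulrA; apply: step; rewrite mulr_gt0// exprn_gt0.
Qed.

End weight.

(** * The weight at very small and very large scales *)

Lemma finite_int_box n (m m' : nat) :
  finite_set [set JM : int * 'rV[int]_n |
    (`|JM.1| <= m)%N /\ forall i, (`|JM.2 ord0 i| <= m')%N].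
Proof.
pose f (a : 'I_(2 * m).+1 * {ffun 'I_n -> 'I_(2 * m').+1}) : int * 'rV[int]_n :=
  ((a.1 : nat)%:Z - m%:Z, \row_i ((a.2 i : nat)%:Z - m'%:Z)).
apply: (@sub_finite_set _ _ (f @` setT)); last exact/finite_image/finite_finset.
move=> [J M] /= [Jm Mm'].
have key (z : int) (k : nat) : (`|z| <= k)%N ->
    {a : 'I_(2 * k).+1 | (a : nat)%:Z - k%:Z = z}.
  move=> zk; have h : (absz (z + k%:Z)%R < (2 * k).+1)%N by lia.
  by exists (Ordinal h) => /=; lia.
exists (sval (key _ _ Jm), [ffun i => sval (key _ _ (Mm' i))]) => //.
rewrite /f /=; congr pair; first by case: (key _ _ Jm).
by apply/rowP => i; rewrite mxE ffunE; case: (key _ _ (Mm' i)).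
Qed.

Section weight_asymptotics.
Context {R : realType} {n : nat}.
Notation V := 'rV[R]_n.
Notation mu := (lebesgue_rV n : {measure set V -> \bar R}).
Variables (w : V -> R) (p : R).
Hypothesis n0 : (0 < n)%N.
Hypothesis p1 : 1 < p.
Hypothesis w0 : forall x, 0 < w x.
Hypothesis Apw : Ap p w.

Local Notation wm := (weight_measure w).

(** Let [l] be the radius of a cube meeting [cube 0 L]. If [l] is far below [L], blowing the cube up
    [k] times stays inside [cube 0 (4 * L)], so reverse doubling makes its weight tiny. If [l] is
    far above [L], reverse doubling applied to [cube 0 L] shows that [cube 0 l] is heavy, and by
    doubling so is the cube itself. In between lie finitely many radii, and each admits finitely
    many centres. *)
Lemma far_cubes (L e : R) : 0 < L -> 0 < e ->
  exists S : set (int * 'rV[int]_n), finite_set S /\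
    forall JM, ~ S JM -> cube 0 L `&` @dyadic_cube R n JM !=set0 ->
      wm (dyadic_cube JM) <= e \/ e^-1 <= wm (dyadic_cube JM).
Proof.
move=> L0 e0.
have [eta [eta0 eta1 etaP etaX]] := reverse_doubling n0 p1 w0 Apw.
have wL : 0 < wm (cube 0 L) by exact: (weight_cube_gt0 w0 Apw).
have w4L : 0 < wm (cube 0 (4 * L)) by apply: (weight_cube_gt0 w0 Apw); lra.
(* The first entry serves the small cubes, the second the large ones. *)
pose d := Num.min (e / wm (cube 0 (4 * L))) (eta * wm (cube 0 L) * e).
have d0 : 0 < d by rewrite lt_min divr_gt0//= !mulr_gt0.
have [k kd] : exists k, (1 - eta) ^+ k <= d.
  have : `|1 - eta| < 1 by rewrite ger0_norm; lra.
  move=> /cvg_expr/cvgrPdist_lt/(_ _ d0)[k _ /(_ k (leqnn _))] /=.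
  rewrite sub0r normrN => h; exists k; apply: le_trans (ltW h).
  exact: ler_norm.
have k4 : 1 <= 4 ^+ k :> R by apply: exprn_ege1; lra.
(* In the intermediate range [L / 4 ^+ k < l < 4 ^+ k * L], so [2 ^ |J|] is less than [4 ^+ k * L]
   or [4 ^+ k / L], according to the sign of [J]. *)
pose m := (Num.truncn (4 ^+ k * L + 4 ^+ k / L)).+1.
have mP : 4 ^+ k * L + 4 ^+ k / L < 2 ^+ m.
  rewrite (lt_trans (truncnS_gt _))// -[ltRHS]natrX ltr_nat; exact: ltn_expl.
have kL : 0 < 4 ^+ k * L by rewrite mulr_gt0// exprn_gt0.
have kL' : 0 < 4 ^+ k / L by rewrite divr_gt0// exprn_gt0.
(* The bound on [M] comes from [|M i| = |c i| / l <= (L + l) / l], where [L / l < 4 ^+ k] unless the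
   cube is small. *)
exists [set JM : int * 'rV[int]_n | (`|JM.1| <= m)%N /\ forall i, (`|JM.2 ord0 i| <= 4 ^ k + 1)%N].
split; first exact: finite_int_box.
move=> [J M] nS [y [y0]]; rewrite /dyadic_cube /= => yQ.
set l := 2 ^ (- J) in yQ *; set c := l *: map_mx intr M in yQ *.
have l0 : 0 < l by rewrite exprz_gt0.
have cE i : c 0 i = l * (M ord0 i)%:~R by rewrite !mxE.
clearbody c.
have cL i : `|c 0 i| <= L + l.
  have := y0 i; rewrite mxE subr0 => h1; have := yQ i; rewrite distrC => h2.
  rewrite -(subrK (y 0 i) (c 0 i)) (le_trans (ler_normD _ _))//; lra.
have [lsmall|lsmall] := leP (l * 4 ^+ k) L.
  left.
  have lL : l <= L by apply: le_trans lsmall; rewrite ler_peMr// ltW.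
  apply: (le_trans (etaX c l k l0)).
  apply: (@le_trans _ _ (d * wm (cube 0 (4 * L)))); last first.
    by rewrite -ler_pdivlMr// ge_min lexx.
  apply: ler_pM => //; [by apply: exprn_ge0; lra|exact: weight_measure_ge0|].
  apply: (weight_measure_le w0 Apw) (@subset_refl _ _); [exact: measurable_cube..|].
  by apply: sub_cube => i; rewrite mxE subr0; have := cL i; lra.
have [llarge|llarge] := leP (4 ^+ k * L) l.
  right.
  have Ll : L <= l by apply: le_trans llarge; rewrite ler_peMl// ltW.
  have c4 : wm (cube 0 l) <= wm (cube c (4 * l)).
    apply: (weight_measure_le w0 Apw) (@subset_refl _ _); [exact: measurable_cube..|].
    by apply: sub_cube => i; rewrite mxE sub0r normrN; have := cL i; lra.
  have c4' : eta * wm (cube c (4 * l)) <= wm (cube c l).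
    by apply: etaP => //; apply: sub_cube => i; rewrite subrr normr0; lra.
  have h1 := etaX 0 L k L0.
  have h2 : wm (cube 0 (4 ^+ k * L)) <= wm (cube 0 l).
    apply: (weight_measure_le w0 Apw) (@subset_refl _ _); [exact: measurable_cube..|].
    by apply: sub_cube => i; rewrite subrr normr0; lra.
  have h3 : wm (cube 0 (4 ^+ k * L)) * eta <= wm (cube c l).
    apply: le_trans c4'; rewrite mulrC ler_pM2l//; exact: le_trans c4.
  rewrite -(ler_pM2l (mulr_gt0 eta0 wL)).
  apply: (@le_trans _ _ ((1 - eta) ^+ k * wm (cube c l) / e)).
    by rewrite ler_pM2r ?invr_gt0// mulrC (le_trans (ler_wpM2r (ltW eta0) h1))// -mulrA
      ler_wpM2l// exprn_ge0//; lra.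
  rewrite mulrAC ler_wpM2r//; first exact: weight_measure_ge0.
  by rewrite ler_pdivrMr// (le_trans kd)// ge_min lexx orbT.
exfalso; apply: nS; split.
  rewrite [(J, M).1]/= leqNgt; apply/negP => mJ.
  have [J0|J0] := leP 0 J.
    have JE : J = `|J|%N by rewrite gez0_abs.
    have lE : l = (2 ^+ `|J|%N)^-1 by rewrite /l {1}JE -exprnN.
    have : (2 : R) ^+ m <= 2 ^+ `|J|%N by rewrite ler_eXn2l ?ltr1n// ltnW.
    have : 2 ^+ `|J|%N < 4 ^+ k / L.
      rewrite -[2 ^+ _]invrK -lE -[ltRHS]invrK ltf_pV2 ?posrE ?invr_gt0// invf_div.
      by rewrite ltr_pdivrMr// exprn_gt0.
    lra.
  have JE : - J = `|J|%N by rewrite ltz0_abs.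
  have lE : l = 2 ^+ `|J|%N by rewrite /l JE -exprnP.
  have : (2 : R) ^+ m <= 2 ^+ `|J|%N by rewrite ler_eXn2l ?ltr1n// ltnW.
  by rewrite -lE; lra.
move=> i; rewrite [(J, M).2]/=.
have BE : ((4 ^ k + 1)%N%:R = 4 ^+ k + 1 :> R) by rewrite natrD natrX.
move: (4 ^ k + 1)%N BE => B BE.
suff : (absz (M ord0 i))%:R <= B%:R :> R by rewrite ler_nat.
rewrite {}BE; have -> : (`|M ord0 i|%N%:R = `|c 0 i| / l :> R).
  by rewrite cE normrM gtr0_norm// mulrC mulKf ?lt0r_neq0// natr_absz intr_norm.
rewrite ler_pdivrMr// (le_trans (cL i))// mulrDl mul1r.
by rewrite lerD2r mulrC ltW.
Qed.

(** Doubling gives polynomial growth: [w] of the cube of radius [4 ^+ k] is at most [D ^+ k] times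
    that of the unit cube. A sufficiently high power of [1 + |x|] beats this growth. It is the
    source of the embedding of S into L_u,w. *)
Lemma weight_moment : exists N : nat,
  (\int[mu]_x (((1 + `|x|) ^+ N)^-1 * w x)%:E < +oo)%E.
Proof.
have [eta [eta0 eta1 etaP _]] := reverse_doubling n0 p1 w0 Apw.
pose D := eta^-1; have D0 : 0 < D by rewrite invr_gt0.
(* With [4 ^+ N > 2 * D] the contributions of the annuli [F k.+1] minus [F k] decrease geometrically
   with ratio 1/2. *)
pose N := (Num.truncn (2 * D)).+1.
have NP : 2 * D < 4 ^+ N.
  rewrite (lt_trans (truncnS_gt _))// -[ltRHS]natrX ltr_nat; exact: ltn_expl.
exists N.
pose F k : set V := cube 0 (4 ^+ k).
have F0 k : 0 < 4 ^+ k :> R by rewrite exprn_gt0.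
have mF k : measurable (F k) by exact: measurable_cube.
have FS k l : (k <= l)%N -> F k `<=` F l.
  move=> kl; apply: sub_cube => i; rewrite subrr normr0 subr_ge0.
  by rewrite ler_eXn2l// ltr1n.
have wF k : wm (F k) <= D ^+ k * wm (F 0).
  elim: k => [|k IH]; first by rewrite expr0 mul1r.
  rewrite exprS -mulrA -ler_pdivrMl// invrK /F [4 ^+ k.+1]exprS.
  apply: le_trans IH; apply: etaP => //.
  by apply: sub_cube => i; rewrite subrr normr0; have := F0 k; lra.
pose g (x : V) := ((1 + `|x|) ^+ N)^-1 * w x.
have g0 x : 0 <= g x by rewrite mulr_ge0 ?(ltW (w0 x))// invr_ge0 exprn_ge0// addr_ge0.
have mg : measurable_fun setT g.
  apply: measurable_funM; last exact: measurable_weight Apw.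
  rewrite (_ : (fun _ => _) = fun x : V => (1 + `|x|) `^ (- N%:R)); last first.
    by apply/funext => x; rewrite powR_invn// addr_ge0.
  apply: (measurableT_comp (measurable_powR _)); apply: measurable_funD => //.
  by apply: continuous_measurable_rV; exact: norm_continuous.
have mge A : measurable_fun A (EFin \o g).
  by apply/measurable_EFinP; exact: measurable_funTS.
have g0e A x : A x -> (0 <= (EFin \o g) x)%E by rewrite lee_fin.
have mw A : measurable_fun A (EFin \o w).
  by apply/measurable_EFinP/measurable_funTS; exact: measurable_weight Apw.
(* The bound is the closed form of [1 + D * (1 + 1/2 + ... + 2^-(k-1))], times the weight of
   [F 0]. *)
have gF k : (\int[mu]_(x in F k) (EFin \o g) x <=
    (wm (F 0) * (1 + 2 * D * (1 - (2 ^+ k)^-1)))%:E)%E.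
  elim: k => [|k IH].
    rewrite expr0 invr1 subrr mulr0 addr0 mulr1.
    rewrite (weight_measureE Apw (mF 0%N) (@subset_refl _ _)).
    apply: ge0_le_integral => //; [exact: g0e|].
    move=> x _; rewrite lee_fin /g ler_piMl ?(ltW (w0 x))//.
    by rewrite invf_le1 ?exprn_ege1 ?exprn_gt0// ?lerDl// ltr_wpDr.
  have FU : F k.+1 = F k `|` (F k.+1 `\` F k).
    by rewrite setDUK//; apply: FS.
  rewrite FU ge0_integral_setU//; first last.
    by apply/disj_set2P; rewrite setDIK.
    by move=> x _; rewrite lee_fin.
    exact: measurableD.
  have -> : wm (F 0) * (1 + 2 * D * (1 - (2 ^+ k.+1)^-1)) =
      wm (F 0) * (1 + 2 * D * (1 - (2 ^+ k)^-1)) + (2 ^+ k)^-1 * (D * wm (F 0)).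
    by rewrite exprS; field; rewrite lt0r_neq0// exprn_gt0.
  rewrite EFinD leeD//.
  apply: (@le_trans _ _ (\int[mu]_(x in F k.+1) ((4 ^+ N) ^- k * w x)%:E)%E).
    apply: (@le_trans _ _ (\int[mu]_(x in F k.+1 `\` F k) ((4 ^+ N) ^- k * w x)%:E)%E).
      apply: ge0_le_integral; [exact: measurableD|by move=> x _; exact: (g0e setT)|exact: mge| |].
        by apply/measurable_EFinP/measurable_funM => //; apply: measurable_funTS;
          exact: measurable_weight Apw.
      move=> x [_]; rewrite /F cube0E ?(ltW (F0 k))//= => /negP; rewrite -ltNge => xk.
      rewrite lee_fin /g ler_wpM2r ?(ltW (w0 x))// -exprM mulnC exprM.
      rewrite lef_pV2 ?posrE ?exprn_gt0 ?ltr_wpDr//.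
      by rewrite lerXn2r ?nnegrE ?ltW// ltr_wpDl// ltW.
    apply: ge0_subset_integral => //; first exact: measurableD.
      by apply/measurable_EFinP/measurable_funM => //; apply: measurable_funTS;
          exact: measurable_weight Apw.
    by move=> x _; rewrite lee_fin mulr_ge0 ?(ltW (w0 x))// invr_ge0 exprn_ge0// exprn_ge0.
  under eq_integral do rewrite EFinM.
  rewrite ge0_integralZl//; last by move=> x _; rewrite lee_fin ltW.
  rewrite -(weight_measureE Apw (mF k.+1) (@subset_refl _ _)) -EFinM lee_fin.
  apply: (@le_trans _ _ ((2 * D) ^- k * (D ^+ k.+1 * wm (F 0)))).
    apply: ler_pM; [by rewrite invr_ge0 exprn_ge0// exprn_ge0
                   |exact: weight_measure_ge0| |exact: wF].
    rewrite lef_pV2 ?posrE ?exprn_gt0// ?mulr_gt0// ?exprn_gt0//.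
    by rewrite lerXn2r ?nnegrE ?exprn_ge0// ?mulr_ge0// ltW.
  rewrite exprMn exprS le_eqVlt; apply/orP; left; apply/eqP; field.
  by rewrite !lt0r_neq0// exprn_gt0.
have FT : \bigcup_k F k = setT.
  apply/seteqP; split => // x _; exists (Num.truncn `|x|).+1 => //.
  rewrite /F cube0E ?(ltW (F0 _))//= ltW// (lt_trans (truncnS_gt _))// -[ltRHS]natrX ltr_nat.
  exact: ltn_expl.
have ndF : nondecreasing_seq F by move=> k l kl; apply/subsetPset; exact: FS.
have := @ge0_nondecreasing_set_cvg_integral _ _ _ F (EFin \o g) mu ndF mF (fun k => mge (F k))
  (fun k x => @g0e (F k) x).
rewrite FT => h; apply: (@le_lt_trans _ _ (wm (F 0) * (1 + 2 * D))%:E); last exact: ltry.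
have -> : (\int[mu]_x (((1 + `|x|) ^+ N)^-1 * w x)%:E)%E =
   limn (fun k => \int[mu]_(x in F k) (EFin \o g) x)%E by exact/esym/cvg_lim.
apply: lime_le; first by apply/cvg_ex; eexists; exact: h.
apply: nearW => k; apply: (le_trans (gF k)); rewrite lee_fin.
rewrite ler_wpM2l ?weight_measure_ge0// lerD2l ler_piMr ?mulr_ge0 ?(ltW D0)//.
Qed.

End weight_asymptotics.

(** * Weighted norms *)

Lemma le_poweR (R : realType) (a b : \bar R) (r : R) :
  0 <= r -> (0 <= a)%E -> (a <= b)%E -> (a `^ r <= b `^ r)%E.
Proof.
move=> r0 a0 ab; apply: gt0_ler_poweR => //; rewrite in_itv/= leey andbT//.
exact: le_trans ab.
Qed.

Section weighted_norm.
Context {R : realType} {n : nat}.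
Notation V := 'rV[R]_n.
Notation mu := (lebesgue_rV n : {measure set V -> \bar R}).
Implicit Types (w f g h : V -> R) (p : R) (M : set V).

(** Weight and restriction to [M] are moved into the function, so that Minkowski's and Hoelder's
    inequalities on the whole space apply directly. For a positive weight [wnormE] recovers the
    usual integral. *)
Definition wnorm w p M f : \bar R :=
  'N[mu]_p%:E[EFin \o (fun x => f x * w x `^ p^-1 * \1_M x)%R]%E.

Lemma wnorm_ge0 w p M f : (0 <= wnorm w p M f)%E.
Proof. exact: Lnorm_ge0. Qed.

Lemma measurable_wnorm w p M f :
  measurable_fun setT w -> measurable M -> measurable_fun setT f ->
  measurable_fun setT (fun x => f x * w x `^ p^-1 * \1_M x).
Proof.
move=> mw mM mf; apply: measurable_funM; last exact: measurable_indic.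
apply: measurable_funM => //.
exact: measurableT_comp (measurable_powR _) mw.
Qed.

Lemma measurable_wpow w p M f :
  measurable_fun setT w -> measurable_fun setT f ->
  measurable_fun M (fun x => (`|f x| `^ p * w x)%:E).
Proof.
move=> mw mf; apply/measurable_EFinP/measurable_funTS/measurable_funM => //.
apply: (measurableT_comp (measurable_powR _)); exact: measurableT_comp.
Qed.

Lemma wpow_ge0 w p f x : (forall x, 0 < w x) -> (0 <= (`|f x| `^ p * w x)%:E)%E.
Proof. by move=> w0; rewrite lee_fin mulr_ge0 ?powR_ge0// ltW. Qed.

Lemma integral_wpow_ge0 w p M f : (forall x, 0 < w x) ->
  (0 <= \int[mu]_(x in M) (`|f x| `^ p * w x)%:E)%E.
Proof. by move=> w0; apply: integral_ge0 => x _; exact: wpow_ge0. Qed.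

Lemma wnormE w p M f : (forall x, 0 < w x) -> 0 < p ->
  wnorm w p M f = ((\int[mu]_(x in M) (`|f x| `^ p * w x)%:E) `^ p^-1)%E.
Proof.
move=> w0 p0; rewrite /wnorm Lnorm_EFinE -(integral_Lnorm_indic _ _ _ (lt0r_neq0 p0)).
congr (_ `^ _)%E; apply: eq_integral => x _.
rewrite normrM [`|_ `^ _|]ger0_norm ?powR_ge0// powRM ?powR_ge0//.
by rewrite -(powRrM (w x)) (mulVf (lt0r_neq0 p0)) powRr1// ltW.
Qed.

Lemma Lpw_normE w p M (f : V -> R[i]) : (forall x, 0 < w x) -> 0 < p ->
  Lpw_norm p w M f = wnorm w p M (fun x => normc (f x)).
Proof.
move=> w0 p0; rewrite (wnormE _ _ w0 p0) /Lpw_norm; apply: (congr1 (fun t => t `^ p^-1)%E).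
apply: eq_integral => x _; rewrite ger0_norm//.
by case: (f x) => a b; exact: sqrtr_ge0.
Qed.

Lemma wnorm_lty w p M f : (forall x, 0 < w x) -> 0 < p ->
  (wnorm w p M f < +oo)%E <->
  (\int[mu]_(x in M) (`|f x| `^ p * w x)%:E < +oo)%E.
Proof.
move=> w0 p0; rewrite (wnormE _ _ w0 p0); split; last exact: poweR_lty.
by apply: lty_poweRy; rewrite invr_neq0// lt0r_neq0.
Qed.

Lemma le_wnorm w p M f g : (forall x, 0 < w x) -> 0 < p ->
  measurable_fun setT w -> measurable M ->
  measurable_fun setT f -> measurable_fun setT g ->
  (forall x, M x -> `|f x| <= `|g x|) -> (wnorm w p M f <= wnorm w p M g)%E.
Proof.
move=> w0 p0 mw mM mf mg fg; rewrite !(wnormE _ _ w0 p0).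
apply: le_poweR; [by rewrite invr_ge0 ltW|exact: integral_wpow_ge0|].
apply: ge0_le_integral => //; [by move=> x _; exact: wpow_ge0
  |exact: measurable_wpow|exact: measurable_wpow|].
move=> x Mx; rewrite lee_fin ler_wpM2r ?(ltW (w0 x))//.
by rewrite ge0_ler_powR ?nnegrE ?(ltW p0)//; exact: fg.
Qed.

Lemma wnorm_subset w p M M' f : (forall x, 0 < w x) -> 0 < p ->
  measurable_fun setT w -> measurable M -> measurable M' ->
  measurable_fun setT f ->
  M `<=` M' -> (wnorm w p M f <= wnorm w p M' f)%E.
Proof.
move=> w0 p0 mw mM mM' mf MM'; rewrite !(wnormE _ _ w0 p0).
apply: le_poweR; [by rewrite invr_ge0 ltW|exact: integral_wpow_ge0|].
apply: ge0_subset_integral => //; [exact: measurable_wpow|].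
by move=> x _; exact: wpow_ge0.
Qed.

Lemma wnormD w p M f g : 1 <= p ->
  measurable_fun setT w -> measurable M ->
  measurable_fun setT f -> measurable_fun setT g ->
  (wnorm w p M (f \+ g)%R <= wnorm w p M f + wnorm w p M g)%E.
Proof.
move=> p1 mw mM mf mg.
have := minkowski_EFin mu (measurable_wnorm p mw mM mf) (measurable_wnorm p mw mM mg) p1.
apply: le_trans; rewrite le_eqVlt; apply/orP; left; apply/eqP.
by apply: eq_Lnorm => x /=; rewrite -!mulrDl.
Qed.

Lemma wnormZ w p M f (a : R) : (forall x, 0 < w x) -> 0 < p ->
  measurable_fun setT w -> measurable M -> measurable_fun setT f ->
  (wnorm w p M (fun x => a * f x)%R = `|a|%:E * wnorm w p M f)%E.
Proof.
move=> w0 p0 mw mM mf; rewrite !(wnormE _ _ w0 p0).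
under eq_integral do rewrite normrM powRM// -mulrA EFinM.
rewrite ge0_integralZl; [|exact: mM|exact: measurable_wpow
  |by move=> x _; exact: wpow_ge0|by rewrite lee_fin powR_ge0].
rewrite poweRM ?lee_fin ?powR_ge0//; last exact: integral_wpow_ge0.
by rewrite poweR_EFin -powRrM mulfV ?lt0r_neq0// powRr1.
Qed.

(* Hoelder's inequality with exponents [u / p] and [(1 - p / u)^-1]. *)
Lemma wnorm_hoelder w p u M f : (forall x, 0 < w x) -> 0 < p -> p < u ->
  measurable_fun setT w -> measurable M -> measurable_fun setT f ->
  (wnorm w p M f <=
   wnorm w u M f * (\int[mu]_(x in M) (w x)%:E) `^ (p^-1 - u^-1))%E.
Proof.
move=> w0 p0 pu mw mM mf; have u0 : 0 < u by exact: lt_trans pu.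
rewrite (wnormE _ _ w0 p0) (wnormE _ _ w0 u0).
pose s := (1 - p / u)^-1.
have pu1 : 0 < 1 - p / u by rewrite subr_gt0 ltr_pdivrMr// mul1r.
have s0 : 0 < s by rewrite invr_gt0.
have up0 : 0 < u / p by rewrite divr_gt0.
have us : (u / p)^-1 + s^-1 = 1 by rewrite /s invrK invf_div; lra.
have mwp a : measurable_fun setT (fun x => w x `^ a).
  exact: measurableT_comp (measurable_powR _) mw.
have mF : measurable_fun setT (fun x => `|f x| `^ p * w x `^ (p / u)).
  apply: measurable_funM => //.
  apply: (measurableT_comp (measurable_powR _)); exact: measurableT_comp.
have := hoelder_setI mu mM mF (mwp (1 - p / u)) up0 s0 us.
have -> : (\int[mu]_(x in M) `|(`|f x| `^ p * w x `^ (p / u) * w x `^ (1 - p / u))%R|%:E =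
    \int[mu]_(x in M) (`|f x| `^ p * w x)%:E)%E.
  apply: eq_integral => x _; rewrite ger0_norm ?mulr_ge0 ?powR_ge0//.
  rewrite -mulrA -powRD; last by apply/implyP => _; exact: lt0r_neq0.
  by rewrite addrC subrK powRr1// ltW.
have -> : (\int[mu]_(x in M) (`|(`|f x| `^ p * w x `^ (p / u))%R| `^ (u / p))%:E =
    \int[mu]_(x in M) (`|f x| `^ u * w x)%:E)%E.
  apply: eq_integral => x _; rewrite ger0_norm ?mulr_ge0 ?powR_ge0//.
  rewrite powRM ?powR_ge0// -(powRrM (w x)) -(powRrM `|f x|).
  rewrite (_ : p / u * (u / p) = 1); last by field; rewrite !lt0r_neq0.
  rewrite (_ : p * (u / p) = u); last by field; rewrite !lt0r_neq0.
  by rewrite powRr1// ltW.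
have -> : (\int[mu]_(x in M) (`|w x `^ (1 - p / u)| `^ s)%:E =
    \int[mu]_(x in M) (w x)%:E)%E.
  apply: eq_integral => x _; rewrite ger0_norm ?powR_ge0//.
  by rewrite -powRrM /s mulfV ?lt0r_neq0// powRr1// ltW.
set A := (\int[mu]_(x in M) _)%E; set B := (\int[mu]_(x in M) _)%E.
set C := (\int[mu]_(x in M) _)%E => h.
have A0 : (0 <= A)%E by exact: integral_wpow_ge0.
have B0 : (0 <= B)%E by exact: integral_wpow_ge0.
have C0 : (0 <= C)%E by apply: integral_ge0 => x _; rewrite lee_fin ltW.
clearbody A B C.
have p'0 : 0 <= p^-1 by rewrite invr_ge0 ltW.
apply: (le_trans (le_poweR p'0 A0 h)).
rewrite poweRM ?poweR_ge0// -!poweRrM invf_div /s invrK.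
rewrite (_ : p / u / p = u^-1); last by field; rewrite !lt0r_neq0.
by rewrite (_ : (1 - p / u) / p = p^-1 - u^-1)//; field; rewrite !lt0r_neq0.
Qed.

End weighted_norm.

Arguments wnorm {R n} (w p)%_R M (f)%_R.

Section weighted_approximation.
Context {R : realType} {n : nat}.
Notation V := 'rV[R]_n.
Notation mu := (lebesgue_rV n : {measure set V -> \bar R}).
Variables (w : V -> R) (s : R).
Hypothesis w0 : forall x, 0 < w x.
Hypothesis mw : measurable_fun setT w.
Hypothesis s0 : 0 < s.

(** Dominated convergence with majorant [|f|^s w]. The hypothesis [|f - f_k| <= |f|] covers all
    later uses: truncations, increasing simple functions, partial sums of disjoint indicators and
    bumps inside a box. *)
Lemma wnorm_approx M (f : V -> R) (f_ : nat -> V -> R) : measurable M ->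
  measurable_fun setT f -> (forall k, measurable_fun setT (f_ k)) ->
  (forall x, f_ ^~ x @ \oo --> f x) ->
  (forall k x, `|f x - f_ k x| <= `|f x|) ->
  (wnorm w s M f < +oo)%E ->
  forall e : R, 0 < e -> \forall k \near \oo, (wnorm w s M (f \- f_ k) <= e%:E)%E.
Proof.
move=> mM mf mf_ f_f f_le /(wnorm_lty _ _ w0 s0) foo e e0.
have mfk k : measurable_fun setT (f \- f_ k) by exact: measurable_funB.
have [] := @dominated_convergence _ _ _ mu M mM
  (fun k x => (`|(f \- f_ k) x| `^ s * w x)%:E) (cst 0%E)
  (fun x => (`|f x| `^ s * w x)%:E).
- by move=> k; exact: measurable_wpow.
- exact: measurable_cst.
- apply: aeW => x _ /=.
  apply: (@cvg_trans _ ((fun k => (`|f x - f_ k x| `^ s * w x)%:E) @ \oo)) => //.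
  apply: cvg_EFin; first exact: nearW.
  rewrite /= -[X in _ --> X](mul0r (w x)); apply: cvgMl.
  have dk : `|f x - f_ k x| @[k --> \oo] --> 0.
    rewrite -[X in _ --> X](@normr0 _ R) -(subrr (f x)).
    by apply: cvg_norm; apply: cvgB; [exact: cvg_cst|exact: f_f].
  apply/cvgrPdist_lt => d d0.
  have d10 : 0 < d `^ s^-1 by rewrite powR_gt0.
  move/cvgrPdist_lt : dk => /(_ _ d10); apply: filterS => k.
  rewrite !sub0r !normrN normr_id [X in _ -> X < _]ger0_norm ?powR_ge0// => h.
  rewrite -[ltRHS]powRr1 ?(ltW d0)// -(mulVf (lt0r_neq0 s0)) powRrM.
  by rewrite gt0_ltr_powR// ?nnegrE ?powR_ge0.
- apply/integrableP; split; first exact: measurable_wpow.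
  apply: le_lt_trans foo; rewrite le_eqVlt; apply/orP; left; apply/eqP.
  by apply: eq_integral => x _; rewrite gee0_abs//; exact: wpow_ge0.
- apply: aeW => x k _ /=.
  rewrite lee_fin ger0_norm ?mulr_ge0 ?powR_ge0 ?(ltW (w0 x))//.
  by rewrite ler_wpM2r ?(ltW (w0 x))// ge0_ler_powR ?nnegrE// ltW.
move=> _ _; rewrite integral0 => h.
have d0 : (0 < e `^ s) by rewrite powR_gt0.
move: h => /fine_cvgP[hfin /cvgrPdist_lt/(_ _ d0) hd].
apply: filterS (filterI hfin hd) => k [hf /=].
rewrite sub0r normrN => hk; rewrite (wnormE _ _ w0 s0).
have -> : e%:E = ((e `^ s)%:E `^ s^-1)%E.
  by rewrite poweR_EFin -powRrM (mulfV (lt0r_neq0 s0)) powRr1 ?(ltW e0).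
have i0 := integral_wpow_ge0 s M (f \- f_ k)%R w0.
apply: le_poweR => //; first by rewrite invr_ge0 ltW.
rewrite -[X in (X <= _)%E](fineK hf) lee_fin.
by apply: le_trans (ltW hk); exact: ler_norm.
Qed.

(** Values larger than [k] are set to 0 instead of being clipped at [k]; the error is then [f] or 0
    at each point, as [wnorm_approx] wants it. *)
Definition truncate (k : nat) (f : V -> R) (x : V) : R :=
  f x * \1_(cube 0 k%:R `&` [set x | `|f x| <= k%:R]) x.

Lemma measurable_truncate k f :
  measurable_fun setT f -> measurable_fun setT (truncate k f).
Proof.
move=> mf; apply: measurable_funM => //; apply: measurable_indic.
apply: measurableI; first exact: measurable_cube.
rewrite -[X in measurable X]setTI.
have mnf : measurable_fun setT (fun x => `|f x|) by exact: measurableT_comp.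
have := mnf measurableT _ (measurable_itv `]-oo, k%:R]).
by congr (measurable (_ `&` _)); apply/seteqP; split => x /=; rewrite in_itv.
Qed.

Lemma truncateE k f x : (`|truncate k f x| <= `|f x|) *
  (`|f x - truncate k f x| <= `|f x|) * (`|truncate k f x| <= k%:R) *
  (~ cube 0 k%:R x -> truncate k f x = 0).
Proof.
rewrite /truncate indicE; have [|] := boolP (x \in _).
  by rewrite inE => -[xk /= fk]; rewrite mulr1 subrr normr0.
rewrite mulr0 subr0 normr0; split => //; split => //.
Qed.

Lemma truncate_cvg f x : truncate ^~ f ^~ x @ \oo --> f x.
Proof.
apply: cvg_near_cst; exists (Num.truncn (`|x| + `|f x|)).+1 => // k /= xk.
have h : `|x| + `|f x| <= k%:R.
  by rewrite (le_trans (ltW (truncnS_gt _)))// ler_nat.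
have n1 := normr_ge0 x; have n2 := normr_ge0 (f x).
rewrite /truncate indicE mem_set ?mulr1//; split; last by rewrite /=; lra.
by rewrite cube0E//=; lra.
Qed.

Lemma wnorm_truncate f : measurable_fun setT f -> (wnorm w s setT f < +oo)%E ->
  forall e : R, 0 < e -> exists k, (wnorm w s setT (f \- truncate k f) <= e%:E)%E.
Proof.
move=> mf foo e e0.
suff /filter_ex[k hk] : \forall k \near \oo,
    (wnorm w s setT (f \- truncate k f) <= e%:E)%E by exists k.
apply: wnorm_approx => //.
- by move=> k; exact: measurable_truncate.
- exact: truncate_cvg.
- by move=> k x; rewrite truncateE.
Qed.

Lemma wnorm_cst M (c : R) : measurable M ->
  (wnorm w s M (cst c) = `|c|%:E * (\int[mu]_(x in M) (w x)%:E) `^ s^-1)%E.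
Proof.
move=> mM; have := @wnormZ _ _ w s M (cst 1) c w0 s0 mw mM (measurable_cst _).
rewrite (_ : (fun x => c * cst 1 x) = cst c); last by apply/funext => x/=; rewrite mulr1.
move=> ->; rewrite (wnormE _ _ w0 s0); congr (_ * _ `^ _)%E.
by apply: eq_integral => x _; rewrite normr1 powR1 mul1r.
Qed.

End weighted_approximation.

(** * Local dual norms and the Morrey norm on dyadic cubes *)

Section dual_norms.
Context {R : realType} {n : nat}.
Notation V := 'rV[R]_n.
Notation mu := (lebesgue_rV n : {measure set V -> \bar R}).
Variables (w : V -> R) (p : R).
Hypothesis p1 : 1 < p.
Hypothesis w0 : forall x, 0 < w x.
Hypothesis mw : measurable_fun setT w.

Let q := conj_exp p.
Let p0 : 0 < p. Proof. exact: lt_trans p1. Qed.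

Lemma conj_exp_gt1 : 1 < q.
Proof. by rewrite /q /conj_exp ltr_pdivlMr ?subr_gt0// mul1r; lra. Qed.

Lemma conj_expK : conj_exp q = p.
Proof.
have p10 : p - 1 != 0 by rewrite subr_eq0 gt_eqF.
rewrite /q /conj_exp (_ : p / (p - 1) - 1 = (p - 1)^-1); last by field.
by rewrite invrK divfK.
Qed.

Lemma conj_exp_inv : p^-1 + q^-1 = 1.
Proof. by rewrite /q /conj_exp; field; rewrite subr_eq0 gt_eqF//= lt0r_neq0. Qed.

(** The norm of a single summand in [H_sum]. It is dual to [wnorm w p] under the unweighted pairing,
    through [h f = (h w^(-1/p)) (f w^(1/p))]. *)
Definition hnorm (h : V -> R) : \bar R :=
  'N[mu]_q%:E[EFin \o (fun x => h x * w x `^ (- p^-1))%R]%E.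

Lemma measurable_hweight (h : V -> R) : measurable_fun setT h ->
  measurable_fun setT (fun x => h x * w x `^ (- p^-1)).
Proof.
move=> mh; apply: measurable_funM => //.
exact: measurableT_comp (measurable_powR _) mw.
Qed.

Lemma hnorm_pairing M (h f : V -> R) : measurable M ->
  measurable_fun setT h -> measurable_fun setT f ->
  {ae mu, forall x, ~ M x -> h x = 0} ->
  (\int[mu]_x `|h x * f x|%:E <= hnorm h * wnorm w p M f)%E.
Proof.
move=> mM mh mf hM.
have q0 : 0 < q by rewrite (lt_trans ltr01)// conj_exp_gt1.
have := @hoelder _ _ _ mu _ _ q p (measurable_hweight mh)
  (measurable_wnorm p mw mM mf) q0 p0.
rewrite addrC conj_exp_inv => /(_ erefl).
apply: le_trans; rewrite Lnorm1 le_eqVlt; apply/orP; left; apply/eqP.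
apply: ge0_ae_eq_integral => //.
- by apply/measurable_EFinP/measurableT_comp => //; exact: measurable_funM.
- apply: measurableT_comp => //; apply/measurable_EFinP.
  apply: measurable_funM; first exact: measurable_hweight.
  exact: measurable_wnorm.
apply: filterS hM => x hx _ /=; congr (`| _ |%:E).
rewrite indicE; have [|] := boolP (x \in M) => xM; last first.
  by rewrite hx ?mul0r//; move: xM; rewrite notin_setE.
rewrite mulr1 mulrACA -powRD ?addNr ?powRr0 ?mulr1//.
by apply/implyP => _; exact: lt0r_neq0.
Qed.

End dual_norms.

Section morrey_norms.
Context {R : realType} {n : nat}.
Notation V := 'rV[R]_n.
Notation mu := (lebesgue_rV n : {measure set V -> \bar R}).
Notation Q := (@dyadic_cube R n).
Variables (w : V -> R) (p r rho : R).
Hypothesis n0 : (0 < n)%N.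
Hypothesis p1 : 1 < p.
Hypothesis rp : - (n%:R / p) < r.
Hypothesis r0 : r < 0.
Hypothesis rrho : r + rho = - n%:R.
Hypothesis w0 : forall x, 0 < w x.
Hypothesis Apw : Ap p w.

Let q := conj_exp p.
Let u := - (n%:R / r).
Local Notation wm := (weight_measure w).
Local Notation b := (cube_factor p r w).
Local Notation a := (cube_factor q rho w).

Let mw : measurable_fun setT w := measurable_weight Apw.
Let nR0 : 0 < n%:R :> R. Proof. by rewrite ltr0n. Qed.
Let p0 : 0 < p. Proof. exact: lt_trans p1. Qed.

Lemma morrey_exp_gt : p < u.
Proof.
rewrite /u -mulrN -invrN ltr_pdivlMr ?oppr_gt0//.
by move: rp; rewrite ltrNl ltr_pdivlMr// mulrC.
Qed.

Lemma morrey_expV : u^-1 = - (r / n%:R).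
Proof. by rewrite /u invrN invf_div. Qed.

Lemma dyadic_radius_gt0 (JM : int * 'rV[int]_n) : 0 < (2 : R) ^ (- JM.1).
Proof. by rewrite exprz_gt0. Qed.

Lemma weight_dyadic_gt0 JM : 0 < wm (Q JM).
Proof. by apply: (weight_cube_gt0 w0 Apw); exact: dyadic_radius_gt0. Qed.

Lemma weight_dyadicE JM : (wm (Q JM))%:E = (\int[mu]_(x in Q JM) (w x)%:E)%E.
Proof.
exact: (weight_measureE Apw (measurable_dyadic_cube _) (@subset_refl _ (Q JM))).
Qed.

Lemma cube_factor_gt0 JM : 0 < b JM.
Proof. by rewrite powR_gt0// weight_dyadic_gt0. Qed.

(** This is exactly the negative of the exponent that Hoelder's inequality produces when L_u,w is
    compared with L_p,w on a cube. Hence L_u,w embeds into the Morrey space with constant 1. *)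
Lemma cube_factorE JM : b JM = wm (Q JM) `^ (- (p^-1 - u^-1)).
Proof. by rewrite /cube_factor morrey_expV opprK. Qed.

Lemma cube_factor_dual JM : a JM = (b JM)^-1.
Proof.
rewrite /cube_factor -powRN; congr (_ `^ _); rewrite opprK.
have -> : rho = - n%:R - r by rewrite -rrho addrAC subrr add0r.
have -> : q^-1 = 1 - p^-1 by have := conj_exp_inv p1; rewrite -/q; lra.
by field; rewrite !lt0r_neq0.
Qed.

Lemma morrey_le_wnorm JM f : measurable_fun setT f ->
  ((b JM)%:E * wnorm w p (Q JM) f <= wnorm w u (Q JM) f)%E.
Proof.
move=> mf; have mQ := @measurable_dyadic_cube R n JM.
have := wnorm_hoelder w0 p0 morrey_exp_gt mw mQ mf.
rewrite -weight_dyadicE poweR_EFin => h.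
rewrite cube_factorE powRN lee_pdivrMl ?powR_gt0 ?weight_dyadic_gt0//.
by rewrite muleC.
Qed.

Lemma morrey_le_wnormT JM f : measurable_fun setT f ->
  ((b JM)%:E * wnorm w p (Q JM) f <= wnorm w u setT f)%E.
Proof.
move=> mf; have mQ := @measurable_dyadic_cube R n JM.
apply: (le_trans (morrey_le_wnorm JM mf)).
have u0 : 0 < u by exact: lt_trans morrey_exp_gt.
exact: wnorm_subset.
Qed.

Lemma hnorm_pairing_dyadic JM (h f : V -> R) :
  measurable_fun setT h -> measurable_fun setT f ->
  {ae mu, forall x, ~ Q JM x -> h x = 0} ->
  (\int[mu]_x `|h x * f x|%:E <=
   ((a JM)%:E * hnorm w p h) * ((b JM)%:E * wnorm w p (Q JM) f))%E.
Proof.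
move=> mh mf hQ; have mQ := @measurable_dyadic_cube R n JM.
rewrite muleACA -EFinM cube_factor_dual mulVf ?lt0r_neq0 ?cube_factor_gt0// mul1e.
exact: hnorm_pairing.
Qed.

(* A family [b_JM ||f||_{p,w,Q_JM}] with f in [L_{u,w}] vanishes at infinity:
   truncate [f], then use that the weight of a cube meeting a fixed cube is
   very small or very large outside a finite set of indices. *)
Lemma morrey_vanish f : measurable_fun setT f -> (wnorm w u setT f < +oo)%E ->
  forall e : R, 0 < e -> exists S : set (int * 'rV[int]_n), finite_set S /\
    forall JM, ~ S JM -> ((b JM)%:E * wnorm w p (Q JM) f <= e%:E)%E.
Proof.
move=> mf foo e e0.
have u0 : 0 < u by exact: lt_trans morrey_exp_gt.
have e20 : 0 < e / 2 by rewrite divr_gt0.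
have [k hk] := wnorm_truncate w0 mw u0 mf foo e20.
set f2 := (f \- _) in hk; pose f1 := truncate k f.
have mf1 : measurable_fun setT f1 by exact: measurable_truncate.
have mf2 : measurable_fun setT f2 by exact: measurable_funB.
(* The radius [k + 1] in place of [k] makes [L] positive also for [k = 0]. *)
pose L : R := k.+1%:R; have L0 : 0 < L by rewrite ltr0n.
pose B : set V := cube 0 L.
have mB : measurable B by exact: measurable_cube.
pose del := p^-1 - u^-1.
have del0 : 0 < del by rewrite subr_gt0 ltf_pV2 ?posrE// morrey_exp_gt.
pose W := wm B; have W0 : 0 < W by exact: (weight_cube_gt0 w0 Apw).
(* The first entry gives [L * w(Q)^(1/u) <= e / 2] when [w(Q) <= d]; the second gives
   [w(Q)^(-del) * L * W^(1/p) <= e / 2] when [w(Q) >= d^-1]. *)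
pose d := Num.min ((e / 2 / L) `^ u) ((e / 2 / (L * W `^ p^-1)) `^ del^-1).
have LW : 0 < L * W `^ p^-1 by rewrite mulr_gt0// powR_gt0.
have d0 : 0 < d by rewrite lt_min !powR_gt0// divr_gt0.
have [S [finS hS]] := far_cubes n0 p1 w0 Apw L0 d0.
exists S; split => // JM nS.
have mQ := @measurable_dyadic_cube R n JM.
have -> : f = f1 \+ f2 by apply/funext => x; rewrite /= addrC subrK.
apply: (@le_trans _ _ ((b JM)%:E * (wnorm w p (Q JM) f1 + wnorm w p (Q JM) f2)))%E.
  rewrite lee_wpmul2l// ?lee_fin ?(ltW (cube_factor_gt0 _))//.
  exact: wnormD (ltW p1) mw mQ mf1 mf2.
rewrite ge0_muleDr ?wnorm_ge0//.
rewrite (splitr e) EFinD leeD//; last exact: le_trans (morrey_le_wnormT JM mf2) hk.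
have f1B x : ~ B x -> f1 x = 0.
  move=> nB; apply/(truncateE k f x).2; apply: contra_not nB.
  by apply: sub_cube => i; rewrite subrr normr0 subr_ge0 ler_nat.
have f1L x : `|f1 x| <= `|cst L x|.
  apply: le_trans (truncateE k f x).1.2 _.
  by rewrite [cst _ _]/= ger0_norm ?(ltW L0)// ler_nat.
have [QB|/set0P QB] := eqVneq (B `&` Q JM) set0.
  have -> : wnorm w p (Q JM) f1 = 0%E.
    apply/eqP; rewrite eq_le wnorm_ge0 andbT.
    apply: (@le_trans _ _ (wnorm w p (Q JM) (cst 0))).
      apply: le_wnorm => // x Qx; rewrite f1B// => Bx.
      by have : (B `&` Q JM) x by []; rewrite QB.
    by rewrite wnorm_cst// normr0 mul0e.
  by rewrite mule0 lee_fin ltW.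
(* A light cube is estimated by the norm of L_u,w, which is small there because [f1] is bounded. On
   a heavy cube the local norm is at most that of the constant [L] on [B], and the factor [b JM] is
   small. *)
have [small|large] := hS JM nS QB.
  apply: (le_trans (morrey_le_wnorm JM mf1)).
  apply: (@le_trans _ _ (wnorm w u (Q JM) (cst L))).
    by apply: le_wnorm.
  rewrite wnorm_cst// -weight_dyadicE poweR_EFin -EFinM lee_fin (gtr0_norm L0).
  rewrite mulrC -ler_pdivlMr//.
  apply: (@le_trans _ _ (((e / 2 / L) `^ u) `^ u^-1)); last first.
    by rewrite -powRrM mulfV ?lt0r_neq0// powRr1// ltW// divr_gt0.
  rewrite ge0_ler_powR ?nnegrE ?invr_ge0 ?powR_ge0 ?(ltW u0) ?(ltW (weight_dyadic_gt0 _))//.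
  by rewrite (le_trans small)// ge_min lexx.
apply: (@le_trans _ _ ((b JM)%:E * wnorm w p B (cst L))%E).
  rewrite lee_wpmul2l// ?lee_fin ?(ltW (cube_factor_gt0 _))//.
  apply: (@le_trans _ _ (wnorm w p (Q JM) (fun x => L * \1_B x))).
    apply: le_wnorm => //.
      by apply: measurable_funM => //; exact: measurable_indic.
    move=> x _; rewrite indicE; case: (boolP (x \in B)) => [_|]; first by rewrite mulr1.
    by rewrite notin_setE => /f1B ->; rewrite normr0.
  rewrite !(wnormE _ _ w0 p0).
  apply: le_poweR; [by rewrite invr_ge0 ltW|exact: integral_wpow_ge0|].
  rewrite [leRHS]integral_mkcond.
  apply: (@le_trans _ _ (\int[mu]_x (`|L * \1_B x| `^ p * w x)%:E)%E).
    apply: ge0_subset_integral => //.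
      apply: measurable_wpow => //.
      by apply: measurable_funM => //; exact: measurable_indic.
    by move=> x _; exact: (wpow_ge0 p (fun x => L * \1_B x) x w0).
  rewrite le_eqVlt; apply/orP; left; apply/eqP; apply: eq_integral => x _.
  rewrite patchE indicE; case: ifPn => _; first by rewrite mulr1.
  by rewrite mulr0 normr0 powR0 ?lt0r_neq0// mul0r.
rewrite wnorm_cst// -(weight_measureE Apw mB (@subset_refl _ _)) poweR_EFin -!EFinM.
rewrite lee_fin (gtr0_norm L0) -/W -ler_pdivlMr// cube_factorE -/del powRN.
rewrite -[leRHS]invrK lef_pV2 ?posrE ?invr_gt0 ?powR_gt0 ?divr_gt0 ?weight_dyadic_gt0//.
have dE : d <= (e / 2 / (L * W `^ p^-1)) `^ del^-1 by rewrite ge_min lexx orbT.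
apply: (@le_trans _ _ ((d^-1) `^ del)); last first.
  rewrite ge0_ler_powR ?nnegrE ?(ltW del0)// ?invr_ge0 ?(ltW d0)//.
  by rewrite ltW// weight_dyadic_gt0.
have -> : d^-1 `^ del = (d `^ del)^-1.
  by rewrite -powRN -mulN1r powRrM powR_inv1 ?(ltW d0).
rewrite lef_pV2 ?posrE ?powR_gt0 ?divr_gt0//.
rewrite -[leRHS]powRr1 ?(ltW (divr_gt0 _ _))// -[X in _ <= _ `^ X](mulVf (lt0r_neq0 del0)) powRrM.
by rewrite ge0_ler_powR ?nnegrE ?(ltW del0)// ?powR_ge0 ?(ltW d0).
Qed.

End morrey_norms.

(** * The Hahn-Banach theorem for sublinear functionals on a subspace *)

Section hahn_banach.
Variables (R : realType) (E : lmodType R) (A D : set E) (N L : E -> R).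
Hypothesis D0 : D 0.
Hypothesis Dlin : forall a x y, D x -> D y -> D (a *: x + y).
Hypothesis DA : D `<=` A.
Hypothesis Alin : forall a x y, A x -> A y -> A (a *: x + y).
Hypothesis Nadd : forall x y, A x -> A y -> N (x + y) <= N x + N y.
Hypothesis Nhom : forall a x, A x -> 0 < a -> N (a *: x) = a * N x.
Hypothesis Llin : forall a x y, D x -> D y -> L (a *: x + y) = a * L x + L y.
Hypothesis LN : forall x, D x -> L x <= N x.

(* Partial linear forms dominated by [N] are represented by their graphs. *)
Let dominated (G : set (E * R)) :=
  (forall a z z', G z -> G z' -> G (a *: z.1 + z'.1, a * z.2 + z'.2)) /\
  (forall z, G z -> A z.1 /\ z.2 <= N z.1).

Let graph : set (E * R) := [set z | D z.1 /\ z.2 = L z.1].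

Let dominated_graph : dominated graph.
Proof.
split=> [a [x s] [y t] [/= Dx ->] [/= Dy ->]|[x s] [/= Dx ->]].
  by split=> /=; [exact: Dlin|rewrite Llin].
by split; [exact: DA|exact: LN].
Qed.

Let N0 : N 0 = 0.
Proof.
(* Homogeneity with the factor 2 gives [N 0 = 2 * N 0]. *)
have := Nhom (DA D0) (@ltr0Sn R 1); rewrite scaler0 => /eqP.
by rewrite -subr_eq0 -{1}[N 0]mul1r -mulrBl mulf_eq0 => /orP[|/eqP//]; rewrite subr_eq0 => /eqP; lra.
Qed.

(** If [s] and [t] both lie over [x], then [s - t] and [t - s] lie over 0 and are bounded by
    [N 0 = 0]. So a dominated graph is automatically single-valued. *)
Let dominated_fun G : dominated G -> forall x s t, G (x, s) -> G (x, t) -> s = t.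
Proof.
move=> [Glin GN] x s t Gs Gt.
have /GN[_ /=] := Glin (-1) _ _ Gs Gt; have /GN[_ /=] := Glin (-1) _ _ Gt Gs.
by rewrite !scaleN1r addNr N0; lra.
Qed.

Let zmodA : A 0 /\ forall a x, A x -> A (a *: x).
Proof.
by split=> [|a x Ax]; [exact: DA|rewrite -[_ *: _]addr0; apply: Alin => //; exact: DA].
Qed.

(** The value [c] at [x0] has to satisfy [s - N (x - x0) <= c <= N (y + x0) - t] for all [(x, s)]
    and [(y, t)] in the graph. Subadditivity makes every lower bound at most every upper bound, so
    the supremum of the lower ones will do. *)
Let extend G x0 : dominated G -> G (0, 0) -> A x0 -> ~ (exists s, G (x0, s)) ->
  exists G', [/\ dominated G', G `<=` G' & exists s, G' (x0, s)].
Proof.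
move=> domG G0 Ax0 nG; have [Glin GN] := domG.
have subA x : A x -> A (x - x0).
  by move=> Ax; rewrite addrC -scaleN1r; exact: Alin.
have addA x : A x -> A (x + x0).
  by move=> Ax; rewrite -[x]scale1r; exact: Alin.
pose S := [set z.2 - N (z.1 - x0) | z in G].
have Sub y s : G (y, s) -> ubound S (N (y + x0) - s).
  move=> Gy _ [[x t] Gx <-] /=.
  have [Ax _] := GN _ Gx; have [Ay _] := GN _ Gy.
  have /GN[_ /=] := Glin 1 _ _ Gx Gy; rewrite scale1r mul1r.
  have := Nadd (subA _ Ax) (addA _ Ay).
  rewrite (_ : x - x0 + (y + x0) = x + y); first by lra.
  by rewrite addrACA addNr addr0.
have hS : has_sup S.
  by split; [exists (0 - N (0 - x0)), (0, 0)|exists (N (0 + x0) - 0); exact: Sub].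
pose c := sup S.
have cge x s : G (x, s) -> s - N (x - x0) <= c.
  by move=> Gx; apply: sup_ubound; [exact: hS.2|exists (x, s)].
have cle x s : G (x, s) -> c <= N (x + x0) - s.
  by move=> Gx; apply: ge_sup; [exact: hS.1|exact: Sub].
exists [set z | exists x s a, [/\ G (x, s), z.1 = x + a *: x0 & z.2 = s + a * c]].
split; first split.
- move=> a _ _ [x [s [d [Gx /= -> ->]]]] [y [t [e [Gy /= -> ->]]]].
  exists (a *: x + y), (a * s + t), (a * d + e); split => /=.
  + exact: Glin Gx Gy.
  + by rewrite scalerDr scalerA scalerDl addrACA.
  + by ring.
- move=> [_ _] [x [s [d [Gx /= -> ->]]]].
  have [Ax sN] := GN _ Gx.
  split; first by rewrite addrC; apply: Alin.
  have [d0|d0|->] := ltgtP d 0; last by rewrite scale0r mul0r !addr0.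
  + have Nd0 : 0 < - d by rewrite oppr_gt0.
    have Gx' : G ((- d)^-1 *: x + 0, (- d)^-1 * s + 0) by exact: Glin Gx G0.
    have := cge _ _ Gx'; rewrite !addr0 => h.
    rewrite (_ : x + d *: x0 = (- d) *: ((- d)^-1 *: x - x0)); last first.
      by rewrite scalerBr scalerA mulfV ?lt0r_neq0// scale1r scaleNr opprK.
    rewrite Nhom//; last by apply: subA; apply: zmodA.2.
    have := ler_wpM2l (ltW Nd0) h; rewrite mulrBr mulVKf ?lt0r_neq0//.
    by rewrite mulNr; lra.
  + have Gx' : G (d^-1 *: x + 0, d^-1 * s + 0) by exact: Glin Gx G0.
    have := cle _ _ Gx'; rewrite !addr0 => h.
    rewrite (_ : x + d *: x0 = d *: (d^-1 *: x + x0)); last first.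
      by rewrite scalerDr scalerA mulfV ?lt0r_neq0// scale1r.
    rewrite Nhom//; last by apply: addA; apply: zmodA.2.
    have := ler_wpM2l (ltW d0) h; rewrite mulrBr mulVKf ?lt0r_neq0//.
    by lra.
- by move=> [x s] Gx; exists x, s, 0; rewrite scale0r mul0r !addr0.
- by exists c, 0, 0, 1; rewrite scale1r mul1r !add0r.
Qed.

(** The domain is a subset [A] of the module, and [N] is sublinear on it alone: in the application
    [A] consists of the families whose supremum norm is finite. *)
Theorem hahn_banach : exists G : E -> R,
  [/\ forall a x y, A x -> A y -> G (a *: x + y) = a * G x + G y,
      forall x, D x -> G x = L x & forall x, A x -> G x <= N x].
Proof.
(* Zorn's lemma also has to handle the empty chain, whose union is empty. Adding [graph] inside the
   predicate makes the empty set admissible. *)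
have [G [domG maxG]] : exists G, dominated (G `|` graph) /\
    forall B, G `<` B -> ~ dominated (B `|` graph).
  apply: Zorn_bigcup => F FP Ftot.
  have sub X : F X -> X `|` graph `<=` \bigcup_(X in F) X `|` graph.
    by move=> FX; apply: setSU => z Xz; exists X.
  split=> [a z z' Gz Gz'|z [[X FX Xz]|gz]]; last 2 first.
  - by apply: (FP _ FX).2; left.
  - exact: dominated_graph.2.
  have [gg|[X [FX [Xz Xz']]]] : (graph z /\ graph z') \/
      exists X, F X /\ (X `|` graph) z /\ (X `|` graph) z'.
    case: Gz => [[X FX Xz]|gz]; case: Gz' => [[Y FY Yz']|gz'].
    + right; case: (Ftot _ _ FX FY) => XY.
        by exists Y; split => //; split; left => //; exact: XY.
      by exists X; split => //; split; left => //; exact: XY.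
    + by right; exists X; split => //; split; [left|right].
    + by right; exists Y; split => //; split; [right|left].
    + by left.
  - by right; apply: dominated_graph.1; case: gg.
  - by apply: (sub _ FX); apply: (FP _ FX).1.
set H := G `|` graph in domG.
have H0 : H (0, 0).
  right; split => //=; have := @Llin (-1) 0 0 D0 D0.
  by rewrite scaler0 addr0 mulN1r addNr.
have Htot x : A x -> exists s, H (x, s).
  move=> Ax; apply: contrapT => nH.
  have [H' [domH' HH' [s H's]]] := extend domG H0 Ax nH.
  apply: (maxG H'); last first.
    by rewrite (_ : H' `|` graph = H')// setUidl// => z gz; apply: HH'; right.
  split; first by move=> z Gz; apply: HH'; left.
  by move=> /(_ _ H's) Gx; apply: nH; exists s; left.
pose g x := xget 0 [set s | H (x, s)].
have gP x : A x -> H (x, g x).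
  by move=> Ax; rewrite /g; case: xgetP => //= nH; have [s /nH] := Htot x Ax.
exists g; split.
- move=> a x y Ax Ay; apply: (dominated_fun domG) (gP _ _) _; first exact: Alin.
  exact: (domG.1 a _ _ (gP _ Ax) (gP _ Ay)).
- move=> x Dx; apply: (dominated_fun domG) (gP _ _) _; first exact: DA.
  by right.
- by move=> x /gP /(domG.2)[].
Qed.

End hahn_banach.

(** * Functionals on a weighted Lebesgue space *)

Section extremal.
Context {R : realType} {n : nat}.
Notation V := 'rV[R]_n.
Notation mu := (lebesgue_rV n : {measure set V -> \bar R}).
Variables (w : V -> R) (p : R).
Hypothesis p1 : 1 < p.
Hypothesis w0 : forall x, 0 < w x.
Hypothesis mw : measurable_fun setT w.

Let q := conj_exp p.
Let p0 : 0 < p. Proof. exact: lt_trans p1. Qed.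
Let q1 : 1 < q. Proof. exact: conj_exp_gt1. Qed.
Let q0 : 0 < q. Proof. exact: lt_trans q1. Qed.
Let qp : q - 1 = q / p.
Proof. by rewrite /q /conj_exp; field; rewrite lt0r_neq0//= subr_eq0 gt_eqF. Qed.
Let qpq : (q - 1) * p = q.
Proof. by rewrite qp divfK ?lt0r_neq0. Qed.

Lemma hnormE (h : V -> R) :
  hnorm w p h = ((\int[mu]_x (`|h x| `^ q * w x `^ (1 - q))%:E) `^ q^-1)%E.
Proof.
rewrite /hnorm Lnorm_EFinE; apply: (congr1 (fun t => t `^ q^-1)%E).
apply: eq_integral => x _.
rewrite normrM [`|_ `^ _|]ger0_norm ?powR_ge0// powRM ?powR_ge0//.
rewrite -(powRrM (w x)) (_ : 1 - q = - p^-1 * q)//.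
by rewrite -[LHS]opprB qp mulNr mulrC.
Qed.

(* The function for which [h] attains its norm in the duality with [L_{p,w}]:
   it is [sgn h |h|^(q-1) w^(1-q)], also where [h] vanishes. *)
Definition extremal (h : V -> R) (x : V) : R :=
  h x * `|h x| `^ (q - 2) * w x `^ (1 - q).

Lemma measurable_extremal h : measurable_fun setT h -> measurable_fun setT (extremal h).
Proof.
move=> mh; apply: measurable_funM; last first.
  exact: measurableT_comp (measurable_powR _) mw.
apply: measurable_funM => //; apply: (measurableT_comp (measurable_powR _)).
exact: measurableT_comp.
Qed.

Lemma extremal_mul h x : h x * extremal h x = `|h x| `^ q * w x `^ (1 - q).
Proof.
rewrite /extremal !mulrA; congr (_ * _).
have [->|hx] := eqVneq (h x) 0; first by rewrite !mul0r normr0 powR0 ?lt0r_neq0.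
rewrite -expr2 -real_normK ?num_real// -powR_mulrn// -powRD.
  by congr (_ `^ _); ring.
by apply/implyP => _; rewrite normr_eq0.
Qed.

(** Because [(q - 1) * p = q]. Together with [extremal_mul], the pairing of [h] with [extremal h]
    and the p-th power of the norm of [extremal h] are the same integral, which is also the q-th
    power of [hnorm h]. *)
Lemma extremal_pow h x : `|extremal h x| `^ p * w x = `|h x| `^ q * w x `^ (1 - q).
Proof.
rewrite /extremal; have [->|hx] := eqVneq (h x) 0.
  by rewrite !mul0r normr0 !powR0 ?lt0r_neq0// !mul0r.
have nhx : 0 < `|h x| by rewrite normr_gt0.
rewrite !normrM [`|_ `^ (q - 2)|]ger0_norm ?powR_ge0//.
rewrite [`|_ `^ (1 - q)|]ger0_norm ?powR_ge0//.
rewrite -{1}[`|h x|]powRr1// -powRD; last by apply/implyP => _; exact: lt0r_neq0.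
rewrite (_ : 1 + (q - 2) = q - 1); last by ring.
rewrite powRM ?powR_ge0// -!powRrM qpq -mulrA; congr (_ * _).
rewrite -{2}[w x]powRr1 ?ltW// -powRD; last by apply/implyP => _; exact: lt0r_neq0.
by congr (_ `^ _); rewrite -[1 - q]opprB mulNr qpq; ring.
Qed.

Lemma wnorm_extremal (M : set V) (h : V -> R) : measurable M -> measurable_fun setT h ->
  (forall x, ~ M x -> h x = 0) ->
  (wnorm w p M (extremal h) =
   (\int[mu]_x (`|h x| `^ q * w x `^ (1 - q))%:E) `^ p^-1)%E.
Proof.
move=> mM mh hM; rewrite (wnormE _ _ w0 p0).
apply: (congr1 (fun t => t `^ p^-1)%E).
rewrite integral_mkcond; apply: eq_integral => x _.
rewrite patchE; case: ifPn => [_|]; first by rewrite extremal_pow.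
by rewrite notin_setE => /hM ->; rewrite normr0 powR0 ?lt0r_neq0// mul0r.
Qed.

End extremal.

Section simple_approximation.
Import HBNNSimple.

(** The approximants are written as finite sums of multiples of indicators, so that linear
    statements pass from indicators to them; the bounds [0 <= s_k <= f] feed [wnorm_approx]. *)
Lemma simple_approximation d (T : measurableType d) (R : realType) (f : T -> R) :
  measurable_fun setT f -> (forall x, 0 <= f x) ->
  exists s_ : nat -> T -> R,
    [/\ forall k, exists (m : nat) (c : 'I_m -> R) (A : 'I_m -> set T),
          (forall i, measurable (A i)) /\
          s_ k = fun x => \sum_(i < m) (c i * \1_(A i) x),
        forall x, s_ ^~ x @ \oo --> f x & forall k x, 0 <= s_ k x <= f x].
Proof.
move=> mf f0; have mEf : measurable_fun setT (EFin \o f) by exact/measurable_EFinP.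
pose s_ := nnsfun_approx measurableT mEf.
have cs x : (fun k => s_ k x) @ \oo --> f x.
  have /fine_cvgP[//] : EFin \o (fun k => s_ k x) @ \oo --> (f x)%:E.
  exact: (cvg_nnsfun_approx measurableT mEf (fun x _ => f0 x) (I : setT x)).
exists (fun k => s_ k); split => //.
- move=> k; do 3 eexists; split; last first.
    by apply/funext => x; exact: fimfunEord.
  by move=> i; exact: measurable_sfunP.
- move=> k x; apply/andP; split; first by [].
  have nd : nondecreasing_seq (fun k => s_ k x).
    by move=> i j ij; have /lefP := nd_nnsfun_approx measurableT mEf ij; exact.
  have cv : cvgn (fun k => s_ k x) by apply/cvg_ex; exists (f x); exact: cs.
  have := nondecreasing_cvgn_le nd cv k.
  by rewrite (cvg_lim _ (cs x)).
Qed.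

End simple_approximation.

(** By disjointness the partial sums only take the values 0 and 1 on the union. This yields
    countable additivity twice, for the charge of a functional and in the Dynkin argument. *)
Lemma indic_bigcup_cvg (T : Type) (R : realType) (F : nat -> set T) :
  trivIset setT F ->
  let f_ (k : nat) (x : T) : R := \sum_(i <- index_iota 0 k) \1_(F i) x in
  (forall x, f_ ^~ x @ \oo --> (\1_(\bigcup_i F i) x : R)) /\
  forall k x, `|\1_(\bigcup_i F i) x - f_ k x| <= `|\1_(\bigcup_i F i) x : R|.
Proof.
move=> tF f_.
have f_E k j x : F j x -> f_ k x = (j < k)%N%:R.
  move=> Fjx; rewrite /f_; elim: k => [|k IH].
    by rewrite big_nil.
  rewrite big_nat_recr//= IH indicE.
  have -> : (x \in F k) = (k == j).
    apply/idP/eqP => [|->]; last by rewrite inE.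
    rewrite inE => Fkx; move/trivIsetP : tF => /(_ k j I I).
    by have [//|_ /(_ isT) h] := eqVneq k j; have : (F k `&` F j) x by []; rewrite h.
  rewrite -natrD [in RHS]ltnS [in RHS]leq_eqVlt [k == j]eq_sym.
  by case: (ltngtP j k).
have f_N k x : ~ (\bigcup_i F i) x -> f_ k x = 0.
  move=> nFx; rewrite /f_ big1// => i _; rewrite indicE memNset// => Fix.
  by apply: nFx; exists i.
split.
- move=> x; rewrite indicE; have [|] := boolP (x \in _).
    rewrite inE => -[j _ Fjx]; apply: cvg_near_cst; exists j.+1 => // k /= jk.
    by rewrite (f_E _ j)// jk.
  by rewrite notin_setE => nFx; apply: cvg_near_cst; apply: nearW => k; rewrite f_N.
- move=> k x; rewrite indicE; have [|] := boolP (x \in _).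
    rewrite inE => -[j _ Fjx]; rewrite (f_E _ j)//.
    by case: ltnP => _; rewrite ?subrr ?subr0 ?normr0.
  by rewrite notin_setE => nFx; rewrite f_N// subrr.
Qed.

(** * Riesz representation on a set of finite weight *)

Section riesz.
Context {R : realType} {n : nat}.
Notation V := 'rV[R]_n.
Notation mu := (lebesgue_rV n : {measure set V -> \bar R}).
Variables (w : V -> R) (p : R) (M : set V).
Hypothesis p1 : 1 < p.
Hypothesis w0 : forall x, 0 < w x.
Hypothesis mw : measurable_fun setT w.
Hypothesis mM : measurable M.
Hypothesis wM : (\int[mu]_(x in M) (w x)%:E < +oo)%E.

Definition in_Lp (f : V -> R) :=
  measurable_fun setT f /\ (wnorm w p M f < +oo)%E.

Variables (l : (V -> R) -> R) (C : R).
Hypothesis C0 : 0 <= C.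
Hypothesis llin : forall c f g, in_Lp f -> in_Lp g ->
  l (fun x => c * f x + g x) = c * l f + l g.
Hypothesis lC : forall f, in_Lp f -> (`|l f|%:E <= C%:E * wnorm w p M f)%E.

Let q := conj_exp p.
Let p0 : 0 < p. Proof. exact: lt_trans p1. Qed.
Let q1 : 1 < q. Proof. exact: conj_exp_gt1. Qed.
Let q0 : 0 < q. Proof. exact: lt_trans q1. Qed.

Implicit Types (f g : V -> R) (A : set V).

Lemma in_Lp_bounded f (k : R) : measurable_fun setT f -> (forall x, `|f x| <= k) ->
  in_Lp f.
Proof.
move=> mf fk; split => //.
have k0 : 0 <= k by exact: le_trans (fk 0).
apply: (@le_lt_trans _ _ (wnorm w p M (cst k))).
  by apply: le_wnorm => // x _; rewrite [leRHS]ger0_norm.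
rewrite (wnorm_cst w0 mw p0 k mM); apply: lte_mul_pinfty => //.
by exact: poweR_lty.
Qed.

Lemma in_Lp_indic A : measurable A -> in_Lp \1_A.
Proof.
move=> mA; apply: (@in_Lp_bounded _ 1); first exact: measurable_indic.
by move=> x; rewrite indicE; case: (x \in A); rewrite ?normr1// normr0.
Qed.

Lemma in_Lp_le f g : measurable_fun setT f -> in_Lp g ->
  (forall x, `|f x| <= `|g x|) -> in_Lp f.
Proof.
by move=> mf [mg goo] fg; split => //; apply: le_lt_trans goo; exact: le_wnorm.
Qed.

Lemma in_Lp0 : in_Lp (cst 0).
Proof. by apply: (@in_Lp_bounded _ 0) => // x; rewrite normr0. Qed.

Lemma in_Lp_lin c f g : in_Lp f -> in_Lp g -> in_Lp (fun x => c * f x + g x).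
Proof.
move=> [mf foo] [mg goo]; have mcf : measurable_fun setT (fun x => c * f x).
  by apply: measurable_funM.
split; first exact: measurable_funD.
apply: (le_lt_trans (wnormD (ltW p1) mw mM mcf mg)).
rewrite lte_add_pinfty//; rewrite (wnormZ c w0 p0 mw mM mf).
by apply: lte_mul_pinfty.
Qed.

Lemma riesz0 : l (cst 0) = 0.
Proof.
have := llin 1 in_Lp0 in_Lp0.
rewrite (_ : (fun x => _) = cst 0); last by apply/funext => x; rewrite mulr0 addr0.
by rewrite mul1r => /eqP; rewrite -subr_eq0 opprD addNKr oppr_eq0 => /eqP.
Qed.

Lemma rieszB f g : in_Lp f -> in_Lp g -> l (f \- g) = l f - l g.
Proof.
move=> df dg; rewrite -[RHS]addrC -mulN1r -llin//; congr l.
by apply/funext => x /=; rewrite mulN1r addrC.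
Qed.

Lemma rieszZ c f : in_Lp f -> l (fun x => c * f x) = c * l f.
Proof.
move=> df; have := llin c df in_Lp0; rewrite riesz0 addr0 => <-; congr l.
by apply/funext => x; rewrite addr0.
Qed.

Lemma in_Lp_sum (I : Type) (s : seq I) (F : I -> V -> R) :
  (forall i, in_Lp (F i)) -> in_Lp (fun x => \sum_(i <- s) F i x).
Proof.
move=> dF; elim: s => [|i s IH].
  by under eq_fun do rewrite big_nil; exact: in_Lp0.
under eq_fun do rewrite big_cons -[F i _]mul1r.
exact: in_Lp_lin.
Qed.

Lemma riesz_sum (I : Type) (s : seq I) (F : I -> V -> R) :
  (forall i, in_Lp (F i)) -> l (fun x => \sum_(i <- s) F i x) = \sum_(i <- s) l (F i).
Proof.
move=> dF; elim: s => [|i s IH].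
  by rewrite big_nil -[RHS]riesz0; congr l; apply/funext => x; rewrite big_nil.
rewrite big_cons -IH -[l (F i)]mul1r -llin//; last exact: in_Lp_sum.
by congr l; apply/funext => x; rewrite big_cons mul1r.
Qed.

(** Boundedness of [l] turns the norm convergence of [wnorm_approx] into convergence of the
    values. *)
Lemma riesz_cvg f (f_ : nat -> V -> R) : in_Lp f -> (forall k, in_Lp (f_ k)) ->
  (forall x, f_ ^~ x @ \oo --> f x) ->
  (forall k x, `|f x - f_ k x| <= `|f x|) ->
  (fun k => l (f_ k)) @ \oo --> l f.
Proof.
move=> df df_ f_f f_le; apply/cvgrPdist_le => e e0.
(* [C + 1] avoids a division by zero when [C = 0]. *)
have d0 : 0 < e / (C + 1) by rewrite divr_gt0// ltr_wpDl.
have := wnorm_approx w0 mw p0 mM df.1 (fun k => (df_ k).1) f_f f_le df.2 d0.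
apply: filterS => k hk; rewrite -rieszB// -lee_fin.
have dB : in_Lp (f \- f_ k).
  apply: (in_Lp_le _ df); last by move=> x; exact: f_le.
  by apply: measurable_funB; [exact: df.1|exact: (df_ k).1].
apply: (le_trans (lC dB)).
apply: (@le_trans _ _ (C%:E * (e / (C + 1))%:E)%E); first exact: lee_wpmul2l.
rewrite -EFinM lee_fin mulrCA ler_piMr ?(ltW e0)// ler_pdivrMr ?ltr_wpDl//.
by rewrite mul1r lerDl.
Qed.

(** It is finite on every measurable set since [M] has finite weight, which puts all indicators into
    L_p,w. Its Radon-Nikodym derivative will represent [l]. *)
Definition riesz_charge (A : set V) : \bar R := (l \1_A)%:E.

Let riesz_charge0 : riesz_charge set0 = 0%E.
Proof. by rewrite /riesz_charge indic0 riesz0. Qed.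

Let riesz_charge_fin A : measurable A -> riesz_charge A \is a fin_num.
Proof. by []. Qed.

Let riesz_charge_sigma_additive : semi_sigma_additive riesz_charge.
Proof.
move=> F mF tF mUF.
pose f_ k (x : V) : R := \sum_(i <- index_iota 0 k) \1_(F i) x.
have [f_cvg f_le] := indic_bigcup_cvg R tF.
have df_ k : in_Lp (f_ k) by apply: in_Lp_sum => i; exact: in_Lp_indic.
rewrite (_ : (fun k => _) = EFin \o (fun k => l (f_ k))); last first.
  by apply/funext => k /=; rewrite /f_ riesz_sum ?sumEFin// => i; exact: in_Lp_indic.
apply: cvg_EFin; first exact: nearW.
by apply: riesz_cvg => //; exact: in_Lp_indic.
Qed.

HB.instance Definition _ := isCharge.Build _ _ _ riesz_charge
  riesz_charge0 riesz_charge_fin riesz_charge_sigma_additive.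

Lemma wnorm_null A : measurable A -> mu (A `&` M) = 0%E -> wnorm w p M \1_A = 0%E.
Proof.
move=> mA A0; rewrite (wnormE _ _ w0 p0).
suff -> : (\int[mu]_(x in M) (`|\1_A x| `^ p * w x)%:E = 0)%E.
  by rewrite poweR0r// invr_neq0// lt0r_neq0.
rewrite (ae_eq_integral (cst 0%E)) ?integral0//.
  by apply: measurable_wpow => //; exact: measurable_indic.
exists (A `&` M); split => //; first exact: measurableI.
move=> x /= h; apply: contrapT => nAM; apply: h => Mx.
by rewrite indicE memNset ?normr0 ?powR0 ?lt0r_neq0 ?mul0r// => Ax; exact: nAM.
Qed.

Lemma riesz_indic0 A : measurable A -> mu (A `&` M) = 0%E -> l \1_A = 0.
Proof.
move=> mA A0; apply/eqP; rewrite -normr_le0 -lee_fin.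
by apply: (le_trans (lC (in_Lp_indic mA))); rewrite wnorm_null// mule0.
Qed.

Let riesz_dominates : riesz_charge `<< mu.
Proof.
apply/null_content_dominatesP => A mA A0; rewrite /riesz_charge riesz_indic0//.
by apply: (subset_measure0 _ _ _ A0) => //; exact: measurableI.
Qed.

Definition riesz_density (x : V) : R :=
  fine (Radon_Nikodym riesz_charge (lebesgue_rV n) x) * \1_M x.

Lemma riesz_density0 x : ~ M x -> riesz_density x = 0.
Proof. by move=> nM; rewrite /riesz_density indicE memNset ?mulr0. Qed.

Let RN_indic A x : (Radon_Nikodym riesz_charge (lebesgue_rV n) \_ A) x =
  (fine (Radon_Nikodym riesz_charge (lebesgue_rV n) x) * \1_A x)%:E.
Proof.
rewrite patchE indicE; case: ifPn => _; last by rewrite mulr0.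
by rewrite mulr1 fineK//; exact: Radon_Nikodym_fin_num.
Qed.

Lemma riesz_density_integrable : mu.-integrable setT (EFin \o riesz_density).
Proof.
rewrite (_ : EFin \o _ = Radon_Nikodym riesz_charge (lebesgue_rV n) \_ M); last first.
  by apply/funext => x; rewrite RN_indic.
rewrite -(integrable_mkcond _ mM).
by apply: integrableS (Radon_Nikodym_integrable riesz_dominates).
Qed.

Lemma measurable_riesz_density : measurable_fun setT riesz_density.
Proof. by have /integrableP[/measurable_EFinP] := riesz_density_integrable. Qed.

Lemma riesz_density_indic A : measurable A ->
  l \1_A = \int[mu]_x (riesz_density x * \1_A x).
Proof.
move=> mA; have mAM : measurable (A `&` M) by exact: measurableI.
have mAD : measurable (A `\` M) by exact: measurableD.
(* The part of [A] outside [M] has norm zero and is invisible to [l]; this matches the cut-off in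
   [riesz_density]. *)
have -> : l \1_A = l \1_(A `&` M).
  have -> : \1_A = (fun x => 1 * \1_(A `&` M) x + \1_(A `\` M) x) :> (V -> R).
    apply/funext => x; rewrite mul1r !indicE in_setI in_setD.
    by case: (x \in A); case: (x \in M); rewrite ?addr0 ?add0r.
  rewrite llin; [|exact: in_Lp_indic..].
  rewrite mul1r [X in _ + X](_ : _ = 0) ?addr0// riesz_indic0//.
  by rewrite setDE -setIA setICl setI0 measure0.
apply: EFin_inj; rewrite -/(riesz_charge _) (Radon_Nikodym_integral riesz_dominates mAM).
rewrite /Rintegral fineK.
  rewrite [LHS]integral_mkcond; congr (integral _ _ _); apply/funext => x.
  rewrite RN_indic /riesz_density !indicE in_setI.
  by case: (x \in A); case: (x \in M); rewrite ?mulr1 ?mulr0.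
apply: integrable_fin_num => //.
apply: le_integrable riesz_density_integrable => //.
  apply/measurable_EFinP/measurable_funM; first exact: measurable_riesz_density.
  exact: measurable_indic.
move=> x _; rewrite lee_fin normrM ler_piMr// indicE.
by case: (x \in A); rewrite ?normr1// normr0.
Qed.

(** Integrability of the product is a hypothesis here, because the bound on [hnorm] that would imply
    it for all [f] in L_p,w is itself obtained from this formula, applied to bounded functions. *)
Let riesz_nonneg f : in_Lp f -> (forall x, 0 <= f x) ->
  mu.-integrable setT (fun x => (riesz_density x * f x)%:E) ->
  l f = \int[mu]_x (riesz_density x * f x).
Proof.
move=> df f0 hf; have mh := measurable_riesz_density.
have [s_ [s_simple s_f s_le]] := simple_approximation df.1 f0.
have ms k : measurable_fun setT (s_ k).
  have [m [c [A [mA ->]]]] := s_simple k.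
  by apply: measurable_sum => i; apply: measurable_funM => //; exact: measurable_indic.
have ds k : in_Lp (s_ k).
  apply: (in_Lp_le (ms k) df) => x; have /andP[s0 sf] := s_le k x.
  by rewrite !ger0_norm.
have hs k : mu.-integrable setT (fun x => (riesz_density x * s_ k x)%:E).
  apply: le_integrable hf => //; first by apply/measurable_EFinP/measurable_funM.
  move=> x _; rewrite lee_fin !normrM ler_wpM2l//; have /andP[s0 sf] := s_le k x.
  by rewrite !ger0_norm.
have ls k : l (s_ k) = \int[mu]_x (riesz_density x * s_ k x).
  have [m [c [A [mA sE]]]] := s_simple k.
  have dc i : in_Lp (fun x => c i * \1_(A i) x).
    rewrite (_ : (fun _ => _) = fun x => c i * \1_(A i) x + cst 0 x); last first.
      by apply/funext => x; rewrite addr0.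
    by apply: in_Lp_lin; [exact: in_Lp_indic|exact: in_Lp0].
  have hA i : mu.-integrable setT (fun x => (riesz_density x * \1_(A i) x)%:E).
    apply: le_integrable riesz_density_integrable => //.
      by apply/measurable_EFinP/measurable_funM => //; exact: measurable_indic.
    move=> x _; rewrite lee_fin normrM ler_piMr// indicE.
    by case: (x \in A i); rewrite ?normr1// normr0.
  rewrite sE riesz_sum//.
  transitivity (\sum_(i < m) c i * \int[mu]_x (riesz_density x * \1_(A i) x)).
    by apply: eq_bigr => i _; rewrite rieszZ ?riesz_density_indic//; exact: in_Lp_indic.
  apply: EFin_inj; rewrite -sumEFin.
  rewrite [RHS]fineK; last first.
    by apply: integrable_fin_num => //; have := hs k; rewrite sE.
  under [RHS]eq_integral do rewrite mulr_sumr -sumEFin.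
  rewrite integral_sum//=; last first.
    move=> i; under eq_fun do rewrite mulrCA EFinM.
    exact: integrableZl.
  apply: eq_bigr => i _.
  under [RHS]eq_integral do rewrite mulrCA EFinM.
  by rewrite integralZl// EFinM fineK//; exact: integrable_fin_num.
have h1 : (fun k => l (s_ k)) @ \oo --> l f.
  apply: riesz_cvg => // k x; have /andP[s0 sf] := s_le k x.
  by rewrite !ger0_norm ?subr_ge0// gerBl.
have h2 : (fun k => l (s_ k)) @ \oo --> \int[mu]_x (riesz_density x * f x).
  rewrite (_ : (fun k => _) = fine \o (fun k => \int[mu]_x (riesz_density x * s_ k x)%:E)%E); last first.
    by apply/funext => k; rewrite ls.
  have [] := @dominated_convergence _ _ _ mu setT measurableT
    (fun k x => (riesz_density x * s_ k x)%:E) (fun x => (riesz_density x * f x)%:E)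
    (fun x => `|riesz_density x * f x|%:E).
  - by move=> k; apply/measurable_EFinP/measurable_funM.
  - by apply/measurable_EFinP/measurable_funM => //; exact: df.1.
  - apply: aeW => x _; apply: cvg_EFin; first exact: nearW.
    by apply: cvgMr; exact: s_f.
  - exact: (integrable_norm hf).
  - apply: aeW => x k _; rewrite lee_fin !normrM ler_wpM2l//.
    by have /andP[s0 sf] := s_le k x; rewrite !ger0_norm.
  move=> _ _; rewrite -[X in _ --> X -> _]fineK; last exact: integrable_fin_num.
  by move/fine_cvgP => -[].
exact: cvg_unique h1 h2.
Qed.

Let riesz_signed f : in_Lp f ->
  mu.-integrable setT (fun x => (riesz_density x * f x)%:E) ->
  l f = \int[mu]_x (riesz_density x * f x).
Proof.
move=> df hf; have mh := measurable_riesz_density.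
pose f1 x := Num.max (f x) 0; pose f2 x := Num.max (- f x) 0.
have mf1 : measurable_fun setT f1 by apply: measurable_maxr => //; exact: df.1.
have mf2 : measurable_fun setT f2.
  by apply: measurable_maxr => //; apply: measurableT_comp => //; exact: df.1.
have f1f x : 0 <= f1 x <= `|f x|.
  by rewrite /f1 le_max lexx orbT/= ge_max ler_norm normr_ge0.
have f2f x : 0 <= f2 x <= `|f x|.
  by rewrite /f2 le_max lexx orbT/= ge_max ler_normr lexx orbT normr_ge0.
have fE : f = f1 \- f2.
  apply/funext => x; rewrite /f1 /f2 /=; have [h|h] := leP 0 (f x).
    by rewrite [X in _ - X]max_r ?subr0//; lra.
  by rewrite [X in _ - X]max_l ?sub0r ?opprK//; lra.
have d1 : in_Lp f1.
  by apply: (in_Lp_le mf1 df) => x; have /andP[? ?] := f1f x; rewrite ger0_norm.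
have d2 : in_Lp f2.
  by apply: (in_Lp_le mf2 df) => x; have /andP[? ?] := f2f x; rewrite ger0_norm.
have h1 : mu.-integrable setT (fun x => (riesz_density x * f1 x)%:E).
  apply: le_integrable hf => //; first by apply/measurable_EFinP/measurable_funM.
  move=> x _; rewrite lee_fin !normrM ler_wpM2l//; have /andP[? ?] := f1f x.
  by rewrite ger0_norm.
have h2 : mu.-integrable setT (fun x => (riesz_density x * f2 x)%:E).
  apply: le_integrable hf => //; first by apply/measurable_EFinP/measurable_funM.
  move=> x _; rewrite lee_fin !normrM ler_wpM2l//; have /andP[? ?] := f2f x.
  by rewrite ger0_norm.
rewrite {1}fE rieszB// riesz_nonneg//; last by move=> x; have /andP[] := f1f x.
rewrite riesz_nonneg//; last by move=> x; have /andP[] := f2f x.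
rewrite -RintegralB//; apply: eq_Rintegral => x _ /=.
by rewrite -mulrBr; congr (_ * _); rewrite fE.
Qed.

(** Test [l] on the extremal function cut off to the set [E k] where it is bounded. With [j] the
    integral of [|h|^q w^(1-q)] over [E k], this gives [j = l e <= C * j^(1/p)], hence
    [j^(1/q) <= C]; monotone convergence in [k] finishes. The cut-off guarantees beforehand that [j]
    is finite. *)
Lemma riesz_hnorm : (hnorm w p riesz_density <= C%:E)%E.
Proof.
pose h := riesz_density; have mh : measurable_fun setT h := measurable_riesz_density.
have me := measurable_extremal p mw mh.
pose E k := [set x : V | `|extremal w p h x| <= k%:R].
have mE k : measurable (E k).
  rewrite -[E k]setTI.
  have mne : measurable_fun setT (fun x => `|extremal w p h x|) by exact: measurableT_comp.
  have := mne measurableT _ (measurable_itv `]-oo, k%:R]).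
  by congr (measurable (_ `&` _)); apply/seteqP; split => x /=; rewrite in_itv.
pose g (x : V) : \bar R := (`|h x| `^ q * w x `^ (1 - q))%:E.
have g0 x : (0 <= g x)%E by rewrite lee_fin mulr_ge0 ?powR_ge0.
have mg : measurable_fun setT g.
  apply/measurable_EFinP/measurable_funM.
    by apply: (measurableT_comp (measurable_powR _)); exact: measurableT_comp.
  exact: measurableT_comp (measurable_powR _) mw.
have gk k : (\int[mu]_(x in E k) g x <= (C `^ q)%:E)%E.
  pose hk x := h x * \1_(E k) x.
  have mhk : measurable_fun setT hk.
    by apply: measurable_funM => //; exact: measurable_indic.
  have hkM x : ~ M x -> hk x = 0 by move=> nM; rewrite /hk /h riesz_density0 ?mul0r.
  pose e := extremal w p hk.
  have mek : measurable_fun setT e by exact: measurable_extremal.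
  have eE x : e x = extremal w p h x * \1_(E k) x.
    rewrite /e /extremal /hk indicE; case: (x \in E k); first by rewrite !mulr1.
    by rewrite !mulr0 !mul0r.
  have ek x : `|e x| <= k%:R.
    rewrite eE indicE; have [|] := boolP (x \in E k); first by rewrite inE mulr1.
    by rewrite mulr0 normr0.
  have de : in_Lp e by exact: in_Lp_bounded mek ek.
  have he : mu.-integrable setT (fun x => (h x * e x)%:E).
    apply: le_integrable (integrableZl measurableT k%:R riesz_density_integrable) => //.
      by apply/measurable_EFinP/measurable_funM.
    move=> x _; rewrite lee_fin (normrM (h x) (e x)) (normrM k%:R (h x)) mulrC.
    by apply: ler_pM => //; exact: le_trans (ek x) (ler_norm _).
  have leE : (l e)%:E = (\int[mu]_(x in E k) g x)%E.
    rewrite riesz_signed// /Rintegral fineK; last exact: integrable_fin_num.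
    rewrite [RHS]integral_mkcond; apply: eq_integral => x _.
    rewrite patchE eE indicE; case: ifPn => _; last by rewrite !mulr0.
    by rewrite mulr1 extremal_mul.
  have gE : (\int[mu]_x (`|hk x| `^ q * w x `^ (1 - q))%:E = (l e)%:E)%E.
    rewrite leE [RHS]integral_mkcond; apply: eq_integral => x _.
    rewrite patchE /hk indicE; case: ifPn => _; first by rewrite mulr1.
    by rewrite mulr0 normr0 powR0 ?lt0r_neq0// mul0r.
  have := lC de; rewrite (wnorm_extremal p1 w0 mM mhk hkM) gE poweR_EFin -EFinM lee_fin.
  rewrite -leE lee_fin; have le0 : 0 <= l e.
    by rewrite -lee_fin leE; exact: integral_ge0.
  (* The case [j = 0] is separated because [j^(1/p)] is about to be divided out. *)
  move: (l e) le0 => j; rewrite le_eqVlt => /predU1P[<- _|j0]; first exact: powR_ge0.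
  rewrite (gtr0_norm j0) => jC.
  have : j `^ q^-1 <= C.
    have -> : q^-1 = 1 - p^-1 by have := conj_exp_inv p1; rewrite -/q; lra.
    rewrite powRB; last by apply/implyP => _; exact: lt0r_neq0.
    by rewrite powRr1 ?(ltW j0)// ler_pdivrMr ?powR_gt0.
  move=> jqC; rewrite -[leLHS]powRr1 ?(ltW j0)// -[X in _ `^ X <= _](mulVf (lt0r_neq0 q0)) powRrM.
  by rewrite ge0_ler_powR ?nnegrE ?powR_ge0// ltW.
have ndE : nondecreasing_seq E.
  move=> i j ij; apply/subsetPset => x /= xi; apply: le_trans xi _.
  by rewrite ler_nat.
have ET : \bigcup_k E k = setT.
  apply/seteqP; split => // x _; exists (Num.truncn `|extremal w p h x|).+1 => //.
  by rewrite /E/= ltW// truncnS_gt.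
have := @ge0_nondecreasing_set_cvg_integral _ _ _ E g mu ndE mE
  (fun k => measurable_funS measurableT (@subsetT _ _) mg) (fun k x _ => g0 x).
rewrite ET => gcvg.
have gC : (\int[mu]_x g x <= (C `^ q)%:E)%E.
  rewrite -(cvg_lim _ gcvg)//; apply: lime_le; first by apply/cvg_ex; eexists; exact: gcvg.
  exact: nearW.
rewrite (hnormE w p1).
have -> : C%:E = ((C `^ q)%:E `^ q^-1)%E.
  by rewrite poweR_EFin -powRrM (mulfV (lt0r_neq0 q0)) powRr1.
by apply: le_poweR; [rewrite invr_ge0 ltW|apply: integral_ge0 => x _; exact: g0|exact: gC].
Qed.

Theorem riesz_representation : exists h : V -> R, [/\ measurable_fun setT h,
  forall x, ~ M x -> h x = 0, (hnorm w p h <= C%:E)%E &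
  forall f, in_Lp f -> mu.-integrable setT (fun x => (h x * f x)%:E) /\
    l f = \int[mu]_x (h x * f x)].
Proof.
have mh := measurable_riesz_density.
exists riesz_density; split => //; [exact: riesz_density0|exact: riesz_hnorm|].
move=> f df.
(* Now that [hnorm] is bounded, Hoelder's inequality supplies the integrability which [riesz_signed]
   asks for. *)
suff hf : mu.-integrable setT (fun x => (riesz_density x * f x)%:E).
  by split => //; exact: riesz_signed.
apply/integrableP; split.
  by apply/measurable_EFinP/measurable_funM => //; exact: df.1.
have := hnorm_pairing p1 w0 mw mM mh df.1 (aeW _ riesz_density0).
move=> /le_lt_trans; apply; apply: lte_mul_pinfty.
- exact: Lnorm_ge0.
- by rewrite ge0_fin_numE ?Lnorm_ge0// (le_lt_trans riesz_hnorm)// ltry.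
- exact: df.2.
Qed.

End riesz.

(** The duality norm is attained, so no approximation enters when finitely many cubes are tested at
    once. *)
Lemma extremal_normalized {R : realType} {n : nat} (w : 'rV[R]_n -> R) (p : R)
    (M : set 'rV[R]_n) (h : 'rV[R]_n -> R) :
  1 < p -> (forall x, 0 < w x) -> measurable_fun setT w -> measurable M ->
  measurable_fun setT h -> (forall x, ~ M x -> h x = 0) ->
  (hnorm w p h < +oo)%E ->
  exists f, [/\ measurable_fun setT f, (wnorm w p M f <= 1)%E &
    (\int[lebesgue_rV n]_x (h x * f x))%:E = hnorm w p h].
Proof.
move=> p1 w0 mw mM mh hM hoo.
have p0 : 0 < p by exact: lt_trans p1.
have q0 : 0 < conj_exp p by rewrite (lt_trans ltr01)// conj_exp_gt1.
have me := measurable_extremal p mw mh.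
have we := wnorm_extremal p1 w0 mM mh hM.
have hE := hnormE w p1 h.
set J := (\int[_]_x _)%E in we hE.
have J0 : (0 <= J)%E by apply: integral_ge0 => x _; rewrite lee_fin mulr_ge0 ?powR_ge0.
have JE : J = (\int[lebesgue_rV n]_x (h x * extremal w p h x)%:E)%E.
  by apply: eq_integral => x _; rewrite extremal_mul.
have Joo : (J < +oo)%E.
  by apply: (@lty_poweRy _ J (conj_exp p)^-1); rewrite ?invr_neq0 ?lt0r_neq0// -hE.
have [j Jj] : exists j, J = j%:E by exists (fine J); rewrite fineK// ge0_fin_numE.
have j0 : 0 <= j by rewrite -lee_fin -Jj.
rewrite Jj poweR_EFin in we; rewrite Jj poweR_EFin in hE.
(* If [j = 0] the inverse is 0 by convention; the test function is then 0 and both sides of the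
   pairing formula vanish. *)
exists (fun x => (j `^ p^-1)^-1 * extremal w p h x); split.
- exact: measurable_funM.
- rewrite wnormZ// we ger0_norm ?invr_ge0 ?powR_ge0// -EFinM lee_fin.
  have [->|jp] := eqVneq (j `^ p^-1) 0; first by rewrite mulr0.
  by rewrite mulVf.
- rewrite /Rintegral.
  under eq_integral do rewrite mulrCA EFinM.
  rewrite integralZl//; last first.
    apply/integrableP; split; first by apply/measurable_EFinP/measurable_funM.
    apply: le_lt_trans Joo; rewrite JE le_eqVlt; apply/orP; left; apply/eqP.
    apply: eq_integral => x _.
    by rewrite gee0_abs// lee_fin extremal_mul// mulr_ge0 ?powR_ge0.
  rewrite -JE Jj /= hE; congr EFin.
  move: j0; rewrite le_eqVlt => /predU1P[<-|j0].
    by rewrite mulr0 powR0// invr_neq0// lt0r_neq0.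
  rewrite mulrC -[X in X / _](powRr1 (ltW j0)) -powRB.
    by congr (_ `^ _); have := conj_exp_inv p1; lra.
  by apply/implyP => _; exact: lt0r_neq0.
Qed.

(** * Representation of real functionals by families over the cubes *)

Section real_representation.
Context {R : realType} {n : nat}.
Notation V := 'rV[R]_n.
Notation mu := (lebesgue_rV n : {measure set V -> \bar R}).
Notation I := (int * 'rV[int]_n)%type.
Notation Q := (@dyadic_cube R n).
Variables (w : V -> R) (p r rho : R).
Hypothesis n0 : (0 < n)%N.
Hypothesis p1 : 1 < p.
Hypothesis rp : - (n%:R / p) < r.
Hypothesis r0 : r < 0.
Hypothesis rrho : r + rho = - n%:R.
Hypothesis w0 : forall x, 0 < w x.
Hypothesis Apw : Ap p w.

Let q := conj_exp p.
Let u := - (n%:R / r).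
Local Notation b := (cube_factor p r w).
Local Notation a := (cube_factor q rho w).
Let mw : measurable_fun setT w := measurable_weight Apw.
Let p0 : 0 < p. Proof. exact: lt_trans p1. Qed.
Let b0 JM : 0 < b JM. Proof. exact: cube_factor_gt0 w0 Apw JM. Qed.
Let aE JM : a JM = (b JM)^-1. Proof. exact: cube_factor_dual. Qed.
Let mQ JM : measurable (Q JM). Proof. exact: measurable_dyadic_cube. Qed.
Let wQ JM : (\int[mu]_(x in Q JM) (w x)%:E < +oo)%E.
Proof. by rewrite -(weight_dyadicE Apw) ltry. Qed.

Let component (JM : I) (f : V -> R) : \bar R := ((b JM)%:E * wnorm w p (Q JM) f)%E.

Let component_ge0 JM f : (0 <= component JM f)%E.
Proof. by rewrite mule_ge0 ?wnorm_ge0// lee_fin ltW. Qed.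

(** [R^o] equips the families with the module structure that [hahn_banach] expects. Functions are
    not taken modulo null sets, so the supremum norm below is only a seminorm. *)
Let family := I -> V -> R^o.

Let bounded_by (F : family) (m : R) := forall JM, (component JM (F JM) <= m%:E)%E.

Let A : set family :=
  [set F | (forall JM, measurable_fun setT (F JM)) /\ exists m, bounded_by F m].

Let component0 JM : component JM (cst 0) = 0%E.
Proof. by rewrite /component (wnorm_cst w0 mw p0 0 (mQ JM)) normr0 mul0e mule0. Qed.

Let A0 : A 0.
Proof.
split; first by move=> JM; exact: measurable_cst.
by exists 0 => JM; rewrite component0.
Qed.

Let bounded_lin c (F F' : family) m m' : A F -> A F' ->
  bounded_by F m -> bounded_by F' m' -> bounded_by (c *: F + F') (`|c| * m + m').
Proof.
move=> [mF _] [mF' _] Fm Fm' JM.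
have mcF : measurable_fun setT (fun x => c * F JM x) by exact: measurable_funM.
apply: (@le_trans _ _ (component JM (fun x => c * F JM x)%R + component JM (F' JM))%E).
  rewrite /component -ge0_muleDr ?wnorm_ge0//.
  by apply: lee_wpmul2l; [rewrite lee_fin ltW|exact: wnormD (ltW p1) mw (mQ JM) mcF (mF' JM)].
rewrite EFinD leeD//.
rewrite /component (wnormZ c w0 p0 mw (mQ JM) (mF JM)) muleCA EFinM.
by apply: lee_wpmul2l; [rewrite lee_fin|exact: Fm].
Qed.

Let A_lin c F F' : A F -> A F' -> A (c *: F + F').
Proof.
move=> AF AF'; have [mF [m Fm]] := AF; have [mF' [m' Fm']] := AF'; split.
  by move=> JM; apply: measurable_funD => //; exact: measurable_funM.
by exists (`|c| * m + m'); exact: bounded_lin.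
Qed.

(** Meaningful on [A] only, where the supremum is finite; [fine] would send an infinite one to 0. *)
Let sup_norm (F : family) : R := fine (ereal_sup (range (fun JM => component JM (F JM)))).

Let sup_norm_ub F : A F -> bounded_by F (sup_norm F).
Proof.
move=> [_ [m Fm]] JM; rewrite /sup_norm fineK.
  by apply: ereal_sup_ubound; exists JM.
rewrite ge0_fin_numE.
  by apply: (@le_lt_trans _ _ m%:E); [apply: ge_ereal_sup => _ [JM' _ <-]|exact: ltry].
apply: le_trans (component_ge0 JM (F JM)) _.
by apply: ereal_sup_ubound; exists JM.
Qed.

Let sup_norm_le F m : bounded_by F m -> sup_norm F <= m.
Proof.
move=> Fm; have i0 : I by exact: (0, 0).
rewrite -lee_fin /sup_norm fineK.
  by apply: ge_ereal_sup => _ [JM _ <-].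
rewrite ge0_fin_numE.
  by apply: (@le_lt_trans _ _ m%:E); [apply: ge_ereal_sup => _ [JM' _ <-]|exact: ltry].
apply: le_trans (component_ge0 i0 (F i0)) _.
by apply: ereal_sup_ubound; exists i0.
Qed.

Variables (l : (V -> R) -> R) (C : R).
Hypothesis C0 : 0 <= C.
Hypothesis llin : forall c f g, in_Lp w u setT f -> in_Lp w u setT g ->
  l (fun x => c * f x + g x) = c * l f + l g.
Hypothesis lC : forall f m, in_Lp w u setT f ->
  (forall JM, ((b JM)%:E * wnorm w p (Q JM) f <= m%:E)%E) -> `|l f| <= C * m.

Let pu : p < u. Proof. exact: morrey_exp_gt. Qed.
Let u0 : 0 < u. Proof. exact: lt_trans pu. Qed.

Let Lu_bounded f : in_Lp w u setT f ->
  bounded_by (fun=> f) (fine (wnorm w u setT f)).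
Proof.
move=> [mf foo] JM; rewrite fineK ?ge0_fin_numE ?wnorm_ge0//.
exact: morrey_le_wnormT.
Qed.

Let diagonal : set family := [set F | exists f, in_Lp w u setT f /\ F = fun=> f].

Let diagonal_sub : diagonal `<=` A.
Proof.
move=> _ [f [df ->]]; split; first by move=> _; exact: df.1.
by exists (fine (wnorm w u setT f)); exact: Lu_bounded.
Qed.

(** The dominating functional is [C * sup_norm]. On a diagonal family the supremum norm is the
    Morrey norm of the function, so domination there is the hypothesis on [l]. *)
Let extension : exists G : family -> R,
  [/\ forall c F F', A F -> A F' -> G (c *: F + F') = c * G F + G F',
      forall f, in_Lp w u setT f -> G (fun=> f) = l f &
      forall F m, A F -> bounded_by F m -> `|G F| <= C * m].
Proof.
(* A diagonal family has the same function at every index, so any index recovers it. *)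
pose i0 : I := (0, 0).
have mT : measurable (setT : set V) by [].
have [] := @hahn_banach R family A diagonal (fun F => C * sup_norm F) (fun F => l (F i0)).
- exists (cst 0); split => //; split; first exact: measurable_cst.
  by rewrite (wnorm_cst w0 mw u0 0 mT) normr0 mul0e.
- move=> c _ _ [f [df ->]] [g [dg ->]]; exists (fun x => c * f x + g x); split => //.
  by apply: (in_Lp_lin _ w0 mw mT) => //; exact: lt_trans pu.
- exact: diagonal_sub.
- exact: A_lin.
- move=> F F' AF AF'; rewrite -mulrDr ler_wpM2l//; apply: sup_norm_le.
  have := bounded_lin 1 AF AF' (sup_norm_ub AF) (sup_norm_ub AF').
  by rewrite scale1r normr1 mul1r.
- have key c F : A F -> 0 < c -> sup_norm (c *: F) <= c * sup_norm F.
    move=> AF c0; apply: sup_norm_le.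
    have b00 : bounded_by 0 0.
      by move=> JM; rewrite component0.
    have := bounded_lin c AF A0 (sup_norm_ub AF) b00.
    by rewrite !addr0 gtr0_norm.
  move=> c F AF c0; rewrite mulrCA; congr (C * _); apply/eqP; rewrite eq_le key//=.
  have AcF : A (c *: F) by rewrite -[c *: F]addr0; exact: A_lin.
  rewrite mulrC -ler_pdivlMr// mulrC; apply: le_trans (key c^-1 _ AcF _); last by rewrite invr_gt0.
  by rewrite scalerA mulVf ?lt0r_neq0// scale1r.
- by move=> c _ _ [f [df ->]] [g [dg ->]]; exact: llin.
- move=> _ [f [df ->]]; apply: (le_trans (ler_norm _)); apply: lC => //.
  by apply: sup_norm_ub; apply: diagonal_sub; exists f.
move=> G [Glin GL GN]; exists G; split => //.
  by move=> f df; apply: GL; exists f.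
(* Domination is one-sided; the bound for the absolute value follows by applying this to [-F] as
   well. *)
have GC F m : A F -> bounded_by F m -> G F <= C * m.
  by move=> AF Fm; apply: le_trans (GN F AF) _; rewrite ler_wpM2l// sup_norm_le.
move=> F m AF Fm; rewrite ler_norml GC// andbT.
have b00 : bounded_by 0 0.
  by move=> JM; rewrite component0.
have G0 : G 0 = 0.
  have := Glin (-1) 0 0 A0 A0.
  by rewrite scaler0 addr0 mulN1r addNr.
have := GC _ _ (A_lin (-1) AF A0) (bounded_lin (-1) AF A0 Fm b00).
by rewrite Glin// G0 !addr0 mulN1r normrN1 mul1r lerNl.
Qed.

Let delta JM (f : V -> R) : family := fun JM' => if JM' == JM then f else cst 0.

Let component_fin JM f : in_Lp w p (Q JM) f -> component JM f \is a fin_num.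
Proof. by move=> [mf foo]; rewrite fin_numM// ge0_fin_numE// wnorm_ge0. Qed.

Let delta_bounded JM f : in_Lp w p (Q JM) f ->
  A (delta JM f) /\ bounded_by (delta JM f) (fine (component JM f)).
Proof.
move=> df; have [mf foo] := df.
have h : bounded_by (delta JM f) (fine (component JM f)).
  move=> JM'; rewrite (fineK (component_fin df)) /delta.
  case: eqP => [->|_]; [exact: lexx|].
  by rewrite component0; exact: component_ge0.
split => //; split; last by exists (fine (component JM f)).
by move=> JM'; rewrite /delta; case: eqP.
Qed.

Let spread (s : seq I) (phi : I -> V -> R) : family :=
  fun JM => if JM \in s then phi JM else cst 0.

(** The convergence statement compares the constant family [f] with its restriction to a finite set
    of indices. The difference is 0 on that set and, by [morrey_vanish], uniformly small off it, so
    [G] of the difference is small. *)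
Lemma real_representation : exists h : I -> V -> R,
  [/\ forall JM, measurable_fun setT (h JM),
      forall JM x, ~ Q JM x -> h JM x = 0,
      (\esum_(JM in [set: I]) ((a JM)%:E * hnorm w p (h JM)) <= C%:E)%E &
      forall f, in_Lp w u setT f ->
        summability.partial_sum (fun JM => \int[mu]_x (h JM x * f x))
          @ summability.totally --> l f].
Proof.
have [G [Glin Gl GC]] := extension.
have /choice[h hP] : forall JM, exists h : V -> R, [/\ measurable_fun setT h,
    forall x, ~ Q JM x -> h x = 0, (hnorm w p h <= (C * b JM)%:E)%E &
    forall f, in_Lp w p (Q JM) f -> mu.-integrable setT (fun x => (h x * f x)%:E) /\
      G (delta JM f) = \int[mu]_x (h x * f x)].
  move=> JM; apply: (@riesz_representation _ _ w p (Q JM) p1 w0 mw (mQ JM) (wQ JM)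
    (fun f => G (delta JM f))).
  - by rewrite mulr_ge0// ltW.
  - move=> c f g df dg; rewrite -Glin; [|exact: (delta_bounded df).1|exact: (delta_bounded dg).1].
    congr G; apply/funext => JM'; rewrite /delta; case: eqP => JMJM'.
      by apply/funext => x; rewrite !fctE JMJM' eqxx.
    by apply/funext => x; rewrite !fctE; case: eqP => //; rewrite scaler0 addr0.
  - move=> f df; have [Ad bd] := delta_bounded df.
    have := GC _ _ Ad bd; rewrite -lee_fin EFinM (fineK (component_fin df)).
    by rewrite [component _ _]/component muleA -EFinM.
have hL JM f : in_Lp w p (Q JM) f -> G (delta JM f) = \int[mu]_x (h JM x * f x).
  by have [_ _ _ H] := hP JM; move=> df; have [] := H f df.
have spreadP s phi : uniq s -> (forall JM, in_Lp w p (Q JM) (phi JM)) ->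
    A (spread s phi) /\
    G (spread s phi) = \sum_(JM <- s) \int[mu]_x (h JM x * phi JM x).
  move=> + dphi; elim: s => [_|JM s IH /= /andP[JMs us]].
    have -> : spread [::] phi = 0 by [].
    split => //; rewrite big_nil.
    by have := Glin (-1) 0 0 A0 A0; rewrite scaler0 addr0 mulN1r addNr.
  have [As Gs] := IH us; have [Ad _] := delta_bounded (dphi JM).
  have -> : spread (JM :: s) phi = 1 *: delta JM (phi JM) + spread s phi.
    apply/funext => JM'; apply/funext => x; rewrite !fctE scale1r /spread /delta inE.
    case: eqP => [->|_] /=; first by rewrite (negbTE JMs) addr0.
    by rewrite add0r.
  by split; [exact: A_lin|rewrite Glin// mul1r Gs big_cons hL].
exists h; split.
- by move=> JM; have [] := hP JM.
- by move=> JM; have [] := hP JM.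
- apply: ge_ereal_sup => _ [F [finF _] <-].
  rewrite fsbig_finite//=; pose s := finmap.enum_fset (fset_set F); rewrite -/s.
  have us : uniq s by exact: finmap.fset_uniq.
  have /choice[t tP] : forall JM, exists f : V -> R, [/\ measurable_fun setT f,
      (wnorm w p (Q JM) f <= 1)%E &
      (\int[mu]_x (h JM x * f x))%:E = hnorm w p (h JM)].
    move=> JM; have [mh hQ hC _] := hP JM.
    by apply: extremal_normalized => //; exact: le_lt_trans hC (ltry _).
  (* Since [a JM = (b JM)^-1], every component has norm at most 1, while the pairing with [h JM]
     becomes exactly the term [a JM * hnorm (h JM)] of the sum to be bounded. *)
  pose phi JM x := a JM * t JM x.
  have a0 JM : 0 <= a JM by rewrite aE invr_ge0 ltW.
  have phi1 JM : (component JM (phi JM) <= 1)%E.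
    have [mt t1 _] := tP JM.
    rewrite /component (wnormZ _ w0 p0 mw (mQ JM) mt) ger0_norm// muleA -EFinM.
    by rewrite aE mulfV ?lt0r_neq0// mul1e.
  have dt JM : in_Lp w p (Q JM) (t JM).
    by have [mt t1 _] := tP JM; split => //; exact: le_lt_trans t1 (ltry _).
  have dphi JM : in_Lp w p (Q JM) (phi JM).
    have [mt t1 _] := tP JM; split; first exact: measurable_funM.
    rewrite (wnormZ _ w0 p0 mw (mQ JM) mt); apply: lte_mul_pinfty => //.
    exact: le_lt_trans t1 (ltry _).
  have [Asp Gsp] := spreadP s phi us dphi.
  have bsp : bounded_by (spread s phi) 1.
    by move=> JM; rewrite /spread; case: ifP => // _; rewrite component0 lee_fin.
  have := GC _ _ Asp bsp; rewrite mulr1 => /(le_trans (ler_norm _)); rewrite Gsp => H.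
  apply: (@le_trans _ _ (\sum_(JM <- s) \int[mu]_x (h JM x * phi JM x))%:E); last by rewrite lee_fin.
  rewrite -sumEFin le_eqVlt; apply/orP; left; apply/eqP; apply: eq_bigr => JM _.
  have [_ _ tE] := tP JM; rewrite -tE -EFinM; congr EFin.
  have [_ _ _ /(_ _ (dt JM))[hint _]] := hP JM.
  rewrite -RintegralZl//; apply: eq_Rintegral => x _; by rewrite mulrCA.
- move=> f df; have [mf foo] := df.
  have FF := @summability.totally_filter I.
  apply/cvgrPdist_le => e e0.
  have d0 : 0 < e / (C + 1) by rewrite divr_gt0// ltr_wpDl.
  have [S [finS hS]] : exists S : set I, finite_set S /\
      forall JM, ~ S JM -> (component JM f <= (e / (C + 1))%:E)%E.
    exact: (morrey_vanish n0 p1 rp r0 w0 Apw mf foo d0).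
  exists (fset_set S) => // B /= SB.
  have dQ JM : in_Lp w p (Q JM) f.
    split => //; have : (component JM f <= wnorm w u setT f)%E.
      exact: morrey_le_wnormT.
    move=> /le_lt_trans/(_ foo); have [//|] := eqVneq (wnorm w p (Q JM) f) +oo%E.
      by rewrite /component => ->; rewrite gt0_muley ?lte_fin.
    by rewrite -ltey.
  have -> : summability.partial_sum (fun JM => \int[mu]_x (h JM x * f x)) B =
      \sum_(JM <- finmap.enum_fset B) \int[mu]_x (h JM x * f x).
    by rewrite finmap.big_seq_fsetE.
  have [Asp Gsp] := spreadP (finmap.enum_fset B) (fun=> f) (finmap.fset_uniq B) dQ.
  rewrite -Gsp -Gl//.
  have Af : A (fun=> f) by apply: diagonal_sub; exists f.
  (* The error is [G] of one bounded family, to which [GC] applies. *)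
  have -> : G (fun=> f) - G (spread (finmap.enum_fset B) (fun=> f)) =
      G (-1 *: spread (finmap.enum_fset B) (fun=> f) + (fun=> f)).
    by rewrite Glin// mulN1r addrC.
  apply: (@le_trans _ _ (C * (e / (C + 1)))); last first.
    rewrite mulrCA ler_piMr ?(ltW e0)// ler_pdivrMr ?ltr_wpDl//.
    by rewrite mul1r lerDl.
  apply: GC; first exact: A_lin.
  move=> JM; have [JMB|JMB] := boolP (JM \in finmap.enum_fset B).
    rewrite (_ : (_ + _) JM = cst 0) ?component0 ?lee_fin ?(ltW d0)//.
    by apply/funext => x; rewrite !fctE /spread JMB scaleN1r addNr.
  rewrite (_ : (_ + _) JM = f).
    apply: hS => SJM; move/negP : JMB; apply.
    by apply: (finmap.fsubsetP SB); rewrite in_fset_set// inE.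
  by apply/funext => x; rewrite !fctE /spread (negbTE JMB) scaler0 add0r.
Qed.

End real_representation.

(** * Test functions and density *)

Section bump.
Context {R : realType}.
Implicit Types t : R.

(** The standard flat function [exp (-1/t)] multiplied by [t^-m]. The extra powers make the
    collection stable under differentiation up to linear combinations. *)
Definition flat_exp (m : nat) (t : R) : R :=
  if 0 < t then (t^-1) ^+ m * expR (- t^-1) else 0.

Lemma flat_exp_ge0 m t : 0 <= flat_exp m t.
Proof.
rewrite /flat_exp; case: ifPn => // t0.
by rewrite mulr_ge0 ?expR_ge0// exprn_ge0// invr_ge0 ltW.
Qed.

(** From [exp (1/t) >= t^-(m+1) / (m+1)!] for [t > 0]. This is what makes the functions continuous
    and flat at 0. *)
Lemma flat_exp_le m t : flat_exp m t <= m.+1`!%:R * `|t|.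
Proof.
rewrite /flat_exp; case: ifPn => t0; last by rewrite mulr_ge0.
have ti0 : 0 < t^-1 by rewrite invr_gt0.
have := expR_ge1Dxn m (ltW ti0) => h.
have {h} : t^-1 ^+ m.+1 / m.+1`!%:R <= expR t^-1 by apply: le_trans h; rewrite lerDr.
rewrite ler_pdivrMr ?ltr0n ?fact_gt0// => h.
rewrite expRN ler_pdivrMr ?expR_gt0// gtr0_norm// -mulrA mulrCA.
by rewrite -ler_pdivrMl// [leRHS]mulrC -exprS.
Qed.

Lemma flat_exp_ge t m : 0 < t -> is_derive t 1 (flat_exp m)
  (- m%:R * flat_exp m.+1 t + flat_exp m.+2 t).
Proof.
move=> t0; have tn0 : t != 0 by exact: lt0r_neq0.
apply: (@near_eq_is_derive R R R (fun x : R => (x^-1) ^+ m * expR (- x^-1))).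
  have : \forall x \near t, 0 < x by exact: lt_nbhsr.
  by apply: filterS => x x0; rewrite /flat_exp x0.
have d1 : is_derive t 1 (fun x : R => x^-1) (- t ^- 2).
  have := @is_deriveV R id t 1 1 tn0 (is_derive_id t 1).
  by move/is_derive_eq; apply; rewrite /GRing.scale/= mulr1.
have d2 : is_derive t 1 (fun x : R => expR (- x^-1)) (expR (- t^-1) * t ^- 2).
  have dN : is_derive t 1 (fun x : R => - x^-1) (- - t ^- 2) by exact: is_deriveN.
  have := @is_derive1_comp R expR (fun x : R => - x^-1) t _ _ (is_derive_expR _) dN.
  by move/is_derive_eq; apply; rewrite opprK.
have d3 := @is_deriveX R R (fun x : R => x^-1) m t 1 _ d1.
rewrite (_ : (fun x : R => _) = (fun x : R => x^-1) ^+ m * (fun x : R => expR (- x^-1))); last first.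
  by apply/funext => x; rewrite !fctE.
have := is_deriveM d3 d2 => /is_derive_eq; apply.
rewrite /flat_exp t0.
rewrite exprfctE /GRing.scale/= -exprVn.
set s := t^-1; set e := expR (- s); clearbody e s; clear.
case: m => [|m]; first by rewrite !mul0r mulr0 oppr0 mul0r addr0 add0r expr0 mul1r mulrC.
by rewrite [m.+1.-1]/= !exprS -natr1; ring.
Qed.

Lemma flat_exp_cvg0 m : flat_exp m x @[x --> 0^'] --> 0.
Proof.
apply/cvgr0Pnorm_le => e e0.
have c0 : 0 < m.+1`!%:R^-1 * e by rewrite mulr_gt0// invr_gt0 ltr0n fact_gt0.
exists (m.+1`!%:R^-1 * e) => //= x + _; rewrite /ball/= sub0r normrN => xe.
rewrite ger0_norm ?flat_exp_ge0// (le_trans (flat_exp_le _ _))//.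
by rewrite -ler_pdivlMl ?ltr0n ?fact_gt0// ltW.
Qed.

(** At 0 the difference quotient of [flat_exp m] is [flat_exp m.+1], which tends to 0; the formula
    also gives 0 there. To the left of 0 everything vanishes. *)
Lemma flat_exp_derive t m : is_derive t 1 (flat_exp m)
  (- m%:R * flat_exp m.+1 t + flat_exp m.+2 t).
Proof.
have [t0|t0|->] := ltgtP t 0; last 2 first.
- exact: flat_exp_ge.
- rewrite /flat_exp ltxx mulr0 addr0 -/(flat_exp m).
  have h : (fun h => h^-1 *: ((flat_exp m \o shift 0) (h *: 1) - flat_exp m 0))
      @ 0^' --> 0.
    have c0 : flat_exp m.+1 x @[x --> 0^'] --> 0.
      exact: flat_exp_cvg0.
    apply: cvg_trans c0; apply: near_eq_cvg; near=> x.
    have x0 : x != 0 by near: x; exact: nbhs_dnbhs_neq.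
    rewrite /= /flat_exp addr0 ltxx subr0 /GRing.scale/= mulr1.
    by case: ifPn => // _; [rewrite mulrA -exprS|rewrite mulr0].
  by apply: DeriveDef; [apply/cvg_ex; exists 0|exact: cvg_lim].
- have -> : - m%:R * flat_exp m.+1 t + flat_exp m.+2 t = 0.
    by rewrite /flat_exp !ifN -?leNgt ?(ltW t0)// mulr0 addr0.
  apply: (@near_eq_is_derive R R R (cst 0)).
  have : \forall x \near t, x < 0 by exact: lt_nbhsl.
  by apply: filterS => x x0; rewrite /flat_exp ltNge (ltW x0).
Unshelve. all: by end_near. Qed.

Lemma flat_exp_continuous m : continuous (flat_exp m).
Proof.
move=> t; apply: differentiable_continuous; apply/derivable1_diffP.
by have [] := flat_exp_derive t m.
Qed.

Lemma flat_exp0_le1 t : flat_exp 0 t <= 1.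
Proof.
rewrite /flat_exp; case: ifPn => // t0; rewrite expr0 mul1r.
by rewrite -expR0 ler_expR oppr_le0 invr_ge0 ltW.
Qed.

Lemma flat_exp0_cvg1 t : 0 < t -> flat_exp 0 (k%:R * t) @[k --> \oo] --> (1 : R).
Proof.
move=> t0.
have h : expR (- (k.+1%:R^-1 * t^-1)) @[k --> \oo] --> (1 : R).
  rewrite -[X in _ --> X]expR0; apply: continuous_cvg; first exact: continuous_expR.
  rewrite -[X in _ --> X]oppr0; apply: cvgN.
  by rewrite -[X in _ --> X](mul0r t^-1); apply: cvgMl; exact: cvg_harmonic.
rewrite -(cvg_shiftS (fun k => flat_exp 0 (k%:R * t))).
apply: cvg_trans h; apply: near_eq_cvg; apply: nearW => k.
by rewrite /= /flat_exp mulr_gt0// expr0 mul1r invfM.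
Qed.

End bump.

Section smooth_functions.
Context {R : realType} {n : nat}.
Notation V := 'rV[R]_n.

(* An algebra of smooth functions stable by partial derivatives and containing
   the functions [exp (-1 / (c x_i + d))], extended by 0. *)
Inductive flat_algebra : (V -> R) -> Prop :=
| flat_gen i m c d : flat_algebra (fun x => flat_exp m (c * x 0 i + d))
| flat_cst c : flat_algebra (fun=> c)
| flat_add f g : flat_algebra f -> flat_algebra g -> flat_algebra (fun x => f x + g x)
| flat_mul f g : flat_algebra f -> flat_algebra g -> flat_algebra (fun x => f x * g x).

Lemma is_derive_coord (g : R -> R) (dg : R) (i j : 'I_n) (x : V) :
  is_derive (x 0 j) 1 g dg ->
  is_derive x (delta_mx 0 i) (fun y : V => g (y 0 j)) (if j == i then dg else 0).
Proof.
move=> [gd gE].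
have E : (fun h : R => h^-1 *: (((fun y : V => g (y 0 j)) \o shift x) (h *: delta_mx 0 i) -
      g (x 0 j))) =
    if j == i then (fun h : R => h^-1 *: ((g \o shift (x 0 j)) (h *: 1) - g (x 0 j)))
    else cst 0.
  apply/funext => h /=; rewrite !mxE eqxx/=; case: ifPn => ji.
    by [].
  by rewrite mulr0 add0r subrr scaler0.
split; rewrite ?/derivable ?/derive E; case: ifPn => ji.
- exact: gd.
- exact: is_cvg_cst.
- exact: gE.
- exact: lim_cst.
Qed.

Lemma flat_algebra_derive f : flat_algebra f -> forall i, exists f',
  flat_algebra f' /\ forall x, is_derive x (delta_mx 0 i) f (f' x).
Proof.
elim=> [j m c d|c|{}f g _ IHf _ IHg|{}f g ff IHf fg IHg] i.
- have dg (t : R) : is_derive t 1 (fun s => flat_exp m (c * s + d))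
      ((- m%:R * flat_exp m.+1 (c * t + d) + flat_exp m.+2 (c * t + d)) * c).
    have da : is_derive t 1 (fun s : R => c * s + d) c.
      have := is_deriveD (is_deriveZ c (@is_derive_id R R t 1)) (@is_derive_cst R R R d t 1).
      by move/is_derive_eq; apply; rewrite addr0 /GRing.scale/= mulr1.
    exact: (@is_derive1_comp R (flat_exp m) (fun s => c * s + d) t _ _ (flat_exp_derive _ _) da).
  exists (fun x => if j == i then (- m%:R * flat_exp m.+1 (c * x 0 j + d) +
      flat_exp m.+2 (c * x 0 j + d)) * c else 0); split.
    case: (j == i); last exact: flat_cst.
    apply: flat_mul; last exact: flat_cst.
    apply: flat_add; last exact: flat_gen.
    by apply: flat_mul; [exact: flat_cst|exact: flat_gen].
  by move=> x; apply: (is_derive_coord i (dg (x 0 j))).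
- exists (fun=> 0); split; first exact: flat_cst.
  by move=> x; exact: is_derive_cst.
- have [f' [ff' df]] := IHf i; have [g' [fg' dg]] := IHg i.
  exists (fun x => f' x + g' x); split; first exact: flat_add.
  by move=> x; exact: is_deriveD (df x) (dg x).
- have [f' [ff' df]] := IHf i; have [g' [fg' dg]] := IHg i.
  exists (fun x => f x * g' x + g x * f' x); split.
    by apply: flat_add; exact: flat_mul.
  by move=> x; exact: is_deriveM (df x) (dg x).
Qed.

Lemma flat_algebra_continuous f : flat_algebra f -> continuous f.
Proof.
elim=> [j m c d|c|{}f g _ IHf _ IHg|{}f g _ IHf _ IHg] x.
- apply: (@continuous_comp V R R (fun y : V => c * y 0 j + d) (flat_exp m)); last first.
    exact: flat_exp_continuous.
  apply: (@continuousD R R V (fun y : V => c * y 0 j) (cst d)); last exact: cst_continuous.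
  apply: (@continuousM R V (cst c) (fun y : V => y 0 j)); first exact: cst_continuous.
  exact: coord_continuous.
- exact: cst_continuous.
- exact: (continuousD (IHf x) (IHg x)).
- exact: (continuousM (IHf x) (IHg x)).
Qed.

Lemma flat_algebra_partial f i : flat_algebra f -> flat_algebra (partial i f).
Proof.
move=> /flat_algebra_derive/(_ i)[f' [ff' df]].
rewrite (_ : partial i f = f')//; apply/funext => x.
by have [_ dfE] := df x; exact: dfE.
Qed.

(** Iterated partial derivatives never leave the algebra, so continuity and derivability of its
    elements suffice at every order. *)
Lemma flat_algebra_smooth f : flat_algebra f -> smooth f.
Proof.
move=> ff s; have fs : flat_algebra (partials s f).
  by elim: s => //= i s IH; exact: flat_algebra_partial.
split; first exact: flat_algebra_continuous.
by move=> i x; have [f' [_ /(_ x)[]]] := flat_algebra_derive fs i.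
Qed.

(** For growing [k] each factor tends to 1 inside the box and it stays 0 outside: a smooth
    approximation of the indicator from below. *)
Definition bump (a b : 'I_n -> R) (k : nat) (x : V) : R :=
  \prod_(i < n) (flat_exp 0 (k%:R * (x 0 i - a i)) * flat_exp 0 (k%:R * (b i - x 0 i))).

Lemma flat_algebra_prod (I : Type) (s : seq I) (F : I -> V -> R) :
  (forall i, flat_algebra (F i)) -> flat_algebra (fun x => \prod_(i <- s) F i x).
Proof.
move=> FF; elim: s => [|i s IH].
  by under eq_fun do rewrite big_nil; exact: flat_cst.
by under eq_fun do rewrite big_cons; exact: flat_mul.
Qed.

Lemma bump_flat a b k : flat_algebra (bump a b k).
Proof.
apply: flat_algebra_prod => i; apply: flat_mul.
  rewrite (_ : (fun x => _) = fun x : V => flat_exp 0 (k%:R * x 0 i + - (k%:R * a i))).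
    exact: flat_gen.
  by apply/funext => x; congr flat_exp; ring.
rewrite (_ : (fun x => _) = fun x : V => flat_exp 0 (- k%:R * x 0 i + k%:R * b i)).
  exact: flat_gen.
by apply/funext => x; congr flat_exp; ring.
Qed.

Lemma bump_ge0_le1 a b k x : 0 <= bump a b k x <= 1.
Proof.
apply/andP; split; first by apply: prodr_ge0 => i _; rewrite mulr_ge0// flat_exp_ge0.
by apply: prodr_ile1 => i _; rewrite mulr_ge0 ?flat_exp_ge0//= mulr_ile1 ?flat_exp_ge0 ?flat_exp0_le1.
Qed.

Lemma bump_out a b k x : ~ open_box a b x -> bump a b k x = 0.
Proof.
move=> /existsNP[i /negP]; rewrite negb_and -!leNgt => xi.
apply/eqP; rewrite prodf_seq_eq0; apply/hasP; exists i; first by rewrite mem_index_enum.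
rewrite mulf_eq0 /flat_exp; case/orP: xi => xi.
  by rewrite ifN ?eqxx// -leNgt mulr_ge0_le0// subr_le0.
by rewrite [X in _ || (X == 0)]ifN ?eqxx ?orbT// -leNgt mulr_ge0_le0// subr_le0.
Qed.

Lemma bump_cvg a b x : bump a b ^~ x @ \oo --> (\1_(open_box a b) x : R).
Proof.
rewrite indicE; have [|] := boolP (x \in open_box a b); last first.
  by rewrite notin_setE => nx; apply: cvg_near_cst; apply: nearW => k; rewrite bump_out.
rewrite inE => xab; rewrite -[X in _ --> X](@big1_eq R 1 *%R _ (index_enum 'I_n) xpredT).
rewrite /bump; elim: (index_enum _) => [|i s IH].
  by under eq_fun do rewrite big_nil; rewrite big_nil; exact: cvg_cst.
under eq_fun do rewrite big_cons; rewrite big_cons; apply: cvgM; last exact: IH.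
rewrite -[X in _ --> X]mulr1; have /andP[? ?] := xab i.
by apply: cvgM; apply: flat_exp0_cvg1; rewrite subr_gt0.
Qed.

Lemma open_box_sub_cube (a b : 'I_n -> R) : exists l : R, 0 < l /\ open_box a b `<=` cube 0 l.
Proof.
pose l := 1 + \sum_i (`|a i| + `|b i|).
have S0 i : `|a i| + `|b i| <= \sum_i (`|a i| + `|b i|).
  by rewrite (bigD1 i)//= lerDl sumr_ge0// => j _; rewrite addr_ge0.
exists l; split; first by rewrite ltr_wpDr// sumr_ge0// => j _; rewrite addr_ge0.
move=> x xab i; rewrite mxE subr0; have /andP[xa xb] := xab i.
have := S0 i; have := normr_ge0 (a i); have := normr_ge0 (b i).
have := ler_norm (b i); have := ler_norm (- a i); rewrite normrN /l => *.
by rewrite ler_norml; apply/andP; split; lra.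
Qed.

Definition flat_test (f : V -> R) :=
  flat_algebra f /\ exists l : R, 0 < l /\ forall x, ~ cube 0 l x -> f x = 0.

Lemma bump_test a b k : flat_test (bump a b k).
Proof.
split; first exact: bump_flat.
have [l [l0 abl]] := open_box_sub_cube a b; exists l; split => //.
by move=> x nx; apply: bump_out; apply: contra_not nx; exact: abl.
Qed.

Lemma flat_test_lin c f g : flat_test f -> flat_test g ->
  flat_test (fun x => c * f x + g x).
Proof.
move=> [ff [k [k0 fk]]] [fg [l [l0 gl]]]; split.
  by apply: flat_add => //; apply: flat_mul => //; exact: flat_cst.
exists (Num.max k l); split; first by rewrite lt_max k0.
move=> x nx; rewrite fk ?gl ?mulr0 ?addr0//; apply: contra_not nx; apply: sub_cube => i;
  by rewrite subrr normr0 subr_ge0 le_max lexx ?orbT.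
Qed.

End smooth_functions.

(** * Density of flat test functions in weighted Lebesgue spaces *)

Section density.
Context {R : realType} {n : nat}.
Notation V := 'rV[R]_n.
Notation mu := (lebesgue_rV n : {measure set V -> \bar R}).
Variables (w : V -> R) (s : R).
Hypothesis s1 : 1 <= s.
Hypothesis w0 : forall x, 0 < w x.
Hypothesis mw : measurable_fun setT w.
Hypothesis wloc : forall l, (\int[mu]_(x in cube 0 l) (w x)%:E < +oo)%E.

Let s0 : 0 < s. Proof. exact: lt_le_trans s1. Qed.

Let approximable (f : V -> R) := measurable_fun setT f /\
  forall e : R, 0 < e -> exists phi, flat_test phi /\
    (wnorm w s setT (f \- phi) <= e%:E)%E.

Lemma measurable_flat (f : V -> R) : flat_algebra f -> measurable_fun setT f.
Proof. by move=> /flat_algebra_continuous/continuous_measurable_rV. Qed.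

Let approximable_lin c f g : approximable f -> approximable g ->
  approximable (fun x => c * f x + g x).
Proof.
move=> [mf hf] [mg hg]; split; first by apply: measurable_funD => //; exact: measurable_funM.
move=> e e0.
have d0 : 0 < e / (`|c| + 1) by rewrite divr_gt0// ltr_wpDl.
have e20 : 0 < e / 2 by rewrite divr_gt0.
have d20 : 0 < e / 2 / (`|c| + 1) by rewrite divr_gt0// ltr_wpDl.
have [phi [tphi fphi]] := hf _ d20; have [psi [tpsi gpsi]] := hg _ e20.
exists (fun x => c * phi x + psi x); split; first exact: flat_test_lin.
have mphi := measurable_flat tphi.1; have mpsi := measurable_flat tpsi.1.
have mfp : measurable_fun setT (f \- phi) by exact: measurable_funB.
have mgp : measurable_fun setT (g \- psi) by exact: measurable_funB.
have mcf : measurable_fun setT (fun x => c * (f \- phi) x) by exact: measurable_funM.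
rewrite (_ : (_ \- _) = (fun x => c * (f \- phi) x) \+ (g \- psi)); last first.
  by apply/funext => x /=; ring.
apply: (le_trans (wnormD s1 mw measurableT mcf mgp)).
rewrite (splitr e) EFinD leeD// (wnormZ c w0 s0 mw measurableT mfp).
apply: (@le_trans _ _ (`|c|%:E * (e / 2 / (`|c| + 1))%:E)%E).
  by apply: lee_wpmul2l => //; rewrite lee_fin.
rewrite -EFinM lee_fin mulrCA ler_piMr ?(ltW e20)// ler_pdivrMr ?ltr_wpDl//.
by rewrite mul1r lerDl.
Qed.

Let approximable_lim f (f_ : nat -> V -> R) : measurable_fun setT f ->
  (wnorm w s setT f < +oo)%E -> (forall k, approximable (f_ k)) ->
  (forall x, f_ ^~ x @ \oo --> f x) ->
  (forall k x, `|f x - f_ k x| <= `|f x|) -> approximable f.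
Proof.
move=> mf foo af f_f f_le; split => // e e0.
have e20 : 0 < e / 2 by rewrite divr_gt0.
have /filter_ex[k hk] := wnorm_approx w0 mw s0 measurableT mf (fun k => (af k).1) f_f f_le foo e20.
have [phi [tphi hphi]] := (af k).2 _ e20; exists phi; split => //.
have mk := (af k).1; have mphi := measurable_flat tphi.1.
rewrite (_ : f \- phi = (f \- f_ k) \+ (f_ k \- phi)); last first.
  by apply/funext => x /=; rewrite addrA subrK.
apply: (@le_trans _ _ (wnorm w s setT (f \- f_ k) + wnorm w s setT (f_ k \- phi))%E).
  by apply: wnormD => //; exact: measurable_funB.
by rewrite (splitr e) EFinD leeD.
Qed.

Let indic_lty (A : set V) l : measurable A -> A `<=` cube 0 l ->
  (wnorm w s setT \1_A < +oo)%E.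
Proof.
move=> mA Al; apply/(wnorm_lty _ _ w0 s0); apply: le_lt_trans (wloc l).
have m1 : measurable_fun setT (fun x => (`|\1_A x : R| `^ s * w x)%:E).
  by apply: measurable_wpow => //; exact: measurable_indic.
have m2 : measurable_fun setT ((EFin \o w) \_ (cube 0 l)).
  have mwc : measurable_fun (cube 0 l) (EFin \o w).
    by apply: measurable_funTS; exact/measurable_EFinP.
  exact: ((measurable_restrictT _ (measurable_cube 0 l)).1 mwc).
rewrite [leRHS]integral_mkcond; apply: ge0_le_integral;
  [exact: measurableT|by move=> x _; exact: (wpow_ge0 s \1_A x w0)|exact: m1|exact: m2|].
move=> x _; rewrite patchE indicE; have [xA|xA] := boolP (x \in A).
  by rewrite normr1 powR1 mul1r mem_set//; apply: Al; exact: set_mem.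
  by rewrite normr0 powR0 ?lt0r_neq0// mul0r; case: ifP => // _; rewrite lee_fin ltW.
Qed.

Let approximable_box a b : approximable \1_(open_box a b).
Proof.
have [l [_ abl]] := open_box_sub_cube a b.
apply: (@approximable_lim _ (bump a b)).
- by apply: measurable_indic; exact: measurable_open_box.
- by apply: indic_lty abl; exact: measurable_open_box.
- move=> k; split; first by apply: measurable_flat; exact: bump_flat.
  move=> e e0; exists (bump a b k); split; first exact: bump_test.
  rewrite (_ : _ \- _ = cst 0); last by apply/funext => x /=; rewrite subrr.
  by rewrite (wnorm_cst w0 mw s0 0 measurableT) normr0 mul0e lee_fin ltW.
- exact: bump_cvg.
- move=> k x; rewrite indicE; have [|] := boolP (x \in _).
    have /andP[b0 b1] := bump_ge0_le1 a b k x.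
    by rewrite normr1 ger0_norm ?subr_ge0// lerBlDr lerDl.
  by rewrite notin_setE => /bump_out ->; rewrite subrr.
Qed.

Let approximable0 : approximable (cst 0).
Proof.
split; first exact: measurable_cst.
move=> e e0; exists (cst 0); split.
  by split; [exact: flat_cst|exists 1].
rewrite (_ : _ \- _ = cst 0); last by apply/funext => x /=; rewrite subrr.
by rewrite (wnorm_cst w0 mw s0 0 measurableT) normr0 mul0e lee_fin ltW.
Qed.

Let approximable_sum (I : Type) (r : seq I) (F : I -> V -> R) :
  (forall i, approximable (F i)) -> approximable (fun x => \sum_(i <- r) F i x).
Proof.
move=> aF; elim: r => [|i r IH].
  by under eq_fun do rewrite big_nil; exact: approximable0.
under eq_fun do rewrite big_cons -[F i _]mul1r.
exact: approximable_lin.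
Qed.

(** Dynkin's induction inside a fixed box, which keeps all norms finite. Complements are taken
    relative to the box, and disjoint unions pass to the limit by [indic_bigcup_cvg]. *)
Let approximable_set (L : R) (A : set V) : measurable A ->
  approximable \1_(A `&` open_box (fun=> - L) (fun=> L)).
Proof.
set B := open_box _ _.
have mB : measurable B by exact: measurable_open_box.
have [l [_ Bl]] := open_box_sub_cube (fun _ : 'I_n => - L) (fun _ : 'I_n => L).
rewrite measurable_open_boxesE.
apply: (dynkin_induction (P := fun A => approximable \1_(A `&` B))
  measurable_open_boxesE open_boxes_setI).
- by rewrite setTI; exact: approximable_box.
- move=> _ [a [b ->]].
  have [c [d ->]] : open_boxes (open_box a b `&` B).
    by apply: open_boxes_setI; do 2 eexists.
  exact: approximable_box.
- move=> S mS aS.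
  rewrite (_ : \1_(~` S `&` B) = fun x => -1 * \1_(S `&` B) x + \1_B x); last first.
    apply/funext => x; rewrite !indicE !in_setI in_setC.
    by case: (x \in S); case: (x \in B); rewrite /=; ring.
  by apply: approximable_lin => //; exact: approximable_box.
- move=> F mF tF aF.
  have tFB : trivIset setT (fun i => F i `&` B) by exact: trivIset_setIr.
  have [f_cvg f_le] := indic_bigcup_cvg R tFB.
  rewrite setI_bigcupl.
  apply: (approximable_lim _ _ _ f_cvg f_le).
  + by apply: measurable_indic; apply: bigcup_measurable => i _; exact: measurableI.
  + apply: (@indic_lty _ l); first by apply: bigcup_measurable => i _; exact: measurableI.
    by apply: bigcup_sub => i _ x [_ /Bl].
  + by move=> k; exact: approximable_sum.
Qed.

Let approximable_nonneg (f : V -> R) : measurable_fun setT f -> (forall x, 0 <= f x) ->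
  (wnorm w s setT f < +oo)%E -> approximable f.
Proof.
move=> mf f0 foo.
have [s_ [s_simple s_f s_le]] := simple_approximation mf f0.
pose B k : set V := open_box (fun=> - k%:R) (fun=> k%:R).
(* Cutting to the box [B k] puts each indicator of the simple function in the form treated by
   [approximable_set]. *)
pose t_ k (x : V) := s_ k x * \1_(B k) x.
have t_le k x : 0 <= t_ k x <= f x.
  have /andP[s0' sf] := s_le k x; rewrite /t_ indicE.
  by case: (x \in B k); rewrite ?mulr1 ?s0' ?mulr0 ?lexx ?f0.
apply: (@approximable_lim _ t_) => //.
- move=> k; have [m [c [A [mA sE]]]] := s_simple k.
  rewrite /t_ sE (_ : (fun x => _) =
      fun x => \sum_(i <- index_enum 'I_m) (c i * \1_(A i `&` B k) x + cst 0 x)); last first.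
    apply/funext => x; rewrite mulr_suml; apply: eq_bigr => i _.
    by rewrite addr0 -mulrA indicI.
  by apply: approximable_sum => i; apply: approximable_lin => //; exact: approximable_set.
- move=> x; rewrite -[X in _ --> X]mulr1; apply: cvgM; first exact: s_f.
  apply: cvg_near_cst; exists (Num.truncn `|x|).+1 => // k /= xk.
  rewrite indicE mem_set// => i; rewrite -ltr_norml.
  have xi : `|x 0 i| <= `|x|.
    by have := lexx `|x|; rewrite rV_norm_le// => /asboolP; exact.
  by rewrite (le_lt_trans xi)// (lt_le_trans (truncnS_gt _))// ler_nat.
- by move=> k x; have /andP[t0 tf] := t_le k x; rewrite !ger0_norm ?subr_ge0// gerBl.
Qed.

(** Bumps approximate boxes, boxes generate the measurable sets, indicators generate the simple
    functions, and these approximate nonnegative functions; the positive and negative parts then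
    give the general case. The exponent 1 is included for the use in [du_bois_reymond]. *)
Theorem flat_test_dense f : in_Lp w s setT f -> forall e : R, 0 < e ->
  exists phi, flat_test phi /\ (wnorm w s setT (f \- phi) <= e%:E)%E.
Proof.
move=> [mf foo].
pose f1 x := Num.max (f x) 0; pose f2 x := Num.max (- f x) 0.
have mf1 : measurable_fun setT f1 by apply: measurable_maxr.
have mf2 : measurable_fun setT f2.
  by apply: measurable_maxr => //; exact: measurableT_comp.
have f1f x : 0 <= f1 x <= `|f x|.
  by rewrite /f1 le_max lexx orbT/= ge_max ler_norm normr_ge0.
have f2f x : 0 <= f2 x <= `|f x|.
  by rewrite /f2 le_max lexx orbT/= ge_max ler_normr lexx orbT normr_ge0.
have a1 : approximable f1.
  apply: approximable_nonneg => //; first by move=> x; have /andP[] := f1f x.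
  apply: le_lt_trans foo; apply: le_wnorm => // x _.
  by have /andP[? ?] := f1f x; rewrite ger0_norm.
have a2 : approximable f2.
  apply: approximable_nonneg => //; first by move=> x; have /andP[] := f2f x.
  apply: le_lt_trans foo; apply: le_wnorm => // x _.
  by have /andP[? ?] := f2f x; rewrite ger0_norm.
have -> : f = fun x => -1 * f2 x + f1 x.
  apply/funext => x; rewrite /f1 /f2 /=; have [h|h] := leP 0 (f x).
    by rewrite [X in -1 * X]max_r ?mulr0 ?add0r//; lra.
  by rewrite [X in -1 * X]max_l ?mulN1r ?opprK ?addr0//; lra.
by have [] := approximable_lin (-1) a2 a1.
Qed.

End density.

Section du_bois_reymond.
Context {R : realType} {n : nat}.
Notation V := 'rV[R]_n.
Notation mu := (lebesgue_rV n : {measure set V -> \bar R}).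

(* Approximate indicators in [L_1] with respect to the weight [1 + |k|]. *)
Lemma du_bois_reymond (k : V -> R) : measurable_fun setT k ->
  (forall l, mu.-integrable (cube 0 l) (EFin \o k)) ->
  (forall phi, flat_test phi -> \int[mu]_x (k x * phi x) = 0) ->
  {ae mu, forall x, k x = 0}.
Proof.
move=> mk kloc kphi.
(* The term [|k|] makes the weighted L_1 norm of [\1_A - phi] dominate its integral against [|k|];
   the term 1 keeps the weight positive. *)
pose w x := 1 + `|k x|.
have w0 x : 0 < w x by rewrite ltr_wpDr.
have mw : measurable_fun setT w by apply: measurable_funD => //; exact: measurableT_comp.
have wloc l : (\int[mu]_(x in cube 0 l) (w x)%:E < +oo)%E.
  (* A negative [l] is allowed here, whereas the volume formula needs a nonnegative radius. *)
  apply: (@le_lt_trans _ _ (\int[mu]_(x in cube 0 `|l|) (w x)%:E)%E).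
    apply: ge0_subset_integral; [exact: measurable_cube|exact: measurable_cube| | |].
    - by apply/measurable_EFinP; exact: measurable_funTS.
    - by move=> x _; rewrite lee_fin ltW.
    - by apply: sub_cube => i; rewrite subrr normr0 subr_ge0 ler_norm.
  have mC := measurable_cube (0 : V) `|l|.
  under eq_integral do rewrite EFinD.
  rewrite ge0_integralD//; last first.
    by apply/measurable_EFinP/measurable_funTS; exact: measurableT_comp.
  apply: lte_add_pinfty; last by have /integrableP[] := kloc `|l|.
  by rewrite integral_cst// mul1e lebesgue_cube// ltry.
have kA (l : R) (A : set V) : measurable A -> A `<=` cube 0 l ->
    \int[mu]_x (k x * \1_A x) = 0.
  move=> mA Al; have mf : measurable_fun setT (\1_A : V -> R) by exact: measurable_indic.
  have kf : mu.-integrable setT (fun x => (k x * \1_A x)%:E).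
    rewrite EFin_mul_indic -(integrable_mkcond _ mA).
    by apply: integrableS (kloc l) => //; exact: measurable_cube.
  have fin : in_Lp w 1 setT \1_A.
    split => //; apply/(wnorm_lty _ _ w0 ltr01); apply: le_lt_trans (wloc l).
    have -> : (\int[mu]_x (`|\1_A x : R| `^ 1 * w x)%:E = \int[mu]_(x in A) (w x)%:E)%E.
      rewrite [RHS]integral_mkcond; apply: eq_integral => x _.
      rewrite powRr1// patchE indicE; case: ifPn => _; first by rewrite normr1 mul1r.
      by rewrite normr0 mul0r.
    apply: ge0_subset_integral; [exact: mA|exact: measurable_cube| | |exact: Al].
    - by apply/measurable_EFinP; exact: measurable_funTS.
    - by move=> x _; rewrite lee_fin ltW.
  (* Since [k] integrates to 0 against [phi], the integral over [A] equals that of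
     [k * (\1_A - phi)], which is at most [e]. *)
  apply/eqP; rewrite -normr_le0; apply/ler_addgt0Pr => e e0; rewrite add0r.
  have [phi [tphi hphi]] := flat_test_dense (lexx 1) w0 mw wloc fin e0.
  have mphi := measurable_flat tphi.1.
  have md : measurable_fun setT (\1_A \- phi) by exact: measurable_funB.
  have kd : (\int[mu]_x `|k x * (\1_A \- phi) x|%:E <= e%:E)%E.
    apply: le_trans hphi; rewrite (wnormE _ _ w0 ltr01) invr1 poweRe1; last first.
      exact: integral_wpow_ge0.
    apply: ge0_le_integral => //.
    - by apply/measurable_EFinP/measurableT_comp => //; exact: measurable_funM.
    - exact: measurable_wpow.
    - move=> x _; rewrite lee_fin normrM mulrC powRr1// ler_wpM2l//.
      by rewrite lerDr.
  have kdi : mu.-integrable setT (fun x => (k x * (\1_A \- phi) x)%:E).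
    apply/integrableP; split; first by apply/measurable_EFinP/measurable_funM.
    exact: le_lt_trans kd (ltry _).
  have kphii : mu.-integrable setT (fun x => (k x * phi x)%:E).
    rewrite (_ : (fun x => _) =
        (fun x => (k x * \1_A x)%:E) \- (fun x => (k x * (\1_A \- phi) x)%:E))%E.
      exact: integrableB.
    by apply/funext => x /=; rewrite -EFinB; congr EFin; ring.
  have -> : \int[mu]_x (k x * \1_A x) = \int[mu]_x (k x * (\1_A \- phi) x).
    rewrite -[RHS]addr0 -(kphi _ tphi) -RintegralD//.
    by apply: eq_Rintegral => x _; rewrite /=; ring.
  apply: (le_trans (le_normr_Rintegral measurableT kdi)).
  rewrite -lee_fin /Rintegral fineK//.
  by rewrite ge0_fin_numE ?integral_ge0// (le_lt_trans kd)// ltry.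
have kl (l : nat) : {ae mu, forall x, cube 0 l%:R x -> k x = 0}.
  have mC := measurable_cube (0 : V) l%:R.
  have := @integral_ae_eq _ _ _ mu _ mC (cst 0%E) (EFin \o k) (kloc _) (measurable_cst _).
  move=> H; have {H} : ae_eq mu (cube 0 l%:R) (EFin \o k) (cst 0%E).
    apply: H => A Al mA; rewrite integral0.
    have := kA _ _ mA Al; rewrite /Rintegral => kA0.
    have -> : (\int[mu]_(x in A) (EFin \o k) x = \int[mu]_x (k x * \1_A x)%:E)%E.
      by rewrite integral_mkcond EFin_mul_indic.
    rewrite -[LHS]fineK ?kA0//.
    rewrite EFin_mul_indic -integral_mkcond.
    apply: integrable_fin_num => //.
    by apply: integrableS (kloc l%:R) => //; exact: measurable_cube.
  by apply: filterS => x /[apply] -[].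
have := ae_foralln kl; apply: filterS => x kx.
apply: (kx (Num.truncn `|x|).+1); rewrite cube0E//= ltW// truncnS_gt//.
Qed.

End du_bois_reymond.

(** * From enumerated series to unordered sums *)

Section summation.
Context {R : realType} {I : choiceType}.

(** A finite list of indices is exhausted by an initial segment of the enumeration; [M] lies beyond
    the position of each of its elements. *)
Lemma big_uniq_bij (c : I -> R) (e : nat -> I) (s : seq I) :
  uniq s -> set_bij setT setT e -> exists M, forall m, (M <= m)%N ->
    \sum_(i <- s) c i =
    \sum_(k <- iota 0 m | e k \in s) c (e k).
Proof.
move=> us [_ einj esurj].
have /boolp.choice[g eg] : forall i, exists k, e k = i.
  by move=> i; have [k _ <-] := esurj i Logic.I; exists k.
exists (\max_(i <- s) (g i).+1) => m Mm.
rewrite -(big_map e (fun i => i \in s)) -big_filter.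
apply: perm_big; apply: uniq_perm.
- exact: us.
- rewrite filter_uniq// map_inj_uniq ?iota_uniq// => j k jk.
  by apply: einj; rewrite ?inE.
- move=> i; rewrite mem_filter; case: (boolP (i \in _)) => //= iB; apply/esym/mapP.
  exists (g i); last by rewrite eg.
  rewrite mem_iota/= add0n (leq_trans _ Mm)//.
  by rewrite (big_rem i iB)/= leq_maxl.
Qed.

Lemma partial_sum_totally (c : I -> R) (e : nat -> I) (l : R) :
  set_bij setT setT e ->
  (\sum_(k <oo) `|c (e k)|%:E < +oo)%E ->
  \sum_(0 <= k < N) c (e k) @[N --> \oo] --> l ->
  summability.partial_sum c @ summability.totally --> l.
Proof.
move=> be coo cl; have FF := @summability.totally_filter I.
apply/cvgrPdist_le => d d0; have d20 : 0 < d / 2 by rewrite divr_gt0.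
have := nneseries_tail_cvg coo (fun k _ => normr_ge0 _).
move=> /fine_cvgP[tfin /cvgrPdist_lt/(_ _ d20) tl].
move: cl => /cvgrPdist_le/(_ _ d20) cl.
have [N [[tf tN] cN]] := filter_ex (filterI (filterI tfin tl) cl).
exists (fset_set [set e k | k in `I_N]) => // B /= SB.
have eB k : (k < N)%N -> e k \in finmap.enum_fset B.
  move=> kN; apply: (finmap.fsubsetP SB); rewrite in_fset_set ?inE//.
    by exists k.
  exact: finite_image.
have [M HM] := big_uniq_bij c (finmap.fset_uniq B) be.
have -> : summability.partial_sum c B = \sum_(i <- finmap.enum_fset B) c i.
  by rewrite finmap.big_seq_fsetE.
rewrite (HM (maxn M N)) ?leq_maxl//.
have NM : (N <= maxn M N)%N by exact: leq_maxr.
move: (maxn M N) NM => m Nm.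
rewrite -[m](subnKC Nm) iotaD big_cat/= add0n.
have -> : \sum_(k <- iota 0 N | e k \in finmap.enum_fset B) c (e k) =
    \sum_(0 <= k < N) c (e k).
  rewrite /index_iota subn0 big_seq_cond [RHS]big_seq; apply: eq_bigl => k.
  by rewrite mem_iota/= add0n; case: ltnP => //= kN; rewrite eB.
rewrite opprD addrA (le_trans (ler_normB _ _))// (splitr d) lerD//.
apply: (@le_trans _ _ (\sum_(N <= k < m) `|c (e k)|)).
  rewrite (le_trans (ler_norm_sum _ _ _))// /index_iota.
  rewrite big_mkcond/=; apply: ler_sum => k _; case: ifP => // _; exact: normr_ge0.
move: tN; rewrite sub0r normrN => tN; apply: le_trans (ltW tN).
apply: le_trans (ler_norm _); rewrite -lee_fin /= fineK// -sumEFin.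
exact: nneseries_lim_ge.
Qed.

End summation.

(** * Absolutely convergent sums over the cubes *)

Lemma dyadic_enumeration n : exists e : nat -> int * 'rV[int]_n, set_bij setT setT e.
Proof.
have /card_set_bijP[f [_ finj fsurj]] : ([set: int * 'rV[int]_n] #= [set: nat])%card.
  rewrite card_eq_le; apply/andP; split; first exact: countableP.
  pose f (k : nat) : int * 'rV[int]_n := (k%:Z, 0).
  rewrite -(preimage_setT f); apply: card_ge_preimage.
  by move=> j k _ _ [].
have /boolp.choice[e fe] : forall k, exists i, f i = k.
  by move=> k; have [i _ <-] := fsurj k Logic.I; exists i.
exists e; split => //.
- by move=> j k _ _ /(congr1 f); rewrite !fe.
- by move=> i _; exists (f i) => //; apply: finj; rewrite ?inE ?fe.
Qed.

Section absolutely_convergent_sums.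
Context d (T : measurableType d) (R : realType) (mu : {measure set T -> \bar R}).
Variable h : nat -> T -> R.
Hypothesis mh : forall k, measurable_fun setT (h k).

Let H x : \bar R := (\sum_(k <oo) `|h k x|%:E)%E.

Let mH : measurable_fun setT H.
Proof.
apply: ge0_emeasurable_sum => // k _.
by apply/measurable_EFinP/measurableT_comp.
Qed.

Hypothesis Hoo : {ae mu, forall x, (H x < +oo)%E}.

Let F := [set x | (H x < +oo)%E].

Let mF : measurable F.
Proof.
have := mH measurableT (emeasurable_itv (Interval -oo%O (BLeft +oo%E))).
by rewrite setTI; congr measurable.
Qed.

(** Deleting the null set where the series of absolute values diverges makes the series of the [g k]
    converge everywhere; its limit is then a measurable function defined at every point. *)
Let g k x : R := \1_F x * h k x.

Let mg k : measurable_fun setT (g k).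
Proof. by apply: measurable_funM => //; exact: measurable_indic. Qed.

Let gh k x : `|g k x| <= `|h k x|.
Proof.
by rewrite normrM ler_piMl// ger0_norm.
Qed.

Let gcvg x : cvgn (series (g^~ x)).
Proof.
have [xF|xF] := boolP (x \in F); last first.
  rewrite (_ : series _ = cst 0); first exact: is_cvg_cst.
  apply/funext => N; rewrite /series/= big1// => k _.
  by rewrite /g indicE (negbTE xF) mul0r.
apply: normed_cvg; rewrite inE/= in xF.
apply: nondecreasing_is_cvgn.
  by move=> i j ij; rewrite /series/=; apply: nondecreasing_series ij => k _ _.
exists (fine (H x)) => _ [N _ <-].
rewrite -lee_fin fineK; last first.
  rewrite ge0_fin_numE//; by apply: nneseries_ge0 => k _ _; rewrite lee_fin.
rewrite /series/= -sumEFin.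
apply: (@le_trans _ _ (\sum_(0 <= k < N) `|h k x|%:E)%E).
  by apply: lee_sum => k _; rewrite lee_fin.
by apply: nneseries_lim_ge => k _ _; rewrite lee_fin.
Qed.

Let G x : R := limn (series (g^~ x)).

Let mG : measurable_fun setT G.
Proof.
apply: (@measurable_fun_cvg _ _ _ _ (fun N x => series (g^~ x) N)).
  by move=> N; apply: measurable_sum => k; exact: mg.
by move=> x _; exact: gcvg.
Qed.

(** One [G] serves all [f]. For each [f] the series of the [|h k * f|] is an integrable majorant,
    and dominated convergence allows termwise integration. *)
Lemma sum_pairing : exists G : T -> R, measurable_fun setT G /\
  forall f : T -> R, measurable_fun setT f -> forall C : R,
  (\sum_(k <oo) \int[mu]_x `|h k x * f x|%:E <= C%:E)%E ->
  [/\ mu.-integrable setT (fun x => (G x * f x)%:E),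
      (\int[mu]_x `|G x * f x|%:E <= C%:E)%E &
      (\sum_(0 <= k < N) \int[mu]_x (h k x * f x))%R @[N --> \oo] -->
        (\int[mu]_x (G x * f x))%R].
Proof.
exists G; split; first exact: mG.
move=> f mf C hC.
have mhf k : measurable_fun setT (fun x => (h k x * f x)%:E).
  by apply/measurable_EFinP/measurable_funM.
have mnhf k : measurable_fun setT (fun x => `|h k x * f x|%:E).
  apply/measurable_EFinP; apply: measurableT_comp => //; exact: measurable_funM.
have mgf k : measurable_fun setT (fun x => (g k x * f x)%:E).
  by apply/measurable_EFinP/measurable_funM.
pose D x : \bar R := (\sum_(k <oo) `|h k x * f x|%:E)%E.
have D0 x : (0 <= D x)%E by apply: nneseries_ge0 => k _ _; rewrite lee_fin.
have mD : measurable_fun setT D by apply: ge0_emeasurable_sum.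
have iD : (\int[mu]_x D x <= C%:E)%E.
  rewrite /D integral_nneseries//; by move=> k x _; rewrite lee_fin.
have intD : mu.-integrable setT D.
  apply/integrableP; split => //; apply: le_lt_trans (ltry C).
  by under eq_integral do rewrite gee0_abs//.
have hD k x : (`|h k x * f x|%:E <= D x)%E.
  apply: (@le_trans _ _ (\sum_(0 <= j < k.+1) `|h j x * f x|%:E)%E).
    by rewrite big_nat_recr//= leeDr// sume_ge0// => j _; rewrite lee_fin.
  by apply: nneseries_lim_ge => j _ _; rewrite lee_fin.
have sD N x : (`|(series (g^~ x) N * f x)%R%:E| <= D x)%E.
  apply: (@le_trans _ _ (\sum_(0 <= j < N) `|h j x * f x|%:E)%E).
    rewrite /= sumEFin lee_fin /series/= mulr_suml.
    apply: (le_trans (ler_norm_sum _ _ _)); apply: ler_sum => j _.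
    by rewrite [leLHS]normrM [leRHS]normrM ler_wpM2r.
  by apply: nneseries_lim_ge => j _ _; rewrite lee_fin.
have ihf k : mu.-integrable setT (fun x => (h k x * f x)%:E).
  by apply: le_integrable intD => // x _; rewrite [leRHS]gee0_abs//; exact: hD.
have igf k : mu.-integrable setT (fun x => (g k x * f x)%:E).
  apply: le_integrable (ihf k) => // x _; by rewrite lee_fin [leLHS]normrM [leRHS]normrM ler_wpM2r.
have ms N : measurable_fun setT (fun x => (series (g^~ x) N * f x)%:E).
  by apply/measurable_EFinP/measurable_funM => //; apply: measurable_sum => k; exact: mg.
have mGf : measurable_fun setT (fun x => (G x * f x)%:E).
  by apply/measurable_EFinP/measurable_funM.
have cGf x : (series (g^~ x) N * f x)%:E @[N --> \oo] --> (G x * f x)%:E.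
  by apply: cvg_EFin; [exact: nearW|apply: cvgMl; exact: gcvg].
have [i1 _ i3] := @dominated_convergence _ _ _ mu setT measurableT
  (fun N x => (series (g^~ x) N * f x)%:E) (fun x => (G x * f x)%:E) D
  ms mGf (aeW _ (fun x _ => cGf x)) intD (aeW _ (fun x N _ => sD N x)).
split => //.
  apply: le_trans iD; apply: ge0_le_integral => //.
    by apply/measurable_EFinP/measurableT_comp => //; exact: measurable_funM.
  move=> x _.
  have cab : `|(series (g^~ x) N * f x)%:E|%E @[N --> \oo] --> `|(G x * f x)%:E|%E.
    by apply: cvg_abse; exact: cGf.
  rewrite -[leLHS](cvg_lim (@ereal_hausdorff R) cab).
  apply: lime_le; first by apply/cvg_ex; eexists; exact: cab.
  by apply: nearW => N; exact: sD.
(* [h k] and [g k] differ only off [F], which is a null set. *)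
have gE k : \int[mu]_x (h k x * f x) = \int[mu]_x (g k x * f x).
  rewrite /Rintegral; congr fine; apply: ae_eq_integral => //.
  apply: filterS Hoo => x xF _; rewrite /g indicE mem_set//.
  by rewrite mul1r.
under eq_fun do under eq_bigr do rewrite gE.
have fG := integrable_fin_num measurableT i1.
rewrite -(fineK fG) in i3; move/fine_cvgP: i3 => [_].
apply: cvg_trans; apply: near_eq_cvg; apply: nearW => N /=.
rewrite (_ : (fun x => _) = fun x => (\sum_(0 <= k < N) (g k x * f x)%:E)%E); last first.
  by apply/funext => x; rewrite sumEFin /series/= mulr_suml.
rewrite integral_sum//.
have -> : \sum_(0 <= k < N) \int[mu]_x (g k x * f x) =
    fine (\sum_(0 <= k < N) (\int[mu]_x (g k x * f x))%:E)%E by rewrite sumEFin.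
congr fine; apply: eq_bigr => k _; rewrite fineK//; exact: integrable_fin_num.
Qed.

End absolutely_convergent_sums.

(** * Local integrability and decay in weighted Lebesgue spaces *)

Section weighted_Lp.
Context {R : realType} {n : nat}.
Notation V := 'rV[R]_n.
Notation mu := (lebesgue_rV n : {measure set V -> \bar R}).
Variables (w : V -> R) (p : R).
Hypothesis n0 : (0 < n)%N.
Hypothesis p1 : 1 < p.
Hypothesis w0 : forall x, 0 < w x.
Hypothesis Apw : Ap p w.

Let mw : measurable_fun setT w := measurable_weight Apw.
Let p0 : 0 < p. Proof. exact: lt_trans p1. Qed.

Lemma in_Lp_cube (s l : R) : 0 < s -> in_Lp w s setT \1_(cube 0 l).
Proof.
move=> s0; have mC := measurable_cube (0 : V) l; split; first exact: measurable_indic.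
apply/(wnorm_lty _ _ w0 s0).
have [_] := integrableP _ _ _ (weight_integrable_cube Apw 0 l).
apply: le_lt_trans; rewrite [leRHS]integral_mkcond.
have mW : measurable_fun (cube 0 l) (fun x : V => `|(EFin \o w) x|%E).
  by apply: measurableT_comp => //; apply/measurable_EFinP/measurable_funTS.
apply: ge0_le_integral => //.
- by move=> x _; exact: wpow_ge0.
- exact: measurable_wpow.
- exact: (measurable_restrictT _ mC).1 mW.
- move=> x _; rewrite patchE indicE; case: ifP => _ /=.
    by rewrite normr1 powR1 mul1r lee_fin ler_norm.
  by rewrite normr0 powR0 ?mul0r// lt0r_neq0.
Qed.

Lemma in_Lp_bounded_support (s l k : R) (f : V -> R) : 0 < s -> measurable_fun setT f ->
  (forall x, `|f x| <= k) -> (forall x, ~ cube 0 l x -> f x = 0) -> in_Lp w s setT f.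
Proof.
move=> s0 mf fk fl; split => //.
have mC := measurable_cube (0 : V) l.
have [mI Ioo] := in_Lp_cube l s0.
have mkI : measurable_fun setT (fun x : V => `|k| * \1_(cube 0 l) x).
  by apply: measurable_funM.
apply: (@le_lt_trans _ _ (wnorm w s setT (fun x => `|k| * \1_(cube 0 l) x))).
  apply: (le_wnorm w0 s0 mw measurableT mf mkI) => x _.
  have [xl|xl] := boolP (x \in (cube 0 l : set V)).
    rewrite indicE xl mulr1 normr_id (le_trans (fk x))// ler_norm//.
  by rewrite fl ?normr0//; move: xl; rewrite notin_setE.
rewrite (wnormZ _ w0 s0 mw measurableT mI) lte_mul_pinfty ?lee_fin//.
Qed.

(** Rests on the pointwise inequality [|f| <= |f|^u w + w + w^(1-p')], whose last two terms are
    integrable on cubes by A_p. Indeed [|f| <= |f|^p w] if [|f|^(p-1) w >= 1] and [|f| <= w^(1-p')]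
    otherwise, while [|f|^p <= |f|^u + 1]. *)
Lemma in_Lp_integrable_cube (u l : R) (f : V -> R) : p < u -> 0 < l ->
  in_Lp w u setT f -> mu.-integrable (cube 0 l) (EFin \o f).
Proof.
move=> pu l0 [mf fu]; have u0 : 0 < u by exact: lt_trans pu.
have mC := measurable_cube (0 : V) l.
have [A [_ /(_ 0 l l0)[isig _]]] := Ap_bound p1 w0 Apw.
have iw := weight_integrable_cube Apw 0 l.
have iu : mu.-integrable (cube 0 l) (fun x => (`|f x| `^ u * w x)%:E).
  apply: (@integrableS _ _ _ mu setT) => //.
  apply/integrableP; split; first exact: measurable_wpow.
  move/(wnorm_lty _ _ w0 u0): fu; apply: le_lt_trans.
  apply: ge0_le_integral => //; [by apply: measurableT_comp => //; exact: measurable_wpow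
    |exact: measurable_wpow|].
  by move=> x _; rewrite gee0_abs// wpow_ge0.
have i2 := integrableD mC iu (integrableD mC iw isig).
apply: (le_integrable mC _ _ i2).
  by apply/measurable_EFinP; exact: measurable_funTS.
move=> x _; rewrite /= lee_fin.
have s0 : 0 <= w x `^ (1 - conj_exp p) by exact: powR_ge0.
have f0 : 0 <= `|f x| `^ u * w x by rewrite mulr_ge0 ?powR_ge0// ltW.
have wx := w0 x.
rewrite [leRHS]ger0_norm; last by rewrite !addr_ge0// ltW.
have [fx0|fx0] := eqVneq (f x) 0.
  by rewrite {1}fx0 normr0 !addr_ge0// ltW.
have nf : 0 < `|f x| by rewrite normr_gt0.
have fp : `|f x| `^ p * w x <= `|f x| `^ u * w x + w x.
  have [f1|f1] := lerP 1 `|f x|.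
    have : `|f x| `^ p <= `|f x| `^ u by rewrite ler_powR// ltW.
    by move=> h; rewrite (le_trans (ler_wpM2r (ltW wx) h))// lerDl ltW.
  have : `|f x| `^ p <= 1.
    have -> : 1 = 1 `^ p :> R by rewrite powR1.
    by rewrite ge0_ler_powR ?nnegrE ?ler01 ?ltW.
  by move=> h; rewrite (le_trans (ler_wpM2r (ltW wx) h))// mul1r lerDr.
apply: (@le_trans _ _ (`|f x| `^ p * w x + w x `^ (1 - conj_exp p))); last first.
  by rewrite addrA lerD2r.
have p10 : p - 1 != 0 by rewrite subr_eq0 gt_eqF.
have [h|h] := lerP 1 (`|f x| `^ (p - 1) * w x).
  apply: (@le_trans _ _ (`|f x| `^ p * w x)); last by rewrite lerDl.
  have -> : `|f x| `^ p = `|f x| `^ (p - 1) * `|f x|.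
    rewrite -[X in _ = _ * X](powRr1 (normr_ge0 (f x))) -powRD ?subrK//.
    by rewrite (gt_eqF nf) implybT.
  by rewrite mulrAC -[leLHS]mul1r ler_wpM2r.
apply: (@le_trans _ _ (w x `^ (1 - conj_exp p))); last first.
  by rewrite lerDr mulr_ge0 ?powR_ge0// ltW.
have -> : 1 - conj_exp p = (- (p - 1)^-1) by rewrite /conj_exp; field.
have h2 : `|f x| `^ (p - 1) <= (w x)^-1 by rewrite -[leRHS]mul1r ler_pdivlMr// ltW.
have -> : `|f x| = (`|f x| `^ (p - 1)) `^ (p - 1)^-1.
  by rewrite -powRrM mulfV// powRr1.
have -> : w x `^ (- (p - 1)^-1) = (w x)^-1 `^ (p - 1)^-1.
  by rewrite -(powR_inv1 (ltW wx)) -(powRrM (w x)) mulN1r.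
apply: ge0_ler_powR => //.
- by rewrite invr_ge0 subr_ge0 ltW.
- by rewrite nnegrE powR_ge0.
- by rewrite nnegrE invr_ge0 ltW.
Qed.

(** [K] is the norm of [g = (1 + |x|)^-N], finite because [g^u <= g] and [g] is integrable against
    the weight by [weight_moment]. [N] and [K] do not depend on [f]. *)
Lemma decay_in_Lp (u : R) : 1 <= u -> exists (N : nat) (K : R), forall (f : V -> R) (S : R),
  measurable_fun setT f -> (forall x, (1 + `|x|) ^+ N * `|f x| <= S) ->
  (wnorm w u setT f <= (S * K)%:E)%E.
Proof.
move=> u1; have u0 : 0 < u by exact: lt_le_trans u1.
have [N Noo] := weight_moment n0 p1 w0 Apw; exists N.
pose g (x : V) : R := ((1 + `|x|) ^+ N)^-1.
have mg : measurable_fun setT g.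
  have mnx : measurable_fun setT (fun x : V => (1 + `|x|) ^+ N).
    apply: measurable_funX; apply: measurable_funD => //.
    by apply: continuous_measurable_rV; exact: norm_continuous.
  apply: measurable_funTS; rewrite (_ : g = fun x => ((1 + `|x|) ^+ N) `^ (-1)).
    exact: measurableT_comp (measurable_powR _) mnx.
  by apply/funext => x; rewrite powR_inv1// exprn_ge0// addr_ge0.
have d1 x : 1 <= (1 + `|x : V|) ^+ N by rewrite exprn_ege1// lerDl.
have g0 x : 0 <= g x by rewrite invr_ge0 (le_trans ler01).
have g1 x : g x <= 1 by rewrite invf_le1// (lt_le_trans ltr01).
have goo : (wnorm w u setT g < +oo)%E.
  apply/(wnorm_lty _ _ w0 u0); apply: le_lt_trans Noo; apply: ge0_le_integral => //.
  - by move=> x _; exact: wpow_ge0.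
  - exact: measurable_wpow.
  - by apply/measurable_EFinP; exact: measurable_funM.
  - move=> x _; rewrite lee_fin ler_wpM2r ?(ltW (w0 x))// ger0_norm//.
    have [->|gx] := eqVneq (g x) 0; first by rewrite powR0// lt0r_neq0.
    have gx0 : 0 < g x by rewrite lt0r gx g0.
    by rewrite ge1r_powR// gx0 g1.
exists (fine (wnorm w u setT g)) => f S mf fS.
have S0 : 0 <= S by apply: le_trans (fS 0); rewrite mulr_ge0// (le_trans ler01).
rewrite EFinM fineK; last by rewrite ge0_fin_numE ?wnorm_ge0.
have mSg : measurable_fun setT (fun x => S * g x) by exact: measurable_funM.
have := wnormZ S w0 u0 mw measurableT mg; rewrite ger0_norm// => <-.
apply: (le_wnorm w0 u0 mw measurableT mf mSg) => x _.
rewrite [leRHS]ger0_norm ?mulr_ge0// ler_pdivlMr ?(lt_le_trans ltr01)//.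
by rewrite mulrC.
Qed.

End weighted_Lp.

(** * Synthesis of a function from a summable family *)

Section synthesis.
Context {R : realType} {n : nat}.
Notation V := 'rV[R]_n.
Notation mu := (lebesgue_rV n : {measure set V -> \bar R}).
Notation I := (int * 'rV[int]_n)%type.
Notation Q := (@dyadic_cube R n).
Variables (w : V -> R) (p r rho : R).
Hypothesis n0 : (0 < n)%N.
Hypothesis p1 : 1 < p.
Hypothesis rp : - (n%:R / p) < r.
Hypothesis r0 : r < 0.
Hypothesis rrho : r + rho = - n%:R.
Hypothesis w0 : forall x, 0 < w x.
Hypothesis Apw : Ap p w.

Let q := conj_exp p.
Let u := - (n%:R / r).
Local Notation b := (cube_factor p r w).
Local Notation a := (cube_factor q rho w).
Let mw : measurable_fun setT w := measurable_weight Apw.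
Let p0 : 0 < p. Proof. exact: lt_trans p1. Qed.
Let pu : p < u. Proof. exact: morrey_exp_gt p1 rp r0. Qed.
Let u0 : 0 < u. Proof. exact: lt_trans pu. Qed.

(** On each cube Hoelder's inequality bounds the pairing by the local norm of [h JM] times that of
    [f], and the factors [a] and [b] cancel. Summation gives the majorant for [sum_pairing],
    uniformly in all [f] with Morrey norm at most [m]. *)
Lemma synthesis (h : I -> V -> R) (C : R) :
  (forall JM, measurable_fun setT (h JM)) ->
  (forall JM, {ae mu, forall x, ~ Q JM x -> h JM x = 0}) ->
  (\esum_(JM in [set: I]) ((a JM)%:E * hnorm w p (h JM)) <= C%:E)%E ->
  exists G : V -> R, measurable_fun setT G /\
  forall f, measurable_fun setT f -> forall m : R,
  (forall JM, (b JM)%:E * wnorm w p (Q JM) f <= m%:E)%E ->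
  [/\ mu.-integrable setT (fun x => (G x * f x)%:E),
      (\int[mu]_x `|G x * f x|%:E <= (C * m)%:E)%E &
      summability.partial_sum (fun JM => \int[mu]_x (h JM x * f x))
        @ summability.totally --> \int[mu]_x (G x * f x)].
Proof.
move=> mh hQ hC; have [e be] := dyadic_enumeration n.
pose t JM := ((a JM)%:E * hnorm w p (h JM))%E.
have t0 JM : (0 <= t JM)%E.
  by rewrite mule_ge0 ?Lnorm_ge0// lee_fin powR_ge0.
have tC : (\sum_(k <oo) t (e k) <= C%:E)%E.
  rewrite nneseries_esumT; last by move=> k; exact: t0.
  by rewrite -(reindex_esum _ _ _ _ be).
have bound f m : measurable_fun setT f ->
    (forall JM, (b JM)%:E * wnorm w p (Q JM) f <= m%:E)%E ->
    (\sum_(k <oo) \int[mu]_x `|h (e k) x * f x|%:E <= (C * m)%:E)%E.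
  move=> mf fm.
  have m0 : 0 <= m.
    rewrite -lee_fin; apply: le_trans (fm (e 0%N)).
    by rewrite mule_ge0 ?wnorm_ge0// lee_fin powR_ge0.
  apply: (@le_trans _ _ (\sum_(k <oo) (m%:E * t (e k)))%E).
    apply: lee_nneseries => [k _ _|k _]; first exact: integral_ge0.
    apply: (le_trans (hnorm_pairing_dyadic n0 p1 rrho w0 Apw (mh _) mf (hQ _))).
    rewrite muleC; apply: lee_wpmul2r; [exact: t0|exact: fm].
  rewrite nneseriesZl; last by move=> k _; exact: t0.
  rewrite mulrC EFinM; apply: lee_wpmul2l => //; by rewrite lee_fin.
(* Indicators of cubes lie in L_u,w and so have finite Morrey norm. Pairing with them makes the
   series of absolute values integrable on each cube, hence finite almost everywhere. *)
have Hoo : {ae mu, forall x, (\sum_(k <oo) `|h (e k) x|%:E < +oo)%E}.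
  have Hl (l : nat) : {ae mu, forall x, cube 0 l%:R x ->
      (\sum_(k <oo) `|h (e k) x|%:E < +oo)%E}.
    pose f : V -> R := \1_(cube 0 l%:R).
    have mf : measurable_fun setT f by apply: measurable_indic; exact: measurable_cube.
    have [_ foo] : in_Lp w u setT f := in_Lp_cube w0 Apw l%:R u0.
    have fm JM : ((b JM)%:E * wnorm w p (Q JM) f <= (fine (wnorm w u setT f))%:E)%E.
      rewrite fineK; last by rewrite ge0_fin_numE ?wnorm_ge0.
      by have := morrey_le_wnormT p1 rp r0 w0 Apw JM mf; apply.
    have mhf k : measurable_fun setT (fun x => `|h (e k) x * f x|%:E).
      by apply/measurable_EFinP/measurableT_comp => //; exact: measurable_funM.
    have := bound _ _ mf fm; rewrite -integral_nneseries//.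
    move=> /le_lt_trans/(_ (ltry _)) ioo.
    have : mu.-integrable setT (fun x => \sum_(k <oo) `|h (e k) x * f x|%:E)%E.
      apply/integrableP; split; first by apply: ge0_emeasurable_sum => // k _.
      apply: le_lt_trans ioo; apply: ge0_le_integral => //.
      - by apply: measurableT_comp => //; apply: ge0_emeasurable_sum.
      - by apply: ge0_emeasurable_sum.
      - by move=> x _; rewrite gee0_abs//; apply: nneseries_ge0 => k _ _; rewrite lee_fin.
    move=> /(integrable_ae measurableT); apply: filterS => x /(_ Logic.I) fx xl.
    rewrite -ge0_fin_numE; last by apply: nneseries_ge0 => k _ _; rewrite lee_fin.
    move: fx; congr (_ \is a fin_num); apply: eq_eseriesr => k _.
    by rewrite /f indicE mem_set// mulr1.
  have := ae_foralln Hl; apply: filterS => x Hx.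
  apply: (Hx (Num.truncn `|x|).+1); rewrite cube0E//= ltW// truncnS_gt//.
have [G [mG GP]] := sum_pairing (fun k => mh (e k)) Hoo.
exists G; split; first exact: mG.
move=> f mf m fm; have hb := bound _ _ mf fm.
have [G1 G2 G3] := GP f mf _ hb; split => //.
apply: (partial_sum_totally be _ G3).
apply: le_lt_trans (ltry (C * m)); apply: le_trans hb.
apply: lee_nneseries => [k _ _|k _]; first by rewrite lee_fin.
have mhf : measurable_fun setT (fun x => `|h (e k) x * f x|%:E).
  by apply/measurable_EFinP/measurableT_comp => //; exact: measurable_funM.
have [|] := ltP (\int[mu]_x `|h (e k) x * f x|%:E)%E +oo%E; last first.
  by rewrite leye_eq => /eqP ->; rewrite leey.
move=> hoo; have ih : mu.-integrable setT (fun x => (h (e k) x * f x)%:E).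
  by apply/integrableP; split; [apply/measurable_EFinP/measurable_funM|].
have := le_normr_Rintegral measurableT ih; rewrite -lee_fin /Rintegral => H.
apply: (le_trans H); rewrite fineK// ge0_fin_numE//; exact: integral_ge0.
Qed.

End synthesis.

(** * Complex-valued functions *)

Section complex_numbers.
Context {R : realType}.
Implicit Types z : R[i].

Lemma normc_ge0 z : 0 <= normc z.
Proof. by case: z => a b; exact: sqrtr_ge0. Qed.

Lemma ler_Re_normc z : `|complex.Re z| <= normc z.
Proof.
case: z => a b /=; rewrite -[leLHS]sqrtr_sqr ler_sqrt ?addr_ge0 ?sqr_ge0//.
by rewrite lerDl sqr_ge0.
Qed.

Lemma ler_Im_normc z : `|complex.Im z| <= normc z.
Proof.
case: z => a b /=; rewrite -[leLHS]sqrtr_sqr ler_sqrt ?addr_ge0 ?sqr_ge0//.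
by rewrite lerDr sqr_ge0.
Qed.

Lemma normc_real (a : R) : normc a%:C%C = `|a|.
Proof. by rewrite /normc /= expr0n /= addr0 sqrtr_sqr. Qed.

Lemma ler_normc_ReIm z : normc z <= `|complex.Re z| + `|complex.Im z|.
Proof.
case: z => a b /=; rewrite -[leRHS]ger0_norm ?addr_ge0// -sqrtr_sqr.
rewrite ler_sqrt ?sqr_ge0// sqrrD !real_normK ?num_real//.
by rewrite addrAC lerDl mulrn_wge0// mulr_ge0.
Qed.

Lemma cvg_complex T (F : set_system T) (FF : Filter F) (f : T -> R[i]) (l : R[i]) :
  (fun x => complex.Re (f x)) @ F --> complex.Re l -> (fun x => complex.Im (f x)) @ F --> complex.Im l ->
  (fun x => f x : R[i]^o) @ F --> (l : R[i]^o).
Proof.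
move=> /cvgrPdist_le fr /cvgrPdist_le fi; apply/cvgrPdist_le => e e0.
(* The norm of [R[i]^o] has values in [R[i]]; a positive element of [R[i]] is real. *)
have [d de] : exists d : R, e = d%:C%C.
  by move: e0; case: e => a b; rewrite ltcE /= => /andP[/eqP -> _]; exists a.
have d20 : 0 < d / 2 by move: e0; rewrite de ltcR => d0; rewrite divr_gt0.
move: (fr _ d20) (fi _ d20); apply: filterS2 => x hr hi.
rewrite de -[`|_|]/((normc (l - f x))%:C%C) lecR (le_trans (ler_normc_ReIm _))//.
rewrite (splitr d) lerD//.
  by move: hr => /=; case: (l); case: (f x).
by move: hi => /=; case: (l); case: (f x).
Qed.

End complex_numbers.

Section flat_schwartz.
Context {R : realType} {n : nat}.
Notation V := 'rV[R]_n.
Implicit Types f : V -> R.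

Lemma flat_test_partial f i : flat_test f -> flat_test (partial i f).
Proof.
move=> [ff [l [l0 fl]]]; split; first exact: flat_algebra_partial.
exists l; split => // x xl; rewrite /partial.
have oC : open (~` (cube 0 l : set V)).
  by apply: closed_openC; apply: compact_closed; [exact: norm_hausdorff|exact: cube_compact].
rewrite (@near_eq_derive _ _ _ f (cst 0)).
- exact: derive_cst.
- have : nbhs x (~` (cube 0 l : set V)) by exact: open_nbhs_nbhs.
  by apply: filterS => y; exact: fl.
Qed.

Lemma bounded_of_support f (l : R) : continuous f ->
  (forall x, ~ cube 0 l x -> f x = 0) -> exists k, forall x, `|f x| <= k.
Proof.
move=> cf fl; have /compact_bounded[M [_ /(_ (M + 1))]] :
    compact (f @` (cube 0 l : set V)).
  apply: continuous_compact; last exact: cube_compact.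
  exact: continuous_subspaceT.
rewrite ltrDl ltr01 => /(_ isT) fM.
exists (Num.max 0 (M + 1)) => x; rewrite le_max.
have [xl|xl] := pselect (cube 0 l x); first by rewrite (fM (f x)) ?orbT//; exists x.
by rewrite fl// normr0 lexx.
Qed.

(** Partial derivatives of flat test functions are again flat test functions, and each of these is
    bounded with bounded support. *)
Lemma flat_test_decay (N : nat) f : flat_test f -> exists k, forall s x, (size s <= N)%N ->
  (1 + `|x|) ^+ N * `|partials s f x| <= k.
Proof.
have H0 g : flat_test g -> exists k, forall x : V, (1 + `|x|) ^+ N * `|g x| <= k.
  move=> [/flat_algebra_continuous cg [l [l0 gl]]]; have [k gk] := bounded_of_support cg gl.
  exists ((1 + l) ^+ N * k) => x.
  have [xl|xl] := pselect (cube 0 l x); last first.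
    by rewrite gl// normr0 mulr0 mulr_ge0 ?(le_trans _ (gk 0))// exprn_ge0// addr_ge0// ltW.
  apply: ler_pM => //.
  by move: xl; rewrite (cube0E (ltW l0))/= => xl; rewrite lerXn2r ?nnegrE ?addr_ge0 ?(ltW l0)// lerD2l.
(* The order of differentiation is separated from the exponent of the weight, which stays fixed
   during the induction. *)
suff H : forall m (g : V -> R), flat_test g -> exists k, forall s x, (size s <= m)%N ->
  (1 + `|x|) ^+ N * `|partials s g x| <= k by exact: H.
elim=> [|m IH] {}f tf; have [k0 fk0] := H0 f tf.
  by exists k0 => s x; rewrite leqn0 => /nilP ->; exact: fk0.
have /boolp.choice[k kP] := fun i => IH _ (flat_test_partial i tf).
have kp i : 0 <= k i.
  by apply: le_trans (kP i [::] 0 _) => //; rewrite mulr_ge0// exprn_ge0// addr_ge0.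
have k00 : 0 <= k0.
  by apply: le_trans (fk0 0); rewrite mulr_ge0// exprn_ge0// addr_ge0.
exists (k0 + \sum_i k i) => s x; have [->|sn] := eqVneq s [::].
  by move=> _; rewrite (le_trans (fk0 x))// lerDl sumr_ge0.
(* [partials] folds from the right, so the last index of the list is the first one to be
   differentiated. *)
case/lastP: s sn => // s i _; rewrite size_rcons ltnS => sm.
rewrite /partials foldr_rcons (le_trans (kP i s x sm))//.
by rewrite (bigD1 i)//= addrCA lerDl addr_ge0// sumr_ge0.
Qed.

Lemma csmooth_flat (f1 f2 : V -> R) : flat_test f1 -> flat_test f2 ->
  csmooth (fun x => (f1 x +i* f2 x)%C).
Proof. by move=> [t1 _] [t2 _]; split; exact: flat_algebra_smooth. Qed.

Lemma flat_test_function (f1 f2 : V -> R) : flat_test f1 -> flat_test f2 ->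
  test_function (fun x => (f1 x +i* f2 x)%C).
Proof.
move=> t1 t2; split; first exact: csmooth_flat.
have [_ [l1 [l10 fl1]]] := t1; have [_ [l2 [l20 fl2]]] := t2.
exists (cube 0 (Num.max l1 l2)); split; first exact: cube_compact.
move=> x nx; rewrite fl1 ?fl2//; apply: contra_not nx; apply: sub_cube => i;
  by rewrite subrr normr0 subr_ge0 le_max lexx ?orbT.
Qed.

Lemma flat_schwartz (f1 f2 : V -> R) : flat_test f1 -> flat_test f2 ->
  schwartz (fun x => (f1 x +i* f2 x)%C).
Proof.
move=> t1 t2; split=> [|N]; first exact: csmooth_flat.
have [k1 kP1] := flat_test_decay N t1; have [k2 kP2] := flat_test_decay N t2.
apply: (@le_lt_trans _ _ (k1 + k2)%:E); last exact: ltry.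
apply: ge_ereal_sup => _ [s sN [x _ <-]]; rewrite lee_fin.
have x0 : 0 <= (1 + `|x|) ^+ N by rewrite exprn_ge0// addr_ge0.
rewrite (le_trans (ler_wpM2l x0 (ler_normc_ReIm _)))//= mulrDr.
by rewrite lerD//; [exact: kP1|exact: kP2].
Qed.

End flat_schwartz.

(** * Morrey spaces of complex-valued functions for the original weight *)

Section complex_valued.
Context {R : realType} {n : nat}.
Notation V := 'rV[R]_n.
Notation mu := (lebesgue_rV n : {measure set V -> \bar R}).
Notation I := (int * 'rV[int]_n)%type.
Notation Q := (@dyadic_cube R n).
Implicit Types f g : V -> R[i].

Definition cnorm f : V -> R := fun x => normc (f x).

Lemma measurable_cnorm f : cmeasurable f -> measurable_fun setT (cnorm f).
Proof.
move=> [mr mi]; rewrite (_ : cnorm f = fun x => Num.sqrt (re f x ^+ 2 + im f x ^+ 2)).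
  apply: (measurableT_comp (@continuous_measurable_fun R (@Num.sqrt R) _)).
    by move=> x; exact: sqrt_continuous.
  by apply: measurable_funD; exact: measurable_funX.
by apply/funext => x; rewrite /cnorm /re /im; case: (f x).
Qed.

Lemma cmeasurable_lin (a : R[i]) f g : cmeasurable f -> cmeasurable g ->
  cmeasurable (fun x => a * f x + g x).
Proof.
move=> [rf jf] [rg jg]; case: a => a b; split.
  rewrite (_ : re _ = fun x => (a * re f x - b * im f x) + re g x); last first.
    by apply/funext => x; rewrite /re /im; case: (f x) => ? ?; case: (g x).
  by apply: measurable_funD => //; apply: measurable_funB; exact: measurable_funM.
rewrite (_ : im _ = fun x => (a * im f x + b * re f x) + im g x); last first.
  by apply/funext => x; rewrite /re /im; case: (f x) => ? ?; case: (g x).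
by apply: measurable_funD => //; apply: measurable_funD; exact: measurable_funM.
Qed.

Lemma cmeasurableM f g : cmeasurable f -> cmeasurable g ->
  cmeasurable (fun x => f x * g x).
Proof.
move=> [rf jf] [rg jg]; split.
  rewrite (_ : re _ = fun x => re f x * re g x - im f x * im g x); last first.
    by apply/funext => x; rewrite /re /im; case: (f x) => ? ?; case: (g x).
  by apply: measurable_funB; exact: measurable_funM.
rewrite (_ : im _ = fun x => re f x * im g x + im f x * re g x); last first.
  by apply/funext => x; rewrite /re /im; case: (f x) => ? ?; case: (g x).
by apply: measurable_funD; exact: measurable_funM.
Qed.

Lemma csmooth_measurable f : csmooth f -> cmeasurable f.
Proof.
by move=> [/(_ [::])[cr _] /(_ [::])[ci _]]; split; exact: continuous_measurable_rV.
Qed.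

Variables (w v : V -> R) (p r rho : R).
Hypothesis n0 : (0 < n)%N.
Hypothesis p1 : 1 < p.
Hypothesis rp : - (n%:R / p) < r.
Hypothesis r0 : r < 0.
Hypothesis rrho : r + rho = - n%:R.
Hypothesis v0 : forall x, 0 < v x.
Hypothesis Apv : Ap p v.
Hypothesis mw : measurable_fun setT w.
Hypothesis wv : {ae mu, forall x, w x = v x}.

Let q := conj_exp p.
Let u := - (n%:R / r).
Local Notation b := (cube_factor p r v).
Local Notation a := (cube_factor q rho v).
Local Notation N := (morrey_norm r p w).
Local Notation X := (morrey_closure r p w).
Let mv : measurable_fun setT v := measurable_weight Apv.
Let p0 : 0 < p. Proof. exact: lt_trans p1. Qed.
Let pu : p < u. Proof. exact: morrey_exp_gt p1 rp r0. Qed.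
Let u0 : 0 < u. Proof. exact: lt_trans pu. Qed.
Let u1 : 1 <= u. Proof. by rewrite ltW// (lt_trans p1). Qed.

(** First of the lemmas that replace the given weight [w] by its everywhere positive representative
    [v]; below, spaces and norms refer to [w] and estimates to [v]. *)
Lemma cube_factor_ae (s t : R) : cube_factor s t w = cube_factor s t v.
Proof.
apply/funext => JM; rewrite /cube_factor; congr (_ `^ _).
rewrite /weight_measure /Rintegral; congr fine.
apply: ae_eq_integral; [exact: measurable_dyadic_cube| | |].
- by apply/measurable_EFinP; exact: measurable_funTS.
- by apply/measurable_EFinP; exact: measurable_funTS.
- by apply: filterS wv => x /= -> _.
Qed.

Lemma Lpw_norm_ae (s : R) (M : set V) f : 0 < s -> measurable M -> cmeasurable f ->
  Lpw_norm s w M f = wnorm v s M (cnorm f).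
Proof.
move=> s0 mM mf; rewrite -(Lpw_normE _ _ v0 s0) /Lpw_norm.
apply: (congr1 (fun t => t `^ s^-1)%E).
have mnf : measurable_fun M (fun x => normc (f x) `^ s).
  apply: measurable_funTS; apply: (measurableT_comp (measurable_powR _)).
  exact: measurable_cnorm.
apply: ae_eq_integral => //.
- by apply/measurable_EFinP; apply: measurable_funM => //; exact: measurable_funTS.
- by apply/measurable_EFinP; apply: measurable_funM => //; exact: measurable_funTS.
- by apply: filterS wv => x /= -> _.
Qed.

(** Comparison with a real bound replaces the supremum by one inequality per cube, the form in which
    the real-valued results are stated. *)
Lemma morrey_normP f (m : R) : cmeasurable f ->
  (N f <= m%:E)%E <-> forall JM, ((b JM)%:E * wnorm v p (Q JM) (cnorm f) <= m%:E)%E.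
Proof.
move=> mf; have E JM : ((cube_factor p r w JM)%:E * Lpw_norm p w (Q JM) f =
    (b JM)%:E * wnorm v p (Q JM) (cnorm f))%E.
  rewrite cube_factor_ae (Lpw_norm_ae p0 _ mf)//; exact: measurable_dyadic_cube.
split=> [Nf JM|H].
  by apply: le_trans Nf; rewrite -E; apply: ereal_sup_ubound; exists JM.
by apply: ge_ereal_sup => _ [JM _ <-]; rewrite E.
Qed.

Lemma H_sumE (h : I -> V -> R[i]) : (forall JM, cmeasurable (h JM)) ->
  (H_sum rho q w h = \esum_(JM in [set: I]) ((a JM)%:E * hnorm v p (cnorm (h JM))))%E.
Proof.
move=> mh; apply: eq_esum => JM _; rewrite cube_factor_ae; congr (_ * _)%E.
rewrite /hnorm -/q /q (conj_expK p1) -/q.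
have q0 : 0 < q by rewrite (lt_trans ltr01)// (conj_exp_gt1 p1).
have mwp (z : V -> R) : measurable_fun setT z ->
    measurable_fun setT (fun x => z x `^ (- p^-1)).
  by move=> mz; exact: measurableT_comp (measurable_powR _) mz.
have -> : (fun x => normc (h JM x * (w x `^ (- p^-1))%:C%C)) =
    fun x => cnorm (h JM) x * w x `^ (- p^-1).
  by apply/funext => x; rewrite normcM normc_real ger0_norm ?powR_ge0.
rewrite !Lnorm_EFinE; apply: (congr1 (fun t => t `^ q^-1)%E).
have mpow (z : V -> R) : measurable_fun setT z -> measurable_fun setT
    (fun x => (`|cnorm (h JM) x * z x `^ (- p^-1)| `^ q)%:E).
  move=> mz; apply/measurable_EFinP; apply: (measurableT_comp (measurable_powR _)).
  apply: measurableT_comp => //; apply: measurable_funM; last exact: mwp.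
  exact: measurable_cnorm.
apply: ae_eq_integral; [exact: measurableT|exact: mpow|exact: mpow|].
by apply: filterS wv => x /= -> _.
Qed.

Lemma Lpw_in_Lp f : Lpw u w f -> in_Lp v u setT (re f) /\ in_Lp v u setT (im f).
Proof.
move=> [mf]; rewrite (Lpw_norm_ae u0 measurableT mf) => foo.
have fL : in_Lp v u setT (cnorm f) by split => //; exact: measurable_cnorm.
have [mr mi] := mf; have uu1 : 1 < u by exact: lt_trans pu.
split; apply: (in_Lp_le uu1 v0 mv measurableT _ fL) => // x.
  by rewrite [leRHS]ger0_norm ?normc_ge0//; exact: ler_Re_normc.
by rewrite [leRHS]ger0_norm ?normc_ge0//; exact: ler_Im_normc.
Qed.

Lemma in_Lp_Lpw f : in_Lp v u setT (re f) -> in_Lp v u setT (im f) -> Lpw u w f.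
Proof.
move=> fr fi; have mf : cmeasurable f by case: fr => ? _; case: fi => ? _; split.
split => //; rewrite (Lpw_norm_ae u0 measurableT mf).
have uu1 : 1 < u by exact: lt_trans pu.
have abs (g : V -> R) : in_Lp v u setT g -> in_Lp v u setT (fun x => `|g x|).
  move=> gL; apply: (in_Lp_le uu1 v0 mv measurableT _ gL) => [|x].
    by case: gL => mg _; exact: measurableT_comp.
  by rewrite normr_id.
have L := in_Lp_lin uu1 v0 mv measurableT 1 (abs _ fr) (abs _ fi).
have mc := measurable_cnorm mf.
have [] // := in_Lp_le uu1 v0 mv measurableT mc L.
move=> x; rewrite ger0_norm ?normc_ge0// mul1r [leRHS]ger0_norm ?addr_ge0//.
exact: ler_normc_ReIm.
Qed.

Lemma morrey_norm_Lpw f : Lpw u w f -> (N f <= wnorm v u setT (cnorm f))%E.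
Proof.
move=> [mf]; rewrite (Lpw_norm_ae u0 measurableT mf) => foo.
have nf : wnorm v u setT (cnorm f) \is a fin_num by rewrite ge0_fin_numE ?wnorm_ge0.
rewrite -(fineK nf); apply/(morrey_normP _ mf) => JM; rewrite (fineK nf).
by have := morrey_le_wnormT p1 rp r0 v0 Apv JM (measurable_cnorm mf); apply.
Qed.

Lemma morrey_norm_ge0 f : (0 <= N f)%E.
Proof.
apply: le_trans (ereal_sup_ubound _); last by exists (0, 0).
by rewrite mule_ge0 ?poweR_ge0// lee_fin powR_ge0.
Qed.

Lemma morrey_norm_lin (c : R[i]) f g (m m' : R) : cmeasurable f -> cmeasurable g ->
  (N f <= m%:E)%E -> (N g <= m'%:E)%E ->
  (N (fun x => c * f x + g x)%R <= (normc c * m + m')%:E)%E.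
Proof.
move=> mf mg Nf Ng; have mfg := cmeasurable_lin c mf mg.
apply/(morrey_normP _ mfg) => JM.
have bf := (morrey_normP _ mf).1 Nf JM.
have bg := (morrey_normP _ mg).1 Ng JM.
have b0 : (0 <= (b JM)%:E)%E by rewrite lee_fin powR_ge0.
have mQ := @measurable_dyadic_cube R n JM.
have mcf := measurable_cnorm mf; have mcg := measurable_cnorm mg.
have mzf : measurable_fun setT (fun x => normc c * cnorm f x) by exact: measurable_funM.
have H : (wnorm v p (Q JM) (cnorm (fun x => c * f x + g x)%R) <=
    wnorm v p (Q JM) (fun x => normc c * cnorm f x)%R + wnorm v p (Q JM) (cnorm g))%E.
  apply: (le_trans _ (wnormD (ltW p1) mv mQ mzf mcg)).
  apply: (le_wnorm v0 p0 mv mQ (measurable_cnorm mfg) (measurable_funD mzf mcg)) => x _.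
  rewrite ger0_norm ?normc_ge0// [leRHS]ger0_norm; last first.
    by rewrite addr_ge0 ?mulr_ge0 ?normc_ge0.
  by rewrite /cnorm (le_trans (le_normcD _ _))// normcM.
apply: (le_trans (lee_wpmul2l b0 H)).
rewrite (wnormZ _ v0 p0 mv mQ mcf) ger0_norm ?normc_ge0// ge0_muleDr ?mule_ge0 ?wnorm_ge0 ?lee_fin ?normc_ge0//.
rewrite EFinD EFinM muleCA; apply: leeD => //; apply: lee_wpmul2l => //.
by rewrite lee_fin normc_ge0.
Qed.

Lemma locally_integrable_lin (c : R) (f g : V -> R) : locally_integrable_rV f ->
  locally_integrable_rV g -> locally_integrable_rV (fun x => c * f x + g x).
Proof.
move=> [mf fK] [mg gK]; split.
  by apply: measurable_funD => //; exact: measurable_funM.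
move=> K cK; have mK := compact_measurable_rV cK.
exact: (integrableD mK (integrableZl mK c (fK K cK)) (gK K cK)).
Qed.

Lemma clocally_integrable_lin (c : R[i]) f g : clocally_integrable f ->
  clocally_integrable g -> clocally_integrable (fun x => c * f x + g x).
Proof.
move=> [rf jf] [rg jg]; case: c => c d; split.
  rewrite (_ : re _ = fun x => c * re f x + (- d * im f x + re g x)); last first.
    by apply/funext => x; rewrite /re /im; case: (f x) => ? ?; case: (g x) => * /=; ring.
  by do 2 apply: locally_integrable_lin => //.
rewrite (_ : im _ = fun x => c * im f x + (d * re f x + im g x)); last first.
  by apply/funext => x; rewrite /re /im; case: (f x) => ? ?; case: (g x) => * /=; ring.
by do 2 apply: locally_integrable_lin => //.
Qed.

Lemma locally_integrable_cube (f : V -> R) : measurable_fun setT f ->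
  (forall l, 0 < l -> mu.-integrable (cube 0 l) (EFin \o f)) -> locally_integrable_rV f.
Proof.
move=> mf H; split => // K cK; have [l [l0 Kl]] := compact_sub_cube cK.
apply: (integrableS _ _ Kl (H l l0)); first exact: measurable_cube.
exact: compact_measurable_rV.
Qed.

Lemma clocally_integrable_Lpw f : Lpw u w f -> clocally_integrable f.
Proof.
move=> fL; have [rL iL] := Lpw_in_Lp fL.
split; (apply: locally_integrable_cube; first by case: fL => -[]) => l l0.
  exact: (in_Lp_integrable_cube p1 v0 Apv pu l0 rL).
exact: (in_Lp_integrable_cube p1 v0 Apv pu l0 iL).
Qed.

Definition cflat f := flat_test (re f) /\ flat_test (im f).

Lemma complexE f : f = (fun x => (re f x +i* im f x)%C).
Proof. by apply/funext => x; rewrite /re /im; case: (f x). Qed.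

Lemma cflat_lin (c : R[i]) f g : cflat f -> cflat g -> cflat (fun x => c * f x + g x).
Proof.
move=> [rf jf] [rg jg]; case: c => c d; split.
  rewrite (_ : re _ = fun x => c * re f x + (- d * im f x + re g x)); last first.
    by apply/funext => x; rewrite /re /im; case: (f x) => ? ?; case: (g x) => * /=; ring.
  by do 2 apply: flat_test_lin => //.
rewrite (_ : im _ = fun x => c * im f x + (d * re f x + im g x)); last first.
  by apply/funext => x; rewrite /re /im; case: (f x) => ? ?; case: (g x) => * /=; ring.
by do 2 apply: flat_test_lin => //.
Qed.

Lemma test_function_cflat f : cflat f -> test_function f.
Proof. by move=> [rf jf]; rewrite (complexE f); exact: flat_test_function. Qed.

Lemma schwartz_cflat f : cflat f -> schwartz f.
Proof. by move=> [rf jf]; rewrite (complexE f); exact: flat_schwartz. Qed.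

Lemma test_function_Lpw f : test_function f -> Lpw u w f.
Proof.
move=> [sf [K [cK fK]]]; have [l [l0 Kl]] := compact_sub_cube cK.
have [mr mi] := csmooth_measurable sf.
have [/(_ [::])[cr _] /(_ [::])[ci _]] := sf.
have fl x : ~ cube 0 l x -> f x = 0
    by move=> xl; apply: fK; apply: contra_not xl; exact: Kl.
have bd (g : V -> R) : continuous g -> (forall x, ~ cube 0 l x -> g x = 0) ->
    in_Lp v u setT g.
  move=> cg gl; have mg := continuous_measurable_rV cg.
  have [k gk] := bounded_of_support cg gl.
  exact: (in_Lp_bounded_support v0 Apv u0 mg gk gl).
by apply: (in_Lp_Lpw); apply: bd => // x /fl;
  rewrite /re /im => ->.
Qed.

(** The undifferentiated part of a Schwartz seminorm gives the decay required by [decay_in_Lp], so S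
    embeds continuously into L_u,w. *)
Lemma schwartz_Lpw : exists (m : nat) (K : R), 0 <= K /\ forall f, schwartz f ->
  Lpw u w f /\ (wnorm v u setT (cnorm f) <= K%:E * schwartz_norm m f)%E.
Proof.
have [m [K H]] := decay_in_Lp n0 p1 v0 Apv u1.
exists m, `|K|; split => // f [sf foo].
have mf := csmooth_measurable sf; have mc := measurable_cnorm mf.
have s0 : (0 <= schwartz_norm m f)%E.
  apply: le_trans (ereal_sup_ubound _); last by exists [::] => //; exists 0.
  by rewrite lee_fin mulr_ge0 ?normc_ge0// exprn_ge0// addr_ge0.
have sfin : schwartz_norm m f \is a fin_num by rewrite ge0_fin_numE.
have bound : (wnorm v u setT (cnorm f) <= (fine (schwartz_norm m f) * K)%:E)%E.
  apply: (H _ _ mc) => x; rewrite -lee_fin fineK//; apply: ereal_sup_ubound.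
  exists [::] => //; exists x => //=; rewrite ger0_norm ?normc_ge0//.
  by congr (_ * _)%:E; rewrite /cnorm /cpartials /= /re /im; case: (f x).
split; last first.
  apply: (le_trans bound); rewrite mulrC EFinM fineK//; apply: lee_wpmul2r => //.
  by rewrite lee_fin ler_norm.
split => //; rewrite (Lpw_norm_ae u0 measurableT mf).
by rewrite (le_lt_trans bound)// ltry.
Qed.

Lemma Lpw_dense f (e : R) : Lpw u w f -> 0 < e ->
  exists g, cflat g /\ (N (fun x => f x - g x)%R < e%:E)%E.
Proof.
move=> fL e0; have [rL iL] := Lpw_in_Lp fL.
have e40 : 0 < e / 4 by rewrite divr_gt0.
have vloc l : (\int[mu]_(x in cube 0 l) (v x)%:E < +oo)%E.
  have [_] := integrableP _ _ _ (weight_integrable_cube Apv 0 l); apply: le_lt_trans.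
  have mC := measurable_cube (0 : V) l; apply: ge0_le_integral => //.
  - by move=> x _; rewrite lee_fin ltW.
  - by apply/measurable_EFinP; exact: measurable_funTS.
  - by apply: measurableT_comp => //; apply/measurable_EFinP; exact: measurable_funTS.
  - by move=> x _; rewrite lee_fin ler_norm.
have [g1 [t1 h1]] := flat_test_dense u1 v0 mv vloc rL e40.
have [g2 [t2 h2]] := flat_test_dense u1 v0 mv vloc iL e40.
pose g : V -> R[i] := fun x => (g1 x +i* g2 x)%C.
have tg : cflat g by [].
exists g; split => //.
have gL : Lpw u w g by apply: test_function_Lpw; exact: test_function_cflat.
pose d x := f x - g x.
have dE : d = fun x => -1 * g x + f x by apply/funext => x; rewrite mulN1r addrC.
have [mf _] := fL; have [mg _] := gL.
have md : cmeasurable d by rewrite dE; exact: cmeasurable_lin.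
have dL : Lpw u w d.
  have uu1 : 1 < u by exact: lt_trans pu.
  have [rgL igL] := Lpw_in_Lp gL.
  apply: (in_Lp_Lpw).
    have := in_Lp_lin uu1 v0 mv measurableT (-1) rgL rL; congr in_Lp.
    by apply/funext => x; rewrite /d /re; case: (f x) => ? ?; rewrite /= mulN1r addrC.
  have := in_Lp_lin uu1 v0 mv measurableT (-1) igL iL; congr in_Lp.
  by apply/funext => x; rewrite /d /im; case: (f x) => ? ?; rewrite /= mulN1r addrC.
apply: (le_lt_trans (morrey_norm_Lpw dL)).
have [md1 md2] : measurable_fun setT (re f \- g1) /\ measurable_fun setT (im f \- g2).
  by case: mf => ? ?; case: mg => ? ?; split; exact: measurable_funB.
have mn1 : measurable_fun setT (fun x => `|(re f \- g1) x|) by exact: measurableT_comp.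
have mn2 : measurable_fun setT (fun x => `|(im f \- g2) x|) by exact: measurableT_comp.
have H : (wnorm v u setT (cnorm d) <= wnorm v u setT (fun x => `|(re f \- g1) x|)%R +
    wnorm v u setT (fun x => `|(im f \- g2) x|)%R)%E.
  apply: (le_trans _ (wnormD u1 mv measurableT mn1 mn2)).
  apply: (le_wnorm v0 u0 mv measurableT (measurable_cnorm md) (measurable_funD mn1 mn2)).
  move=> x _; rewrite ger0_norm ?normc_ge0// [leRHS]ger0_norm ?addr_ge0//.
  apply: (le_trans (ler_normc_ReIm _)).
  by rewrite /d /= /re /im; case: (f x).
have nE (z : V -> R) : measurable_fun setT z ->
    (wnorm v u setT (fun x => `|z x|)%R <= wnorm v u setT z)%E.
  move=> mz; apply: (le_wnorm v0 u0 mv measurableT _ mz) => [|x _]; last by rewrite normr_id.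
  exact: measurableT_comp.
apply: (le_lt_trans H); apply: (@le_lt_trans _ _ ((e / 4)%:E + (e / 4)%:E)%E).
  apply: leeD; [exact: le_trans (nE _ md1) h1|exact: le_trans (nE _ md2) h2].
by rewrite -EFinD lte_fin; lra.
Qed.

Lemma morrey_closure_measurable f : X f -> cmeasurable f.
Proof. by move=> [[[[mr _] [mi _]] _] _]. Qed.

Let subE f g : (fun x => f x - g x) = fun x => -1 * g x + f x.
Proof. by apply/funext => x; rewrite mulN1r addrC. Qed.

Lemma cflat_Lpw f : cflat f -> Lpw u w f.
Proof.
move=> tf; apply: (test_function_Lpw).
exact: test_function_cflat.
Qed.

Let cmeasurable_sub f g : cmeasurable f -> cmeasurable g -> cmeasurable (fun x => f x - g x).
Proof. by move=> mf mg; rewrite subE; exact: cmeasurable_lin. Qed.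

Lemma Lpw_morrey_closure f : Lpw u w f -> X f.
Proof.
move=> fL; split; [split|].
- exact: (clocally_integrable_Lpw fL).
- apply: (le_lt_trans (morrey_norm_Lpw fL)).
  have [mf] := fL; by rewrite (Lpw_norm_ae u0 measurableT mf).
move=> e e0; have [g [tg gN]] := Lpw_dense fL e0.
by exists g; split => //; exact: test_function_cflat.
Qed.

(** An arbitrary test function lies in L_u,w and is therefore itself approximable by flat ones.
    Later arguments can then use the flat algebra alone, whose elements are known to be Schwartz
    functions. *)
Lemma cflat_dense f (e : R) : X f -> 0 < e ->
  exists g, cflat g /\ (N (fun x => f x - g x)%R < e%:E)%E.
Proof.
move=> Xf e0; have mf := morrey_closure_measurable Xf; have [_ fD] := Xf.
have e30 : 0 < e / 3 by rewrite divr_gt0.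
have [phi [tphi hphi]] := fD _ e30.
have phiL := test_function_Lpw tphi.
have [g [tg hg]] := Lpw_dense phiL e30.
exists g; split => //.
have [mphi _] := phiL; have [mg _] := cflat_Lpw tg.
have := morrey_norm_lin 1 (cmeasurable_sub mf mphi)
  (cmeasurable_sub mphi mg) (ltW hphi) (ltW hg).
rewrite normc1 mul1r => /le_lt_trans h.
rewrite (_ : (fun x => f x - g x) = fun x => 1 * (f x - phi x) + (phi x - g x)); last first.
  by apply/funext => x; rewrite mul1r addrA subrK.
by apply: h; rewrite lte_fin; lra.
Qed.

Lemma morrey_closure_lin (c : R[i]) f g : X f -> X g -> X (fun x => c * f x + g x).
Proof.
move=> Xf Xg; have mf := morrey_closure_measurable Xf; have mg := morrey_closure_measurable Xg.
have [[lf foo] _] := Xf; have [[lg goo] _] := Xg.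
have fin z : (N z < +oo)%E -> N z \is a fin_num.
  by move=> zoo; rewrite ge0_fin_numE// morrey_norm_ge0.
split; [split|].
- exact: clocally_integrable_lin.
- apply: le_lt_trans (morrey_norm_lin c (m := fine (N f))
    (m' := fine (N g)) mf mg _ _) _; [| |exact: ltry].
    by rewrite fineK ?fin.
  by rewrite fineK ?fin.
move=> e e0; have k0 := normc_ge0 c; set k := normc c in k0.
have e30 : 0 < e / 3 by rewrite divr_gt0.
have ek0 : 0 < e / 3 / (k + 1) by rewrite divr_gt0// ltr_wpDl.
have [f' [tf' hf]] := cflat_dense Xf ek0.
have [g' [tg' hg]] := cflat_dense Xg e30.
exists (fun x => c * f' x + g' x); split.
  by apply: test_function_cflat; exact: cflat_lin.
have [mf' _] := cflat_Lpw tf'; have [mg' _] := cflat_Lpw tg'.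
have := morrey_norm_lin c (cmeasurable_sub mf mf')
  (cmeasurable_sub mg mg') (ltW hf) (ltW hg).
rewrite (_ : (fun x => c * (f x - f' x) + _) =
    fun x => c * f x + g x - (c * f' x + g' x)); last first.
  by apply/funext => x; ring.
move=> /le_lt_trans; apply; rewrite lte_fin -/k.
have h : k * (e / 3 / (k + 1)) <= e / 3.
  by rewrite mulrA ler_pdivrMr ?ltr_wpDl// mulrC ler_wpM2l ?(ltW e30)// lerDl.
by apply: (le_lt_trans (lerD h (lexx _))); lra.
Qed.

Lemma morrey_closure0 : X (fun=> 0).
Proof.
apply: Lpw_morrey_closure; apply: cflat_Lpw; split.
  rewrite (_ : re _ = cst 0)//; split; first exact: flat_cst.
  by exists 1.
rewrite (_ : im _ = cst 0)//; split; first exact: flat_cst.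
by exists 1.
Qed.

Lemma morrey_norm0 : (N (fun=> 0%R) <= 0)%E.
Proof.
apply/(morrey_normP 0) => [|JM]; first exact: morrey_closure_measurable morrey_closure0.
rewrite (_ : cnorm _ = cst 0); last by apply/funext => x; exact: normc0.
have mQ := @measurable_dyadic_cube R n JM.
by rewrite (wnorm_cst v0 mv p0 0 mQ) normr0 mul0e mule0.
Qed.

(** Two bounded functionals that agree on a dense subspace agree; the dense functions used are the
    flat ones, which lie in L_u,w. *)
Lemma dual_ext G1 G2 : dual X N G1 -> dual X N G2 ->
  (forall f, Lpw u w f -> G1 f = G2 f) -> forall f, X f -> G1 f = G2 f.
Proof.
move=> [lin1 [C1 b1]] [lin2 [C2 b2]] GE f Xf.
apply/eqP; rewrite -subr_eq0; apply/eqP/eq0_normc/eqP.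
rewrite eq_le normc_ge0 andbT; apply/ler_addgt0Pr => e e0; rewrite add0r.
have k0 : 0 < `|C1| + `|C2| + 1 by rewrite ltr_wpDl.
(* The constants of [bounded_on] may be negative, hence the absolute values; the summand 1 keeps the
   denominator positive. *)
have d0 : 0 < e / (`|C1| + `|C2| + 1) by rewrite divr_gt0.
have [g [tg gN]] := cflat_dense Xf d0.
have gL := cflat_Lpw tg; have Xg := Lpw_morrey_closure gL.
have Xfg : X (fun x => -1 * g x + f x) by exact: morrey_closure_lin.
rewrite subE in gN.
have bound G C : (forall f, X f -> ((normc (G f))%:E <= C%:E * N f)%E) ->
    normc (G (fun x => -1 * g x + f x)) <= `|C| * (e / (`|C1| + `|C2| + 1)).
  move=> /(_ _ Xfg) h; rewrite -lee_fin (le_trans h)// EFinM.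
  apply: (@le_trans _ _ (`|C|%:E * N (fun x => -1 * g x + f x)%R)%E).
    by apply: lee_wpmul2r; rewrite ?morrey_norm_ge0// lee_fin ler_norm.
  by apply: lee_wpmul2l; rewrite ?lee_fin// ltW.
have -> : G1 f - G2 f = G1 (fun x => -1 * g x + f x) - G2 (fun x => -1 * g x + f x).
  by rewrite (lin1 _ _ _ Xg Xf) (lin2 _ _ _ Xg Xf) (GE _ gL); ring.
rewrite (le_trans (le_normcD _ _))// normcN (le_trans (lerD (bound _ _ b1) (bound _ _ b2)))//.
by rewrite -mulrDl mulrA ler_pdivrMr// mulrC ler_wpM2l ?(ltW e0)// lerDl.
Qed.

(** Rescaling to the unit ball makes the dual norm itself a bound. The conclusion has the form of
    the hypothesis of [dual_representation]. *)
Lemma dual_normE G : dual X N G -> exists D : R, [/\ 0 <= D, dual_norm X N G = D%:E &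
  forall f (m : R), X f -> (N f <= m%:E)%E -> normc (G f) <= D * m].
Proof.
move=> [lin [C CG]]; pose D := dual_norm X N G.
have D0 : (0 <= D)%E.
  apply: (@le_trans _ _ (normc (G (fun=> 0)))%:E); first by rewrite lee_fin normc_ge0.
  apply: ereal_sup_ubound; exists (fun=> 0) => //; split; first exact: morrey_closure0.
  by apply: (le_trans morrey_norm0); exact: lee01.
have DC : (D <= `|C|%:E)%E.
  apply: ge_ereal_sup => _ [f [Xf Nf] <-]; apply: (le_trans (CG f Xf)).
  apply: (@le_trans _ _ (`|C|%:E * N f)%E).
    by apply: lee_wpmul2r; rewrite ?morrey_norm_ge0// lee_fin ler_norm.
  by rewrite -[leRHS]mule1; apply: lee_wpmul2l; rewrite ?lee_fin.
have Dfin : D \is a fin_num by rewrite ge0_fin_numE// (le_lt_trans DC)// ltry.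
exists (fine D); split; [by rewrite fine_ge0|by rewrite fineK|].
move=> f m Xf Nf; have m0 : 0 <= m by rewrite -lee_fin; apply: le_trans Nf; exact: morrey_norm_ge0.
(* For [m = 0] no rescaling is possible; boundedness with the constant [C] gives [G f = 0]
   directly. *)
have [m00|mN0] := eqVneq m 0.
  have Nf0 : N f = 0%E.
    by apply/eqP; rewrite eq_le morrey_norm_ge0 andbT; move: Nf; rewrite m00.
  by have := CG f Xf; rewrite Nf0 mule0 m00 mulr0 lee_fin.
have mp : 0 < m by rewrite lt0r mN0.
pose c : R[i] := (m^-1)%:C%C.
have nc : normc c = m^-1 by rewrite normc_real ger0_norm// invr_ge0.
have Xcf : X (fun x => c * f x + 0) := morrey_closure_lin c Xf morrey_closure0.
have G0 : G (fun=> 0) = 0.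
  have := lin (-1) _ _ morrey_closure0 morrey_closure0; rewrite (_ : (fun x => _) = fun=> 0).
    by rewrite mulN1r addNr.
  by apply/funext => x; rewrite mulr0 addr0.
have Nc : (N (fun x => c * f x + 0)%R <= 1)%E.
  have := morrey_norm_lin c (morrey_closure_measurable Xf) (morrey_closure_measurable morrey_closure0) Nf morrey_norm0.
  by rewrite nc mulVf// addr0.
have : ((normc (G (fun x => c * f x + 0)))%:E <= D)%E.
  by apply: ereal_sup_ubound; exists (fun x => c * f x + 0).
rewrite (lin _ _ _ Xf morrey_closure0) G0 addr0 normcM nc -(fineK Dfin) lee_fin.
by rewrite mulrC ler_pdivrMr.
Qed.

Lemma cintegralM G f :
  mu.-integrable setT (fun x => (re G x * re f x)%:E) ->
  mu.-integrable setT (fun x => (re G x * im f x)%:E) ->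
  mu.-integrable setT (fun x => (im G x * re f x)%:E) ->
  mu.-integrable setT (fun x => (im G x * im f x)%:E) ->
  cintegrable setT (fun x => G x * f x) /\
  cintegral setT (fun x => G x * f x) =
    ((\int[mu]_x (re G x * re f x) - \int[mu]_x (im G x * im f x)) +i*
     (\int[mu]_x (re G x * im f x) + \int[mu]_x (im G x * re f x)))%C.
Proof.
move=> rr ri ir ii.
have reE : re (fun x => G x * f x) = fun x => re G x * re f x - im G x * im f x.
  by apply/funext => x; rewrite /re /im; case: (G x) => ? ?; case: (f x).
have imE : im (fun x => G x * f x) = fun x => re G x * im f x + im G x * re f x.
  by apply/funext => x; rewrite /re /im; case: (G x) => ? ?; case: (f x).
split; last by rewrite /cintegral reE imE RintegralB// RintegralD.
split; first by rewrite reE; exact: (integrableB measurableT rr ii).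
by rewrite imE; exact: (integrableD measurableT ri ir).
Qed.

Lemma pairing_integrable (h f : V -> R) (JM : I) (C m : R) :
  measurable_fun setT h -> measurable_fun setT f ->
  {ae mu, forall x, ~ Q JM x -> h x = 0} ->
  ((a JM)%:E * hnorm v p h <= C%:E)%E ->
  ((b JM)%:E * wnorm v p (Q JM) f <= m%:E)%E ->
  mu.-integrable setT (fun x => (h x * f x)%:E).
Proof.
move=> mh mf hQ hC fm; apply/integrableP; split.
  by apply/measurable_EFinP/measurable_funM.
apply: (le_lt_trans (hnorm_pairing_dyadic n0 p1 rrho v0 Apv mh mf hQ)).
have a0 : (0 <= (a JM)%:E * hnorm v p h)%E by rewrite mule_ge0 ?Lnorm_ge0// lee_fin powR_ge0.
have b0 : (0 <= (b JM)%:E * wnorm v p (Q JM) f)%E.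
  by rewrite mule_ge0 ?wnorm_ge0// lee_fin powR_ge0.
apply: (le_lt_trans (lee_pmul a0 b0 hC fm)); by rewrite -EFinM ltry.
Qed.

Lemma hnorm_le (h k : V -> R) : measurable_fun setT h -> measurable_fun setT k ->
  (forall x, `|h x| <= `|k x|) -> (hnorm v p h <= hnorm v p k)%E.
Proof.
move=> mh mk hk; have q1 : 1 < q by exact: conj_exp_gt1.
have q0 : 0 < q by exact: lt_trans q1.
rewrite /hnorm !Lnorm_EFinE; apply: le_poweR.
- by rewrite invr_ge0 ltW.
- by apply: integral_ge0 => x _; rewrite lee_fin powR_ge0.
have mm (z : V -> R) : measurable_fun setT z ->
    measurable_fun setT (fun x => (`|z x * v x `^ (- p^-1)| `^ q)%:E).
  move=> mz; apply/measurable_EFinP; apply: (measurableT_comp (measurable_powR _)).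
  by apply: measurableT_comp => //; exact: measurable_hweight.
apply: ge0_le_integral; [exact: measurableT|by move=> x _; rewrite lee_fin powR_ge0
  |exact: mm|exact: mm|].
move=> x _; rewrite lee_fin; apply: ge0_ler_powR; rewrite ?nnegrE ?normr_ge0 ?(ltW q0)//.
by rewrite [leLHS]normrM [leRHS]normrM ler_wpM2r.
Qed.

Lemma esum_term (h : I -> V -> R) (C : R) (JM : I) :
  (\esum_(JM in [set: I]) ((a JM)%:E * hnorm v p (h JM)) <= C%:E)%E ->
  ((a JM)%:E * hnorm v p (h JM) <= C%:E)%E.
Proof.
apply: le_trans; apply: esum_ge; exists [set JM].
  by split => //; exact: finite_set1.
by rewrite fsbig_set1.
Qed.

(** Real and imaginary parts of [h] are synthesised separately. The factor 4 counts the products of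
    the parts of [G] with those of [f], each of which integrates to at most [C * m] in absolute
    value. *)
Lemma csynthesis (h : I -> V -> R[i]) (C : R) :
  (forall JM, cmeasurable (h JM)) ->
  (forall JM, {ae mu, forall x, ~ Q JM x -> h JM x = 0}) ->
  (H_sum rho q w h <= C%:E)%E ->
  exists G, cmeasurable G /\ forall f, cmeasurable f ->
    forall m : R, (N f <= m%:E)%E ->
    [/\ cintegrable setT (fun x => G x * f x),
        normc (cintegral setT (fun x => G x * f x)) <= 4 * C * m &
        summability.partial_sum (fun JM => function_distr (h JM) f)
          @ summability.totally --> (cintegral setT (fun x => G x * f x) : R[i]^o)].
Proof.
move=> mh hQ; rewrite (H_sumE mh) => hC.
have C_re : (\esum_(JM in [set: I]) ((a JM)%:E * hnorm v p (re (h JM))) <= C%:E)%E.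
  apply: le_trans hC; apply: le_esum => JM _; apply: lee_wpmul2l.
    by rewrite lee_fin powR_ge0.
  apply: hnorm_le; [by case: (mh JM)|exact: measurable_cnorm|move=> x].
  by rewrite [leRHS]ger0_norm ?normc_ge0//; exact: ler_Re_normc.
have C_im : (\esum_(JM in [set: I]) ((a JM)%:E * hnorm v p (im (h JM))) <= C%:E)%E.
  apply: le_trans hC; apply: le_esum => JM _; apply: lee_wpmul2l.
    by rewrite lee_fin powR_ge0.
  apply: hnorm_le; [by case: (mh JM)|exact: measurable_cnorm|move=> x].
  by rewrite [leRHS]ger0_norm ?normc_ge0//; exact: ler_Im_normc.
have mre JM : measurable_fun setT (re (h JM)) by case: (mh JM).
have mim JM : measurable_fun setT (im (h JM)) by case: (mh JM).
have Qre JM : {ae mu, forall x, ~ Q JM x -> re (h JM) x = 0}.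
  by apply: filterS (hQ JM) => x /[apply]; rewrite /re => ->.
have Qim JM : {ae mu, forall x, ~ Q JM x -> im (h JM) x = 0}.
  by apply: filterS (hQ JM) => x /[apply]; rewrite /im => ->.
have [G1 [mG1 G1P]] := synthesis n0 p1 rp r0 rrho v0 Apv mre Qre C_re.
have [G2 [mG2 G2P]] := synthesis n0 p1 rp r0 rrho v0 Apv mim Qim C_im.
exists (fun x => (G1 x +i* G2 x)%C); split; first by [].
move=> f mf m Nf.
have bf := (morrey_normP m mf).1 Nf.
have [mfr mfi] := mf; have mfc := measurable_cnorm mf.
have le_b (g : V -> R) : measurable_fun setT g -> (forall x, `|g x| <= `|cnorm f x|) ->
    forall JM, ((b JM)%:E * wnorm v p (Q JM) g <= m%:E)%E.
  move=> mg gf JM; apply: le_trans (bf JM); apply: lee_wpmul2l.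
    by rewrite lee_fin powR_ge0.
  by apply: (le_wnorm v0 p0 mv (@measurable_dyadic_cube R n JM) mg mfc) => x _.
have bfr : forall JM, ((b JM)%:E * wnorm v p (Q JM) (re f) <= m%:E)%E.
  by apply: le_b => // x; rewrite [leRHS]ger0_norm ?normc_ge0//; exact: ler_Re_normc.
have bfi : forall JM, ((b JM)%:E * wnorm v p (Q JM) (im f) <= m%:E)%E.
  by apply: le_b => // x; rewrite [leRHS]ger0_norm ?normc_ge0//; exact: ler_Im_normc.
have [rr1 rr2 rr3] := G1P _ mfr m bfr; have [ri1 ri2 ri3] := G1P _ mfi m bfi.
have [ir1 ir2 ir3] := G2P _ mfr m bfr; have [ii1 ii2 ii3] := G2P _ mfi m bfi.
have [cG cGE] := @cintegralM (fun x => (G1 x +i* G2 x)%C) f rr1 ri1 ir1 ii1.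
have bd (k : V -> R) : mu.-integrable setT (fun x => (k x)%:E) ->
    (\int[mu]_x `|k x|%:E <= (C * m)%:E)%E -> `|\int[mu]_x k x| <= C * m.
  move=> ik kC; apply: (le_trans (le_normr_Rintegral measurableT ik)).
  rewrite -lee_fin /Rintegral fineK//.
  by rewrite ge0_fin_numE ?integral_ge0// (le_lt_trans kC)// ltry.
split; [exact: cG| |].
  rewrite cGE; apply: (le_trans (ler_normc_ReIm _)); rewrite /=.
  apply: (le_trans (lerD (ler_normB _ _) (ler_normD _ _))).
  have := bd _ rr1 rr2; have := bd _ ri1 ri2; have := bd _ ir1 ir2; have := bd _ ii1 ii2.
  move=> h1 h2 h3 h4.
  apply: (le_trans (lerD (lerD h4 h1) (lerD h3 h2))).
  by rewrite le_eqVlt; apply/orP; left; apply/eqP; ring.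
rewrite cGE; have FF := @summability.totally_filter I.
have hE JM : function_distr (h JM) f =
    ((\int[mu]_x (re (h JM) x * re f x) - \int[mu]_x (im (h JM) x * im f x)) +i*
     (\int[mu]_x (re (h JM) x * im f x) + \int[mu]_x (im (h JM) x * re f x)))%C.
  apply: (cintegralM _ _ _ _).2.
  - exact: (pairing_integrable (mre JM) mfr (Qre JM) (esum_term JM C_re) (bfr JM)).
  - exact: (pairing_integrable (mre JM) mfi (Qre JM) (esum_term JM C_re) (bfi JM)).
  - exact: (pairing_integrable (mim JM) mfr (Qim JM) (esum_term JM C_im) (bfr JM)).
  - exact: (pairing_integrable (mim JM) mfi (Qim JM) (esum_term JM C_im) (bfi JM)).
apply: cvg_complex.
  apply: cvg_trans (cvgB rr3 ii3); apply: near_eq_cvg; apply: nearW => B.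
  rewrite -[LHS]/(summability.partial_sum _ B - summability.partial_sum _ B).
  rewrite /summability.partial_sum -sumrB [RHS]raddf_sum; apply: eq_bigr => JM _.
  by rewrite hE.
apply: cvg_trans (cvgD ri3 ir3); apply: near_eq_cvg; apply: nearW => B.
rewrite -[LHS]/(summability.partial_sum _ B + summability.partial_sum _ B).
rewrite /summability.partial_sum -big_split [RHS]raddf_sum; apply: eq_bigr => JM _.
by rewrite hE.
Qed.

Lemma ae_eq_of_cflat G1 G2 : clocally_integrable G1 -> clocally_integrable G2 ->
  (forall g, cflat g -> [/\ cintegrable setT (fun x => G1 x * g x),
     cintegrable setT (fun x => G2 x * g x) &
     cintegral setT (fun x => G1 x * g x) = cintegral setT (fun x => G2 x * g x)]) ->
  ae_equal G1 G2.
Proof.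
move=> [[mr1 r1] [mi1 i1]] [[mr2 r2] [mi2 i2]] GE.
have key (F1 F2 : V -> R) : locally_integrable_rV F1 -> locally_integrable_rV F2 ->
    (forall phi, flat_test phi -> [/\ mu.-integrable setT (fun x => (F1 x * phi x)%:E),
       mu.-integrable setT (fun x => (F2 x * phi x)%:E) &
       \int[mu]_x (F1 x * phi x) = \int[mu]_x (F2 x * phi x)]) ->
    {ae mu, forall x, F1 x = F2 x}.
  move=> [mF1 lF1] [mF2 lF2] FE.
  have mF : measurable_fun setT (F1 \- F2) by exact: measurable_funB.
  have : {ae mu, forall x, (F1 \- F2) x = 0}.
    apply: (du_bois_reymond mF) => [l|phi tphi].
      have cC : compact (cube (0 : V) l) by exact: cube_compact.
      have mC := measurable_cube (0 : V) l.
      exact: (integrableB mC (lF1 _ cC) (lF2 _ cC)).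
    have [if1 if2 E] := FE _ tphi.
    under eq_Rintegral do rewrite mulrBl.
    by rewrite RintegralB// E subrr.
  by apply: filterS => x /= /eqP; rewrite subr_eq0 => /eqP.
have t0 : flat_test (cst 0 : V -> R) by split; [exact: flat_cst|exists 1].
(* Pairing with real test functions separates the real and imaginary parts of [G1] and [G2]. *)
have testE (phi : V -> R) : flat_test phi -> cflat (fun x => (phi x)%:C%C) by [].
have hr : {ae mu, forall x, re G1 x = re G2 x}.
  apply: key => // phi tphi; have [[c1 _] [c2 _] cE] := GE _ (testE _ tphi).
  have E (G : V -> R[i]) : re (fun x => G x * (phi x)%:C%C) = fun x => re G x * phi x.
    by apply/funext => x; rewrite /re; case: (G x) => * /=; rewrite mulr0 subr0.
  by move: c1 c2 cE; rewrite /cintegral !E => ? ? [].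
have hi : {ae mu, forall x, im G1 x = im G2 x}.
  apply: key => // phi tphi; have [[_ c1] [_ c2] cE] := GE _ (testE _ tphi).
  have E (G : V -> R[i]) : im (fun x => G x * (phi x)%:C%C) = fun x => im G x * phi x.
    by apply/funext => x; rewrite /im; case: (G x) => * /=; rewrite mulr0 add0r.
  by move: c1 c2 cE; rewrite /cintegral !E => ? ? [].
apply: filterS2 hr hi => x; rewrite /re /im.
by case: (G1 x) => ? ?; case: (G2 x) => ? ? /= -> ->.
Qed.

(** * Kernels pairing boundedly with Morrey functions *)

Lemma cintegral_lin (c : R[i]) G f g :
  cintegrable setT (fun x => G x * f x) -> cintegrable setT (fun x => G x * g x) ->
  cintegral setT (fun x => G x * (c * f x + g x)) =
  c * cintegral setT (fun x => G x * f x) + cintegral setT (fun x => G x * g x).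
Proof.
move=> [rf jf] [rg jg]; case: c => s t; rewrite /cintegral.
set F := fun x => G x * f x; set F' := fun x => G x * g x.
have -> : re (fun x => G x * ((s +i* t)%C * f x + g x)) =
    fun x => (s * re F x - t * im F x) + re F' x.
  apply/funext => x; rewrite /re /im /F /F'; case: (G x) => ? ?; case: (f x) => ? ?.
  by case: (g x) => ? ? /=; ring.
have -> : im (fun x => G x * ((s +i* t)%C * f x + g x)) =
    fun x => (s * im F x + t * re F x) + im F' x.
  apply/funext => x; rewrite /re /im /F /F'; case: (G x) => ? ?; case: (f x) => ? ?.
  by case: (g x) => ? ? /=; ring.
have Z (k : R) (z : V -> R) : mu.-integrable setT (EFin \o z) ->
    mu.-integrable setT (EFin \o (fun x => k * z x)).
  by move=> iz; exact: (integrableZl measurableT k iz).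
rewrite RintegralD//; last exact: (integrableB measurableT (Z _ _ rf) (Z _ _ jf)).
rewrite RintegralB//; [|exact: Z|exact: Z].
rewrite RintegralD//; last exact: (integrableD measurableT (Z _ _ jf) (Z _ _ rf)).
rewrite RintegralD//; [|exact: Z|exact: Z].
by rewrite !RintegralZl.
Qed.

(** Isolates what a synthesised function provides. The pairing is bounded for every measurable
    function of finite Morrey norm, not merely on the closure of the test functions. *)
Definition morrey_kernel G (C : R) := cmeasurable G /\
  forall f, cmeasurable f -> forall m : R, (N f <= m%:E)%E ->
    cintegrable setT (fun x => G x * f x) /\
    normc (cintegral setT (fun x => G x * f x)) <= C * m.

Lemma Lpw_morrey_bounded f : Lpw u w f -> exists m : R, (N f <= m%:E)%E.
Proof.
move=> fL; have [mf] := fL.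
rewrite (Lpw_norm_ae u0 measurableT mf) => foo.
exists (fine (wnorm v u setT (cnorm f))); rewrite fineK; last first.
  by rewrite ge0_fin_numE// wnorm_ge0.
exact: (morrey_norm_Lpw fL).
Qed.

(** Pair [G] with indicators of cubes, which lie in L_u,w. *)
Lemma kernel_clocally_integrable G C : morrey_kernel G C -> clocally_integrable G.
Proof.
move=> [[mr mi] GP].
have cube_int l : 0 < l -> mu.-integrable (cube 0 l) (EFin \o re G) /\
    mu.-integrable (cube 0 l) (EFin \o im G).
  move=> l0; have mC := measurable_cube (0 : V) l.
  pose f : V -> R[i] := fun x => (\1_(cube 0 l) x)%:C%C.
  have Z : in_Lp v u setT (cst 0).
    by apply: (@in_Lp_bounded_support _ _ _ _ v0 Apv _ 0 0) => // x; rewrite normr0.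
  have fL : Lpw u w f.
    apply: (in_Lp_Lpw); last exact: Z.
    exact: (in_Lp_cube v0 Apv l u0).
  have [m fm] := Lpw_morrey_bounded fL; have [mf _] := fL.
  have [[ir ii] _] := GP _ mf m fm.
  split; rewrite (integrable_mkcond _ mC) -EFin_mul_indic.
    move: ir; congr (mu.-integrable setT _); apply/funext => x.
    by rewrite /= /re /f; case: (G x) => * /=; rewrite mulr0 subr0.
  move: ii; congr (mu.-integrable setT _); apply/funext => x.
  by rewrite /= /im /f; case: (G x) => * /=; rewrite mulr0 add0r.
by split; apply: locally_integrable_cube => // l l0; have [] := cube_int l l0.
Qed.

Lemma kernel_regular G C : morrey_kernel G C -> regular_on_schwartz G.
Proof.
move=> kG; split; first exact: kernel_clocally_integrable kG.
move=> phi sphi; have [_ [_ [_ /(_ phi sphi)[phiL _]]]] :=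
  schwartz_Lpw.
have [m fm] := Lpw_morrey_bounded phiL; have [mf _] := phiL.
by have [_ /(_ _ mf m fm)[]] := kG.
Qed.

(** The pairing is bounded by the Morrey norm, this by the norm of L_u,w, and this by a Schwartz
    seminorm. *)
Lemma kernel_tempered G C : 0 <= C -> morrey_kernel G C -> tempered (function_distr G).
Proof.
move=> C0 kG; have [_ GS] := kernel_regular kG; split.
  by move=> c f g sf sg; apply: cintegral_lin; exact: GS.
have [k [K [K0 HK]]] := schwartz_Lpw.
exists k, (C * K) => phi sphi; have [phiL phiK] := HK phi sphi.
have [mf] := phiL; rewrite (Lpw_norm_ae u0 measurableT mf) => foo.
have nfin : wnorm v u setT (cnorm phi) \is a fin_num by rewrite ge0_fin_numE// wnorm_ge0.
have Nphi : (N phi <= (fine (wnorm v u setT (cnorm phi)))%:E)%E.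
  by rewrite fineK//; exact: (morrey_norm_Lpw phiL).
have [_ /(_ _ mf _ Nphi)[_ h]] := kG.
apply: (@le_trans _ _ (C%:E * wnorm v u setT (cnorm phi))%E).
  by rewrite -(fineK nfin) -EFinM lee_fin.
by rewrite EFinM -muleA; apply: lee_wpmul2l => //; rewrite lee_fin.
Qed.

Lemma kernel_represents G C : morrey_kernel G C ->
  represents u w (fun f => cintegral setT (fun x => G x * f x)) G.
Proof.
move=> kG f fL; have [m fm] := Lpw_morrey_bounded fL; have [mf _] := fL.
by have [_ /(_ _ mf m fm)[]] := kG.
Qed.

Lemma kernel_dual G C : 0 <= C -> morrey_kernel G C ->
  dual X N (fun f => cintegral setT (fun x => G x * f x)).
Proof.
move=> C0 [mG kG].
have Xint f : X f -> exists m : R, [/\ N f = m%:E, cintegrable setT (fun x => G x * f x) &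
    normc (cintegral setT (fun x => G x * f x)) <= C * m].
  move=> Xf; have mf := morrey_closure_measurable Xf; have [[_ foo] _] := Xf.
  have Nfin : N f \is a fin_num by rewrite ge0_fin_numE// morrey_norm_ge0.
  exists (fine (N f)); rewrite fineK//.
  have h : (N f <= (fine (N f))%:E)%E by rewrite fineK.
  by have [] := kG f mf _ h; split.
split.
  move=> c f g Xf Xg; have [_ [_ cf _]] := Xint _ Xf; have [_ [_ cg _]] := Xint _ Xg.
  exact: cintegral_lin.
exists C => f Xf; have [m [-> _ h]] := Xint f Xf.
by rewrite -EFinM lee_fin.
Qed.

Lemma cintegral_ae (F F' : V -> R[i]) : cmeasurable F -> cmeasurable F' -> ae_equal F F' ->
  (cintegrable setT F' -> cintegrable setT F) /\ cintegral setT F = cintegral setT F'.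
Proof.
move=> [mr mi] [mr' mi'] FF'.
have aer : {ae mu, forall x, re F' x = re F x}.
  by apply: filterS FF' => x; rewrite /re => ->.
have aei : {ae mu, forall x, im F' x = im F x}.
  by apply: filterS FF' => x; rewrite /im => ->.
have key (g g' : V -> R) : measurable_fun setT g -> measurable_fun setT g' ->
    {ae mu, forall x, g' x = g x} ->
    (mu.-integrable setT (EFin \o g') -> mu.-integrable setT (EFin \o g)) /\
    \int[mu]_x g x = \int[mu]_x g' x.
  move=> mg mg' gg'; split.
    move=> /integrableP[_ goo]; apply/integrableP; split; first exact/measurable_EFinP.
    apply: le_lt_trans goo; rewrite le_eqVlt; apply/orP; left; apply/eqP.
    apply: ae_eq_integral => //.
    - by apply: measurableT_comp => //; exact/measurable_EFinP.
    - by apply: measurableT_comp => //; exact/measurable_EFinP.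
    - by apply: filterS gg' => x /= ->.
  rewrite /Rintegral; congr fine; apply: ae_eq_integral => //;
    [exact/measurable_EFinP|exact/measurable_EFinP|].
  by apply: filterS gg' => x /= ->.
have [r1 r2] := key _ _ mr mr' aer; have [i1 i2] := key _ _ mi mi' aei.
by split; [move=> [/r1 ? /i1 ?]|rewrite /cintegral r2 i2].
Qed.

Lemma kernel_ae G G' C : cmeasurable G -> ae_equal G G' -> morrey_kernel G' C ->
  morrey_kernel G C.
Proof.
move=> mG GG' [mG' kG]; split => // f mf m fm.
have [i1 i2] := kG f mf m fm.
have [j1 j2] := cintegral_ae (cmeasurableM mG mf) (cmeasurableM mG' mf)
  (filterS (fun x (E : G x = G' x) => congr1 (fun t => t * f x) E) GG').
by split; [exact: j1|rewrite j2].
Qed.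

(** Synthesis gives some [G'], a priori unrelated to [G] pointwise. Both have the same pairings with
    flat test functions, as limits of the same partial sums, hence they agree almost everywhere and
    [G] inherits the estimate. *)
Lemma H_fun_kernel G (h : I -> V -> R[i]) C : regular_on_schwartz G ->
  H_representation (function_distr G) h -> (H_sum rho q w h <= C%:E)%E ->
  morrey_kernel G (4 * C).
Proof.
move=> [lG GS] [mh hQ hG] hC.
have [G' [mG' GP]] := csynthesis mh hQ hC.
have kG' : morrey_kernel G' (4 * C).
  by split => // f mf m fm; have [] := GP f mf m fm.
have mG : cmeasurable G by case: lG => -[? _] [? _].
apply: (kernel_ae mG _ kG').
apply: ae_eq_of_cflat => //.
  exact: (kernel_clocally_integrable kG').
move=> g tg; have sg := schwartz_cflat tg.
have gL := cflat_Lpw tg.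
have [m gm] := Lpw_morrey_bounded gL; have [mg _] := gL.
have [ig _ cg] := GP g mg m gm.
split => //; first exact: GS.
have FF := @summability.totally_filter I.
exact: (cvg_unique (@norm_hausdorff _ (R[i]^o)) (hG g sg) cg).
Qed.

(** * The two directions of the duality *)

Lemma hnormD (h k : V -> R) : measurable_fun setT h -> measurable_fun setT k ->
  (hnorm v p (h \+ k)%R <= hnorm v p h + hnorm v p k)%E.
Proof.
move=> mh mk; have q1 : 1 <= q by rewrite ltW// conj_exp_gt1.
have := minkowski_EFin mu (measurable_hweight p mv mh) (measurable_hweight p mv mk) q1.
apply: le_trans; rewrite le_eqVlt; apply/orP; left; apply/eqP.
by apply: eq_Lnorm => x /=; rewrite mulrDl.
Qed.

(** The real and imaginary parts of [T] on real functions are real linear with bound [C] each, and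
    are represented by families [h1] and [h2]. The family [h1 + i h2] has sum at most [2 * C] and is
    synthesised to [G]. *)
Lemma dual_representation T (C : R) : linear_on X T -> 0 <= C ->
  (forall f (m : R), X f -> (N f <= m%:E)%E -> normc (T f) <= C * m) ->
  exists G, [/\ H_fun rho q w G, represents u w T G &
    (H_fun_norm rho q w G <= (2 * C)%:E)%E].
Proof.
move=> Tlin C0 TC.
pose toC (f : V -> R) : V -> R[i] := fun x => (f x)%:C%C.
have Z : in_Lp v u setT (cst 0).
  by apply: (@in_Lp_bounded_support _ _ _ _ v0 Apv _ 0 0) => // x; rewrite normr0.
have toCL (f : V -> R) : in_Lp v u setT f -> Lpw u w (toC f).
  by move=> fL; exact: (in_Lp_Lpw (f := toC f) fL Z).
have toCX (f : V -> R) : in_Lp v u setT f -> X (toC f) by move=> /toCL/(Lpw_morrey_closure).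
have Tadd (c : R) (f g : V -> R) : in_Lp v u setT f -> in_Lp v u setT g ->
    T (toC (fun x => c * f x + g x)) = c%:C%C * T (toC f) + T (toC g).
  move=> fL gL; rewrite -(Tlin _ _ _ (toCX _ fL) (toCX _ gL)); congr T.
  by apply/funext => x; rewrite /toC rmorphD rmorphM.
have Tm (f : V -> R) (m : R) : in_Lp v u setT f ->
    (forall JM, ((b JM)%:E * wnorm v p (Q JM) f <= m%:E)%E) -> normc (T (toC f)) <= C * m.
  move=> fL fm; apply: TC; first exact: toCX.
  have [mf _] := toCL _ fL; have [mfr _] := fL.
  apply/(morrey_normP m mf) => JM; apply: le_trans (fm JM).
  apply: lee_wpmul2l; first by rewrite lee_fin powR_ge0.
  apply: (le_wnorm v0 p0 mv (@measurable_dyadic_cube R n JM) (measurable_cnorm mf) mfr).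
  by move=> x _; rewrite /cnorm normc_real normr_id.
pose l1 (f : V -> R) := complex.Re (T (toC f)); pose l2 (f : V -> R) := complex.Im (T (toC f)).
have l1add (c : R) (f g : V -> R) : in_Lp v u setT f -> in_Lp v u setT g ->
    l1 (fun x => c * f x + g x) = c * l1 f + l1 g.
  move=> fL gL; rewrite /l1 (Tadd c _ _ fL gL).
  by case: (T (toC f)) => ? ?; case: (T (toC g)) => ? ? /=; rewrite mul0r subr0.
have l2add (c : R) (f g : V -> R) : in_Lp v u setT f -> in_Lp v u setT g ->
    l2 (fun x => c * f x + g x) = c * l2 f + l2 g.
  move=> fL gL; rewrite /l2 (Tadd c _ _ fL gL).
  by case: (T (toC f)) => ? ?; case: (T (toC g)) => ? ? /=; rewrite mul0r addr0.
have l1m (f : V -> R) (m : R) : in_Lp v u setT f ->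
    (forall JM, ((b JM)%:E * wnorm v p (Q JM) f <= m%:E)%E) -> `|l1 f| <= C * m.
  by move=> fL fm; apply: le_trans (ler_Re_normc _) (Tm f m fL fm).
have l2m (f : V -> R) (m : R) : in_Lp v u setT f ->
    (forall JM, ((b JM)%:E * wnorm v p (Q JM) f <= m%:E)%E) -> `|l2 f| <= C * m.
  by move=> fL fm; apply: le_trans (ler_Im_normc _) (Tm f m fL fm).
have [h1 [mh1 Qh1 Ch1 lh1]] := real_representation n0 p1 rp r0 rrho v0 Apv C0 l1add l1m.
have [h2 [mh2 Qh2 Ch2 lh2]] := real_representation n0 p1 rp r0 rrho v0 Apv C0 l2add l2m.
pose h JM : V -> R[i] := fun x => (h1 JM x +i* h2 JM x)%C.
have mh JM : cmeasurable (h JM) by split; [exact: mh1|exact: mh2].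
have Qh JM : {ae mu, forall x, ~ Q JM x -> h JM x = 0}.
  by apply: aeW => x xQ; rewrite /h Qh1// Qh2.
have hC : (H_sum rho q w h <= (2 * C)%:E)%E.
  rewrite (H_sumE mh).
  have t0 (k : I -> V -> R) JM : (0 <= (a JM)%:E * hnorm v p (k JM))%E.
    by rewrite mule_ge0 ?Lnorm_ge0// lee_fin powR_ge0.
  apply: (@le_trans _ _ (\esum_(JM in [set: I])
      ((a JM)%:E * hnorm v p (h1 JM) + (a JM)%:E * hnorm v p (h2 JM)))%E).
    apply: le_esum => JM _; rewrite -ge0_muleDr ?Lnorm_ge0//.
    apply: lee_wpmul2l; first by rewrite lee_fin powR_ge0.
    have mn1 : measurable_fun setT (fun x => `|h1 JM x|) by exact: measurableT_comp.
    have mn2 : measurable_fun setT (fun x => `|h2 JM x|) by exact: measurableT_comp.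
    have mc := measurable_cnorm (mh JM).
    apply: (le_trans (hnorm_le mc (measurable_funD mn1 mn2) _)).
      move=> x; rewrite [leRHS]ger0_norm ?addr_ge0// ger0_norm ?normc_ge0//.
      exact: ler_normc_ReIm.
    apply: (le_trans (hnormD mn1 mn2)); apply: leeD.
      by apply: (hnorm_le mn1 (mh1 JM)) => x; rewrite normr_id.
    by apply: (hnorm_le mn2 (mh2 JM)) => x; rewrite normr_id.
  rewrite esumD; [|by move=> JM _; exact: t0|by move=> JM _; exact: t0].
  by apply: (le_trans (leeD Ch1 Ch2)); rewrite -EFinD lee_fin; lra.
have [G [mG GP]] := csynthesis mh Qh hC.
have kG : morrey_kernel G (4 * (2 * C)).
  by split => // f mf m fm; have [] := GP f mf m fm.
have hrep : H_representation (function_distr G) h.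
  split => // phi sphi.
  have [_ [_ [_ /(_ phi sphi)[phiL _]]]] := schwartz_Lpw.
  have [m phim] := Lpw_morrey_bounded phiL; have [mphi _] := phiL.
  by have [] := GP phi mphi m phim.
have C80 : 0 <= 4 * (2 * C) by rewrite !mulr_ge0.
exists G; split.
- split; first exact: (kernel_regular kG).
  split; first exact: (kernel_tempered C80 kG).
  by exists h; split => //; apply: le_lt_trans hC _; rewrite ltry.
- move=> f fL; have [ig _] := kernel_represents kG fL; split => //.
  have [m fm] := Lpw_morrey_bounded fL; have [mf _] := fL.
  have [_ _ cg] := GP f mf m fm; have [rL iL] := Lpw_in_Lp fL.
  have FF := @summability.totally_filter I.
  (* Complex linearity recovers [T f] from its values on the real functions [re f] and [im f]. *)
  have TfE : T f = ((l1 (re f) - l2 (im f)) +i* (l1 (im f) + l2 (re f)))%C.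
    have fE : f = fun x => 'i%C * toC (im f) x + toC (re f) x.
      by apply/funext => x; rewrite /toC /re /im; case: (f x) => s t /=; simpc.
    rewrite {1}fE (Tlin _ _ _ (toCX _ iL) (toCX _ rL)) /l1 /l2.
    case: (T _) => ? ?; case: (T _) => ? ? /=; simpc; congr (_ +i* _)%C; ring.
  have bnd (g : V -> R) : in_Lp v u setT g -> exists k : R, forall JM,
      ((b JM)%:E * wnorm v p (Q JM) g <= k%:E)%E.
    move=> [mg goo]; exists (fine (wnorm v u setT g)) => JM.
    rewrite fineK; last by rewrite ge0_fin_numE ?wnorm_ge0.
    by have := morrey_le_wnormT p1 rp r0 v0 Apv JM mg; apply.
  have intg (k : I -> V -> R) (g : V -> R) JM : measurable_fun setT (k JM) ->
      (forall x, ~ Q JM x -> k JM x = 0) ->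
      (\esum_(JM in [set: I]) ((a JM)%:E * hnorm v p (k JM)) <= C%:E)%E ->
      in_Lp v u setT g -> mu.-integrable setT (fun x => (k JM x * g x)%:E).
    move=> mk Qk Ck gL; have [mg _] := gL; have [m' /(_ JM) gm'] := bnd _ gL.
    exact: (pairing_integrable mk mg (aeW _ Qk) (esum_term JM Ck) gm').
  have hE JM : function_distr (h JM) f =
      ((\int[mu]_x (h1 JM x * re f x) - \int[mu]_x (h2 JM x * im f x)) +i*
       (\int[mu]_x (h1 JM x * im f x) + \int[mu]_x (h2 JM x * re f x)))%C.
    apply: (@cintegralM (h JM) f _ _ _ _).2.
    - exact: (intg h1 _ JM (mh1 JM) (Qh1 JM) Ch1 rL).
    - exact: (intg h1 _ JM (mh1 JM) (Qh1 JM) Ch1 iL).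
    - exact: (intg h2 _ JM (mh2 JM) (Qh2 JM) Ch2 rL).
    - exact: (intg h2 _ JM (mh2 JM) (Qh2 JM) Ch2 iL).
  apply: (cvg_unique (@norm_hausdorff _ (R[i]^o)) _ cg); rewrite TfE.
  apply: cvg_complex.
    apply: cvg_trans (cvgB (lh1 _ rL) (lh2 _ iL)); apply: near_eq_cvg; apply: nearW => B.
    rewrite -[LHS]/(summability.partial_sum _ B - summability.partial_sum _ B).
    rewrite /summability.partial_sum -sumrB [RHS]raddf_sum; apply: eq_bigr => JM _.
    by rewrite hE.
  apply: cvg_trans (cvgD (lh1 _ iL) (lh2 _ rL)); apply: near_eq_cvg; apply: nearW => B.
  rewrite -[LHS]/(summability.partial_sum _ B + summability.partial_sum _ B).
  rewrite /summability.partial_sum -big_split [RHS]raddf_sum; apply: eq_bigr => JM _.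
  by rewrite hE.
- by apply: le_trans hC; apply: ereal_inf_lbound; exists h.
Qed.

Lemma representation_unique T G G' : H_fun rho q w G -> H_fun rho q w G' ->
  represents u w T G -> represents u w T G' -> ae_equal G G'.
Proof.
move=> [[lG _] _] [[lG' _] _] TG TG'; apply: ae_eq_of_cflat => // g tg.
have gL := cflat_Lpw tg.
have [iG gE] := TG _ gL; have [iG' gE'] := TG' _ gL; split => //.
by rewrite -gE -gE'.
Qed.

(** Functions that agree almost everywhere define the same distribution on S, so each representation
    of one represents the other. *)
Lemma H_fun_norm_ae G G' : H_fun rho q w G -> H_fun rho q w G' -> ae_equal G G' ->
  (H_fun_norm rho q w G' <= H_fun_norm rho q w G)%E.
Proof.
move=> [[[[mGr _] [mGi _]] _] _] [[[[mGr' _] [mGi' _]] _] _] GG'.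
rewrite /H_fun_norm /H_norm; apply: le_ereal_inf.
move=> _ [h [mh hQ hG] <-]; exists h; [split; [exact: mh|exact: hQ|]|by []] => phi sphi.
have mphi : cmeasurable phi by case: sphi => /csmooth_measurable.
have mG : cmeasurable G by split.
have mG' : cmeasurable G' by split.
have -> : function_distr G' phi = function_distr G phi.
  have [_ E] := cintegral_ae (cmeasurableM mG mphi) (cmeasurableM mG' mphi)
    (filterS (fun x (E : G x = G' x) => congr1 (fun t => t * phi x) E) GG').
  exact/esym/E.
exact: hG.
Qed.

Lemma H_sum_ge0 (h : I -> V -> R[i]) : (0 <= H_sum rho q w h)%E.
Proof.
by apply: esum_ge0 => JM _; rewrite mule_ge0 ?Lnorm_ge0// lee_fin powR_ge0.
Qed.

Lemma H_fun_functional G : H_fun rho q w G ->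
  exists T, [/\ dual X N T, represents u w T G &
    forall T', dual X N T' -> represents u w T' G -> forall f, X f -> T' f = T f].
Proof.
move=> [rG [_ [h [hrep hoo]]]].
have hfin : H_sum rho q w h \is a fin_num by rewrite ge0_fin_numE ?H_sum_ge0.
have hC : (H_sum rho q w h <= (fine (H_sum rho q w h))%:E)%E by rewrite fineK.
have C0 : 0 <= 4 * fine (H_sum rho q w h) by rewrite mulr_ge0 ?fine_ge0 ?H_sum_ge0.
have kG := H_fun_kernel rG hrep hC.
have TG := kernel_represents kG.
have dT := kernel_dual C0 kG.
exists (fun f => cintegral setT (fun x => G x * f x)); split => //.
move=> T' dT' TG'; apply: (dual_ext dT' dT) => f fL.
by have [_ ->] := TG' f fL.
Qed.

(** Every representation of [G] with finite sum makes [G] a kernel with constant four times that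
    sum, and [T] is the pairing with [G] by density. The infimum over representations is taken
    afterwards. *)
Lemma dual_norm_le G T : dual X N T -> represents u w T G -> H_fun rho q w G ->
  ((4^-1)%:E * dual_norm X N T <= H_fun_norm rho q w G)%E.
Proof.
move=> dT TG [rG _]; rewrite /H_fun_norm /H_norm; apply: le_ereal_inf_tmp => _ [h hrep <-].
have [hoo|] := ltP (H_sum rho q w h) +oo%E; last by rewrite leye_eq => /eqP ->; rewrite leey.
have hfin : H_sum rho q w h \is a fin_num by rewrite ge0_fin_numE ?H_sum_ge0.
have hC : (H_sum rho q w h <= (fine (H_sum rho q w h))%:E)%E by rewrite fineK.
have C0 : 0 <= 4 * fine (H_sum rho q w h) by rewrite mulr_ge0 ?fine_ge0 ?H_sum_ge0.
have kG := H_fun_kernel rG hrep hC.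
have dT' := kernel_dual C0 kG.
have TE f : X f -> T f = cintegral setT (fun x => G x * f x).
  move: f; apply: (dual_ext dT dT') => f fL.
  by have [_ ->] := TG f fL.
have DC : (dual_norm X N T <= (4 * fine (H_sum rho q w h))%:E)%E.
  apply: ge_ereal_sup => _ [f [Xf Nf] <-]; rewrite lee_fin (TE f Xf).
  have [_ /(_ _ (morrey_closure_measurable Xf) _ Nf)[_]] := kG.
  by rewrite mulr1.
apply: (@le_trans _ _ ((4^-1)%:E * (4 * fine (H_sum rho q w h))%:E)%E).
  by apply: lee_wpmul2l => //; rewrite lee_fin invr_ge0.
by rewrite -EFinM mulKf ?pnatr_eq0// fineK.
Qed.

(** The estimate is known for the representing function constructed from [T]; uniqueness transfers
    it to the given one. *)
Lemma H_fun_norm_le G T : dual X N T -> represents u w T G -> H_fun rho q w G ->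
  (H_fun_norm rho q w G <= 2%:E * dual_norm X N T)%E.
Proof.
move=> dT TG hG; have [D [D0 DE DP]] := dual_normE dT.
have [G' [hG' TG' nG']] :=
  dual_representation dT.1 D0 DP.
rewrite DE -EFinM; apply: le_trans nG'.
by apply: H_fun_norm_ae => //; exact: representation_unique TG' TG.
Qed.

End complex_valued.

(** * Reduction to an everywhere positive weight, and the duality theorem *)

Section positive_representative.
Context {R : realType} {n : nat}.
Notation V := 'rV[R]_n.
Notation mu := (lebesgue_rV n : {measure set V -> \bar R}).

(** The weight is set to 1 where it is not positive, a null set. Identities such as
    [w^a * w^(-a) = 1] then hold at every point. *)
Lemma Ap_positive (w : V -> R) (p : R) : Ap p w ->
  exists v : V -> R, [/\ forall x, 0 < v x, Ap p v & {ae mu, forall x, w x = v x}].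
Proof.
move=> [[mw lw] w0 wA]; pose v x := if 0 < w x then w x else 1.
have v0 x : 0 < v x by rewrite /v; case: ifP.
have wv : {ae mu, forall x, w x = v x} by apply: filterS w0 => x; rewrite /v => ->.
have mv : measurable_fun setT v.
  apply: measurable_fun_ifT => //.
  by apply: measurable_fun_ltr.
exists v; split; [exact: v0| |exact: wv]; split.
- split => // K cK; have mK := compact_measurable_rV cK.
  have /integrableP[_ woo] := lw K cK; apply/integrableP; split.
    by apply/measurable_EFinP; exact: measurable_funTS.
  apply: le_lt_trans woo; rewrite le_eqVlt; apply/orP; left; apply/eqP.
  apply: ae_eq_integral => //.
  - by apply: measurableT_comp => //; apply/measurable_EFinP; exact: measurable_funTS.
  - by apply: measurableT_comp => //; apply/measurable_EFinP; exact: measurable_funTS.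
  - by apply: filterS wv => x /= ->.
- exact: aeW.
- suff E : (fun c l => Ap_product p v (cube c l)) = fun c l => Ap_product p w (cube c l).
    by rewrite E.
  apply/funext => c; apply/funext => l.
  have mC := measurable_cube c l.
  rewrite /Ap_product; congr (_ * _ * (_ * _) `^ _)%E.
    apply: ae_eq_integral => //; [by apply/measurable_EFinP; exact: measurable_funTS..|].
    by apply: filterS wv => x /= ->.
  apply: ae_eq_integral => //.
  - by apply/measurable_EFinP/measurable_funTS; exact: measurableT_comp (measurable_powR _) mv.
  - by apply/measurable_EFinP/measurable_funTS; exact: measurableT_comp (measurable_powR _) mw.
  - by apply: filterS wv => x /= ->.
Qed.

End positive_representative.

Theorem theorem4p8 (R : realType) (n : nat) (p r rho : R) (w : 'rV[R]_n -> R) :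
  (0 < n)%N -> 1 < p -> - (n%:R / p) < r -> r < 0 -> r + rho = - n%:R ->
  Ap p w ->
  let X := morrey_closure r p w in
  let X_norm := morrey_norm r p w in
  let q := conj_exp p in
  let u := - (n%:R / r) in
  [/\ forall g, dual X X_norm g ->
        exists gt, [/\ H_fun rho q w gt, represents u w g gt &
          forall gt', H_fun rho q w gt' -> represents u w g gt' ->
            ae_equal gt gt'],
      forall gt, H_fun rho q w gt ->
        exists g, [/\ dual X X_norm g, represents u w g gt &
          forall g', dual X X_norm g' -> represents u w g' gt ->
            forall f, X f -> g' f = g f] &
      exists c C : R, [/\ 0 < c, 0 < C &
        forall g gt, dual X X_norm g -> H_fun rho q w gt ->
          represents u w g gt ->
          (c%:E * dual_norm X X_norm g <= H_fun_norm rho q w gt)%E /\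
          (H_fun_norm rho q w gt <= C%:E * dual_norm X X_norm g)%E]].

Proof.
move=> n0 p1 rp r0 rrho Apw X N q u.
have [v [v0 Apv wv]] := Ap_positive Apw; have mw := measurable_weight Apw.
split.
- move=> g dg; have [D [D0 _ DP]] := dual_normE p1 rp r0 v0 Apv mw wv dg.
  have [G [hG gG _]] := dual_representation n0 p1 rp r0 rrho v0 Apv mw wv dg.1 D0 DP.
  exists G; split => // G' hG' gG'.
  exact: (representation_unique p1 rp r0 v0 Apv mw wv hG hG' gG gG').
- by move=> G hG; exact: (H_fun_functional n0 p1 rp r0 rrho v0 Apv mw wv hG).
(* The first constant comes from the four real products in the pairing, the second from the two real
   functionals into which [g] splits. *)
- exists 4^-1, 2; split=> [||g G dg hG gG]; [by rewrite invr_gt0|by []|split].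
    exact: (dual_norm_le n0 p1 rp r0 rrho v0 Apv mw wv dg gG hG).
  exact: (H_fun_norm_le n0 p1 rp r0 rrho v0 Apv mw wv dg gG hG).
Qed.
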